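(* Let $A$ be a minimax abelian group and let $S\le A$. Then: (i) $S$ is in the scattered part of $\mathcal{S}(A)$ if and only if $\kappa_{\mathrm{cr}(A)}(A/S)=\ell_{\mathrm{cr}(A)}(S)=0$; (ii) the extended Cantor-Bendixson rank of $S$ in $\mathcal{S}(A)$ is $d_A(S)$, where $$d_A(S)=\gamma_{\mathrm{ncr}(A)}(A/S)+\kappa_{\mathrm{ncr}(A)}(A/S)+\ell_{\mathrm{ncr}(A)}(S).$$
   Context: For an abelian group $A$, $\mathcal{S}(A)$ denotes the set of all subgroups of $A$, with the topology induced by the product topology on $2^A$. An abelian group is Artinian if every non-increasing sequence of subgroups stabilizes. An abelian group $A$ is minimax if it has a finitely generated subgroup $Z$ with $A/Z$ Artinian; subgroups and quotients of minimax groups are minimax. For a prime $p$, $C_{p^\infty}=\mathbf{Z}[1/p]/\mathbf{Z}$. For $B$ minimax with torsion subgroup $T_B$ and $p$ prime, $\ell_p(B)$ is the largest integer $k$ such that $B$ maps onto $C_{p^\infty}^k$, and $\kappa_p(B)=\ell_p(B/T_B)$; for a set $V$ of primes, $\ell_V(B)=\sum_{p\in V}\ell_p(B)$ and $\kappa_V(B)=\sum_{p\in V}\kappa_p(B)$. $r(B)=\dim_{\mathbf{Q}}(B\otimes_{\mathbf{Z}}\mathbf{Q})$. $\mathrm{cr}(A)$ is the set of primes $p$ with $\ell_p(A)\ge 2$ (critical primes of $A$), and $\mathrm{ncr}(A)$ is the set of the other primes. For a set $V$ of primes, with complement $V^c$ in the set of all primes, $R_V\subset\mathbf{Q}$ is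 the ring of rationals whose denominator is divisible by no $p\in V$; $U_V(B)$ is the intersection of the kernels of all homomorphisms $B\to R_V$; $\gamma_{V^c}(B)=r(B/U_V(B))$. Thus $\gamma_{\mathrm{ncr}(A)}(A/S)=r\bigl((A/S)/U_{\mathrm{cr}(A)}(A/S)\bigr)$. Topology: a space is perfect if it has no isolated point. The condensation part $\mathrm{Cond}(X)$ of a space $X$ is its largest perfect subset, and the scattered part of $X$ is $X-\mathrm{Cond}(X)$. Let $X^{(0)}=X$ and let $X^{(n+1)}$ be the set of non-isolated points of $X^{(n)}$. If $x\in X^{(n)}-X^{(n+1)}$, the Cantor-Bendixson rank of $x$ in $X$ is $\mathrm{CB}_X(x)=n$ (and we write $\mathrm{CB}_X(x)<\infty$). When these ranks are bounded (as is the case for $X=\mathcal{S}(A)$), the extended Cantor-Bendixson rank of any $x\in X$ is $\inf_V\sup\{\mathrm{CB}_X(y): y\in V,\ \mathrm{CB}_X(y)<\infty\}$, where $V$ ranges over all neighbourhoods of $x$ and $\sup\emptyset=-\infty$. *)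

(* Defs.v *)
From HB Require Import structures.
From mathcomp Require Import all_boot all_order all_algebra.
From mathcomp Require Import generic_quotient.
From mathcomp Require Import all_classical all_reals.
From mathcomp Require Import ereal topology.

Set Implicit Arguments.
Unset Strict Implicit.
Unset Printing Implicit Defensive.

Import Order.TTheory GRing.Theory Num.Theory.
Local Open Scope classical_set_scope.
Local Open Scope ring_scope.
Local Open Scope quotient_scope.

(* Abelian groups are zmodTypes and a subgroup of A is a zmodClosed A.  The
   quotient of A by H is the library's {ideal_quot H}. *)

Section Subgroup.
Variables (A : zmodType) (H : zmodClosed A).

Definition subgroup_type : Type := {x : A | x \in H}.

HB.instance Definition _ := SubChoice.on subgroup_type.
HB.instance Definition _ := [SubChoice_isSubZmodule of subgroup_type by <:].

End Subgroup.

Definition finitely_generated (A : zmodType) (H : zmodClosed A) :=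
  exists s : seq A, {subset s <= H} /\
    forall K : zmodClosed A, {subset s <= K} -> {subset H <= K}.

Definition artinian (A : zmodType) :=
  forall G : nat -> zmodClosed A, (forall n, {subset G n.+1 <= G n}) ->
  exists N, forall n, (N <= n)%N -> G n =i G N.

Definition minimax (A : zmodType) :=
  exists Z : zmodClosed A, finitely_generated Z /\ artinian {ideal_quot Z}.

Section Zinv.
Variable p : nat.

Definition Zinv_pred : {pred rat} :=
  [pred q | `[< exists n : nat, q * p%:R ^+ n \is a Num.int >]].

Fact Zinv_zmod_closed : zmod_closed Zinv_pred.
Proof.
split=> [|x y]; first by apply/asboolP; exists 0%N; rewrite mul0r.
move=> /asboolP[m xm] /asboolP[n yn]; apply/asboolP; exists (m + n)%N.
rewrite mulrBl {1}exprD mulrA addnC exprD mulrA.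
by rewrite rpredB // rpredM // rpredX // natr_int.
Qed.
HB.instance Definition _ := GRing.isZmodClosed.Build rat Zinv_pred
  Zinv_zmod_closed.

Definition Zinv : zmodType := subgroup_type Zinv_pred.

Definition Zinv_int : {pred Zinv} := [pred x | \val x \is a Num.int].

Fact Zinv_int_zmod_closed : zmod_closed Zinv_int.
Proof.
split=> [|x y]; rewrite !inE ?rpred0 //.
by move=> xZ yZ; rewrite raddfB rpredB.
Qed.
HB.instance Definition _ := GRing.isZmodClosed.Build Zinv Zinv_int
  Zinv_int_zmod_closed.

(* C_{p^oo} = Z[1/p] / Z *)
Definition quasicyclic : zmodType := {ideal_quot Zinv_int}.

End Zinv.

(* 0 when P is empty or unbounded; the set used in ell below contains 0, and it
   is bounded when B is minimax. *)
Definition largest (P : set nat) : nat :=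
  xget 0%N [set k | P k /\ forall j, P j -> (j <= k)%N].

Definition ell (p : nat) (B : zmodType) : nat :=
  largest [set k | exists f : {additive B -> {ffun 'I_k -> quasicyclic p}},
                     forall y, exists x, f x = y].

Section Torsion.
Variable B : zmodType.

Definition torsion : {pred B} :=
  [pred x | `[< exists n, (0 < n)%N /\ x *+ n = 0 >]].

Fact torsion_zmod_closed : zmod_closed torsion.
Proof.
split=> [|x y]; first by apply/asboolP; exists 1%N.
move=> /asboolP[m [m0 xm]] /asboolP[n [n0 yn]]; apply/asboolP.
exists (m * n)%N; rewrite muln_gt0 m0 n0; split=> //.
by rewrite mulrnBl mulrnA xm mul0rn mulnC mulrnA yn mul0rn subr0.
Qed.
HB.instance Definition _ := GRing.isZmodClosed.Build B torsion
  torsion_zmod_closed.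

End Torsion.

Definition kappa (p : nat) (B : zmodType) : nat :=
  ell p {ideal_quot (@torsion B)}.

(* These sums run over possibly infinite sets of primes; the notation sums the
   nonzero terms, which are finitely many when B is minimax. *)
Definition ell_sum (V : set nat) (B : zmodType) : nat :=
  \sum_(p \in V) ell p B.

Definition kappa_sum (V : set nat) (B : zmodType) : nat :=
  \sum_(p \in V) kappa p B.

(* The tensor product B (x)_Z Q: formal sums of pure tensors (b, q), up to the
   congruence generated by commutativity and biadditivity. *)
Inductive tensor_eq (B : zmodType) : seq (B * rat) -> seq (B * rat) -> Prop :=
| tensor_refl s : tensor_eq s s
| tensor_sym s t : tensor_eq s t -> tensor_eq t s
| tensor_trans s t u : tensor_eq s t -> tensor_eq t u -> tensor_eq s u
| tensor_cat s s' t t' :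
    tensor_eq s s' -> tensor_eq t t' -> tensor_eq (s ++ t) (s' ++ t')
| tensor_catC s t : tensor_eq (s ++ t) (t ++ s)
| tensor_0l q : tensor_eq [:: (0, q)] [::]
| tensor_0r b : tensor_eq [:: (b, 0)] [::]
| tensor_Dl b b' q : tensor_eq [:: (b + b', q)] [:: (b, q); (b', q)]
| tensor_Dr b q q' : tensor_eq [:: (b, q + q')] [:: (b, q); (b, q')].

Section TensorQ.
Variable B : zmodType.
Implicit Types s t : seq (B * rat).

Definition tensor_rel : rel (seq (B * rat)) := fun s t => `[< tensor_eq s t >].

Fact tensor_equiv : equiv_class_of tensor_rel.
Proof.
split=> [s|s t|t s u].
- exact/asboolP/tensor_refl.
- by apply/asboolP/asboolP; apply: tensor_sym.
- by move=> /asboolP st /asboolP tu; apply/asboolP/(tensor_trans st).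
Qed.
Canonical tensor_equiv_rel := EquivRelPack tensor_equiv.
Canonical tensor_encModRel := defaultEncModRel tensor_rel.

Definition tensorQ : Type := {eq_quot tensor_rel}.
HB.instance Definition _ : EqQuotient _ tensor_rel tensorQ :=
  EqQuotient.on tensorQ.
HB.instance Definition _ := Choice.on tensorQ.

Fact tensorQP s t : tensor_eq s t <-> \pi_tensorQ s = \pi_tensorQ t.
Proof.
split=> [st|/eqP]; first by apply/eqP; rewrite piE; apply/asboolP.
by rewrite piE => /asboolP.
Qed.

Fact tensor_repr s : tensor_eq (repr (\pi_tensorQ s)) s.
Proof. by apply/tensorQP; rewrite reprK. Qed.

Fact tensor_map (f : B * rat -> B * rat) s t :
  (forall q, tensor_eq [:: f (0, q)] [::]) ->
  (forall b, tensor_eq [:: f (b, 0)] [::]) ->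
  (forall b b' q, tensor_eq [:: f (b + b', q)] [:: f (b, q); f (b', q)]) ->
  (forall b q q', tensor_eq [:: f (b, q + q')] [:: f (b, q); f (b, q')]) ->
  tensor_eq s t -> tensor_eq (map f s) (map f t).
Proof.
move=> f0l f0r fDl fDr; elim=> /=.
- by move=> ?; apply: tensor_refl.
- by move=> ? ? _; apply: tensor_sym.
- by move=> ? ? ? _ st _; apply: tensor_trans.
- by move=> ? ? ? ? _ ss' _ tt'; rewrite !map_cat; apply: tensor_cat.
- by move=> ? ?; rewrite !map_cat; apply: tensor_catC.
- exact: f0l.
- exact: f0r.
- exact: fDl.
- exact: fDr.
Qed.

Fact tensor_perm s t : perm_eq s t -> tensor_eq s t.
Proof.
elim: s t => [|x s IHs] t.
  by rewrite perm_sym => /perm_nilP ->; apply: tensor_refl.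
move=> st; have xt : x \in t by rewrite -(perm_mem st) mem_head.
case/splitPr: xt st => t1 t2; rewrite perm_sym -cat1s perm_catCA /= perm_cons.
rewrite perm_sym => /IHs st; rewrite -[x :: s]cat1s -[x :: t2]cat1s.
apply: (tensor_trans (tensor_cat (tensor_refl _) st)); rewrite !catA.
by apply: tensor_cat (tensor_catC _ _) (tensor_refl _).
Qed.

Let opp1 (x : B * rat) := (- x.1, x.2).
Let scale1 (a : rat) (x : B * rat) := (x.1, a * x.2).

Fact tensor_opp s t :
  tensor_eq s t -> tensor_eq (map opp1 s) (map opp1 t).
Proof.
apply: tensor_map => [q|b|b b' q|b q q']; rewrite /opp1 /=.
- by rewrite oppr0; apply: tensor_0l.
- exact: tensor_0r.
- by rewrite opprD; apply: tensor_Dl.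
- exact: tensor_Dr.
Qed.

Fact tensor_scale a s t :
  tensor_eq s t -> tensor_eq (map (scale1 a) s) (map (scale1 a) t).
Proof.
apply: tensor_map => [q|b|b b' q|b q q']; rewrite /scale1 /=.
- exact: tensor_0l.
- by rewrite mulr0; apply: tensor_0r.
- exact: tensor_Dl.
- by rewrite mulrDr; apply: tensor_Dr.
Qed.

Definition tensor_zero : tensorQ := \pi_tensorQ [::].
Definition tensor_add (x y : tensorQ) : tensorQ :=
  \pi_tensorQ (repr x ++ repr y).
Definition tensor_neg (x : tensorQ) : tensorQ :=
  \pi_tensorQ (map opp1 (repr x)).
Definition tensor_scaling (a : rat) (x : tensorQ) : tensorQ :=
  \pi_tensorQ (map (scale1 a) (repr x)).

Fact tensor_add_pi s t :
  tensor_add (\pi_tensorQ s) (\pi_tensorQ t) = \pi_tensorQ (s ++ t).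
Proof. by apply/tensorQP/tensor_cat; apply: tensor_repr. Qed.

Fact tensor_neg_pi s : tensor_neg (\pi_tensorQ s) = \pi_tensorQ (map opp1 s).
Proof. by apply/tensorQP/tensor_opp/tensor_repr. Qed.

Fact tensor_scaling_pi a s :
  tensor_scaling a (\pi_tensorQ s) = \pi_tensorQ (map (scale1 a) s).
Proof. by apply/tensorQP/tensor_scale/tensor_repr. Qed.

Fact tensor_addA : associative tensor_add.
Proof.
elim/quotW=> s; elim/quotW=> t; elim/quotW=> u.
rewrite (tensor_add_pi t u) (tensor_add_pi s t).
by rewrite (tensor_add_pi s (t ++ u)) (tensor_add_pi (s ++ t) u) catA.
Qed.

Fact tensor_addC : commutative tensor_add.
Proof. by move=> x y; apply/tensorQP/tensor_catC. Qed.

Fact tensor_add0 : left_id tensor_zero tensor_add.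
Proof. by elim/quotW=> s; rewrite (tensor_add_pi [::] s). Qed.

Fact tensor_addN : left_inverse tensor_zero tensor_neg tensor_add.
Proof.
elim/quotW=> s; rewrite tensor_neg_pi (tensor_add_pi _ s); apply/tensorQP.
elim: s => [|[b q] s IHs]; first exact: tensor_refl.
apply: (tensor_trans (t := [:: (- b, q); (b, q)] ++ (map opp1 s ++ s))).
  by apply: tensor_perm; rewrite /= perm_cons -[_ :: s]cat1s perm_catCA.
apply: (tensor_cat (s' := [::]) (t' := [::])) IHs.
apply: tensor_trans (tensor_sym (tensor_Dl _ _ _)) _.
by rewrite addNr; apply: tensor_0l.
Qed.

HB.instance Definition _ := GRing.isZmodule.Build tensorQ
  tensor_addA tensor_addC tensor_add0 tensor_addN.

Fact tensor_scaleA a b x :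
  tensor_scaling a (tensor_scaling b x) = tensor_scaling (a * b) x.
Proof.
elim/quotW: x => s; rewrite (tensor_scaling_pi b s).
rewrite (tensor_scaling_pi _ s) (tensor_scaling_pi a) -map_comp; congr (\pi _).
by apply: eq_map => -[c q]; rewrite /scale1 /= mulrA.
Qed.

Fact tensor_scale1 : left_id 1 tensor_scaling.
Proof.
elim/quotW=> s; rewrite (tensor_scaling_pi 1 s); congr (\pi _).
by apply: map_id_in => -[c q] _; rewrite /scale1 /= mul1r.
Qed.

Fact tensor_scaleDr : right_distributive tensor_scaling +%R.
Proof.
move=> a; elim/quotW=> s; elim/quotW=> t.
have addE (x y : tensorQ) : x + y = tensor_add x y by [].
rewrite !addE (tensor_add_pi s t).
rewrite (tensor_scaling_pi a s) (tensor_scaling_pi a t).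
by rewrite (tensor_scaling_pi a (s ++ t)) map_cat -tensor_add_pi.
Qed.

Fact tensor_scaleDl x : {morph tensor_scaling^~ x : a b / a + b}.
Proof.
move=> a b; elim/quotW: x => s.
have addE (x y : tensorQ) : x + y = tensor_add x y by [].
rewrite addE (tensor_scaling_pi a s) (tensor_scaling_pi b s).
rewrite (tensor_scaling_pi (a + b) s) tensor_add_pi; apply/tensorQP.
elim: s => [|[c q] s IHs]; first exact: tensor_refl.
apply: (tensor_trans (t := [:: (c, a * q); (c, b * q)] ++
                       (map (scale1 a) s ++ map (scale1 b) s))); last first.
  apply: tensor_perm; rewrite /= perm_cons.
  by rewrite -[_ :: map (scale1 b) s]cat1s perm_sym perm_catCA.
rewrite map_cons -cat1s; apply: tensor_cat IHs.
by rewrite /scale1 /= mulrDl; apply: tensor_Dr.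
Qed.

HB.instance Definition _ := GRing.Zmodule_isLmodule.Build rat tensorQ
  tensor_scaleA tensor_scale1 tensor_scaleDr tensor_scaleDl.

End TensorQ.

(* dim_Q (B (x)_Z Q), where Vector.axiom n V says that V is linearly isomorphic
   to 'rV_n; 0 if this dimension is infinite, which minimax groups exclude. *)
Definition rank (B : zmodType) : nat :=
  xget 0%N [set n | inhabited (Vector.axiom n (tensorQ B))].

Section Localization.
Variable V : set nat.

Definition Rloc_pred : {pred rat} :=
  [pred q | `[< forall p, prime p -> V p -> ~~ (p %| `|denq q|)%N >]].

Fact Rloc_zmod_closed : zmod_closed Rloc_pred.
Proof.
have dvd_denq (x : rat) (m : int) :
    x * m%:~R \is a Num.int -> (denq x %| m)%Z.
  move=> /intrP[k xm]; have : numq x * m = k * denq x.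
    apply: (@intr_inj rat); rewrite !intrM -xm numqE.
    by rewrite -!mulrA [_%:~R * m%:~R]mulrC.
  move=> E; have : (denq x %| numq x * m)%Z by rewrite E dvdz_mull.
  by rewrite Gauss_dvdzr // coprimezE coprime_sym coprime_num_den.
split=> [|x y].
  apply/asboolP => p p_pr _; rewrite (_ : denq 0 = 1) // dvdn1.
  by apply: contraTneq p_pr => ->.
move=> /asboolP xV /asboolP yV; apply/asboolP => p p_pr pV.
have : (denq (x - y) %| denq x * denq y)%Z.
  apply: dvd_denq; rewrite intrM mulrBl mulrA -numqE [X in y * X]mulrC mulrA.
  by rewrite -numqE rpredB // rpredM // intr_int.
rewrite dvdzE abszM => dxy; apply/negP => /dvdn_trans /(_ dxy).
by rewrite Euclid_dvdM // (negPf (xV p p_pr pV)) (negPf (yV p p_pr pV)).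
Qed.
HB.instance Definition _ := GRing.isZmodClosed.Build rat Rloc_pred
  Rloc_zmod_closed.

(* The additive group of the ring R_V. *)
Definition Rloc : zmodType := subgroup_type Rloc_pred.

Variable B : zmodType.

Definition Uker : {pred B} :=
  [pred x | `[< forall f : {additive B -> Rloc}, f x = 0 >]].

Fact Uker_zmod_closed : zmod_closed Uker.
Proof.
split=> [|x y]; first by apply/asboolP => f; rewrite raddf0.
move=> /asboolP xU /asboolP yU; apply/asboolP => f.
by rewrite raddfB xU yU subrr.
Qed.
HB.instance Definition _ := GRing.isZmodClosed.Build B Uker Uker_zmod_closed.

End Localization.

Definition primes_set : set nat := [set p | prime p].

(* gamma_W for W = V^c: the quotient is by U_V with V the complement of W. *)
Definition gamma (W : set nat) (B : zmodType) : nat :=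
  rank {ideal_quot (@Uker (primes_set `\` W) B)}.

Definition cr (A : zmodType) : set nat :=
  [set p | prime p /\ (2 <= ell p A)%N].

Definition ncr (A : zmodType) : set nat := primes_set `\` cr A.

Section CantorBendixson.
Variable X : topologicalType.

(* P is perfect for the induced topology; P is not required to be closed. *)
Definition perfect (P : set X) := isolated P = set0.

Definition condensation : set X := \bigcup_(P in perfect) P.

Fact condensation_perfect : perfect condensation.
Proof.
apply/seteqP; split=> // x [/set_mem[P perfP Px] [U xU UC]].
have : isolated P x.
  split; first exact/mem_set.
  exists U => //; apply/seteqP; split=> [y [Uy Py]|y ->].
    by rewrite -UC; split=> //; exists P.
  by split=> //; apply: nbhs_singleton.
by rewrite perfP.
Qed.

Definition scattered : set X := ~` condensation.

Fixpoint derived (n : nat) : set X :=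
  if n is m.+1 then derived m `\` isolated (derived m) else setT.

Definition has_CB_rank (x : X) (n : nat) :=
  (derived n `\` derived n.+1) x.

(* R only serves to take values in the extended line \bar R. *)
Definition extended_CB_rank (R : realType) (x : X) : \bar R :=
  ereal_inf [set ereal_sup [set n%:R%:E | n in
    [set n | exists2 y, V y & has_CB_rank y n]] | V in nbhs x].

End CantorBendixson.

Arguments scattered {X}.

Section SubgroupSpace.
Variable A : zmodType.

Definition is_subgroup : set {ptws A -> bool} :=
  [set H | zmod_closed (H : {pred A})].

(* S(A): the subspace topology of the product topology on 2^A. *)
Definition subgroups : Type := is_subgroup.
HB.instance Definition _ := Topological.on subgroups.

Definition mem_subgroup (S : subgroups) : {pred A} := \val S.

Fact mem_subgroup_zmod_closed S : zmod_closed (mem_subgroup S).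
Proof. exact: (set_mem (valP S)). Qed.
HB.instance Definition _ S := GRing.isZmodClosed.Build A (mem_subgroup S)
  (mem_subgroup_zmod_closed S).

End SubgroupSpace.

Section dA.
Variables (A : zmodType) (S : subgroups A).
Let AmodS : zmodType := {ideal_quot (mem_subgroup S)}.

Definition dA : nat :=
  (gamma (ncr A) AmodS + kappa_sum (ncr A) AmodS
   + ell_sum (ncr A) (subgroup_type (mem_subgroup S)))%N.

End dA.

(* Main.v *)
Require Import Defs.
From HB Require Import structures.
From mathcomp Require Import all_boot all_order all_algebra.
From mathcomp Require Import generic_quotient.
From mathcomp Require Import all_classical all_reals.
From mathcomp Require Import ereal topology function_spaces.
From mathcomp Require Import zify.

(* Write l_p(G/H) for the largest k such that G/H maps onto C_{p^oo}^k.  Since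
   C_{p^oo} is injective, l_p is additive in chains of subgroups of A.  Let I be
   the isolator of S (all x with a positive multiple in S) and put
   w_p(S) = l_p(S) + l_p(A/I) = kappa_p(A/S) + l_p(S) = l_p(A) - l_p(I/S).
   Then d_A(S) = gamma(A/S) + sum of the w_p(S) over noncritical p, where
   w_p(S) <= 1; the claimed scattered part consists of the S with w_p(S) = 0 for
   all critical p, and there gamma(A/S) is the rank of A/S.
   Upper semicontinuity of d_A: S contains a finitely generated L with S/L
   torsion, and every T close to S contains L.  If w_p(S) = 0, the torsion of
   A/L over p contains C_{p^oo}^(l_p(A)) up to a finite group, and excluding
   finitely many elements from T forces w_p(T) = 0.  If S is in the claimed
   scattered part and d_A(T) = d_A(S), then T has the same isolator as S and the
   same p-primary part modulo L for each of the finitely many relevant p, so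
   T = S.
   Approximation: if S maps onto C_{p^oo} then S is the limit of the preimages of
   its finite subgroups, which lowers w_p by one; if U contains I and A/U is
   torsion-free, then S is the limit of subgroups T = S + n T1 having isolator U,
   where T1/S meets I/S in a finite group and n is a fixed integer times a large
   power of a prime l with l_l(A) = 0; finally, S may be replaced by the graph
   of a small homomorphism C_{p^oo} -> A/S.  These lower the rank one step at a time, show
   that the complement of the claimed scattered part has no isolated point, and
   approximate every S by scattered subgroups of the same d_A. *)

Set Implicit Arguments.
Unset Strict Implicit.
Unset Printing Implicit Defensive.

Import Order.TTheory GRing.Theory Num.Theory.
Local Open Scope classical_set_scope.
Local Open Scope ring_scope.
Local Open Scope quotient_scope.

(** * Divisible groups are injective *)

(** Since w_p(S) + l_p(I/S) = l_p(A) is constant, a small weight means a large torsion part of A/S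
    over p, and both extremes are locally rigid. At weight 0 the maps onto C_{p^oo} that use up
    l_p(A) live on I/S, and finitely many excluded elements confine the p-primary part of T to a
    finite group modulo L. At weight l_p(A) the group I/S has no quotient C_{p^oo}, so each such T
    near S contains the whole divisible p-part modulo L. A noncritical p leaves only these two
    cases. For a critical p, intermediate weights let S be turned inside copies of C_{p^oo}, and at
    the top weight a loss of one still leaves a positive weight: hence the threshold 2. The group
    R_V suits gamma because W(S), the preimage of U_V(A/S) for V the set of critical primes, is
    pure, A/W(S) has no quotient C_{p^oo} with p in V, and W(W(S)) = W(S). Enlarging the isolator of
    S to W(S) thus removes the critical part of kappa and keeps gamma. The main finiteness tool is
    the descending chain condition between S and I, which holds although A need not be Artinian. *)

Lemma subgroup_of (A : zmodType) (P : A -> Prop) :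
  P 0 -> (forall x y, P x -> P y -> P (x - y)) ->
  {G : zmodClosed A | forall x, x \in G <-> P x}.
Proof.
move=> P0 PB.
pose Q : {pred A} := fun x => `[< P x >].
have h : zmod_closed Q.
  split; first exact/asboolP.
  by move=> x y /asboolP Px /asboolP Py; apply/asboolP/PB.
exists (HB.pack_for (zmodClosed A) (Q : A -> bool)
  (GRing.isZmodClosed.Build A Q h)).
by move=> x; split=> /asboolP.
Qed.

Lemma additive_of (A D : zmodType) (f : A -> D) :
  {morph f : x y / x - y} -> {g : {additive A -> D} | g =1 f}.
Proof.
move=> fB.
by exists (HB.pack_for {additive A -> D} f (GRing.isZmodMorphism.Build A D f fB)).
Qed.

Section Basics.
Variable A : zmodType.
Implicit Types (S G H K : zmodClosed A) (x y : A).

Lemma coprime_mulrn_in G m n x :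
  coprime m n -> x *+ m \in G -> x *+ n \in G -> x \in G.
Proof.
case: m => [|m] cmn xm xn.
  by move: cmn; rewrite /coprime gcd0n => /eqP n1; rewrite n1 in xn.
case: (egcdnP n (ltn0Sn m)) => km kn; rewrite (eqP cmn) => E _.
have -> : x = x *+ (km * m.+1) - x *+ (kn * n) by rewrite E mulrnDr addrC addKr.
by rewrite mulnC mulrnA [(kn * _)%N]mulnC mulrnA rpredB // rpredMn.
Qed.

Lemma mulrz_in G x (j : int) : (x *~ j \in G) = (x *+ `|j|%N \in G).
Proof. by case: (intP j) => // n; rewrite mulrNz rpredN abszN. Qed.

(** A divisible subgroup D/S of A/S is a direct summand. The preimage C of a complement is a
    subgroup maximal among those that meet D in S. *)
Lemma complement S (D : zmodClosed A) :
    {subset S <= D} ->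
    (forall n d, (0 < n)%N -> d \in D -> exists2 d', d' \in D & d - d' *+ n \in S) ->
  exists C : zmodClosed A, [/\ {subset S <= C},
    forall x, x \in C -> x \in D -> x \in S &
    forall x, exists c d, [/\ c \in C, d \in D & x = c + d]].
Proof.
move=> SD Ddiv.
(* Zorn's lemma is applied to sets X whose union with S is a subgroup: the empty chain has an empty
   union, which would not itself be a subgroup. *)
pose SX (X : set A) x := x \in S \/ X x.
pose P X := (forall x y, SX X x -> SX X y -> SX X (x - y)) /\
  forall x, X x -> x \in D -> x \in S.
have [|X [[XB XD] Xmax]] := @Zorn_bigcup A P.
  move=> F FP Ftot; split; last by move=> x [Y /FP [_]]; apply.
  have up Y z : F Y -> SX Y z -> SX (\bigcup_(X in F) X) z.
    by move=> FY [zS|Yz]; [left|right; exists Y].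
  move=> x y [xS|[X FX Xx]] [yS|[Y FY Yy]].
  - by left; rewrite rpredB.
  - by apply/(up Y _ FY)/(FP _ FY).1; [left|right].
  - by apply/(up X _ FX)/(FP _ FX).1; [right|left].
  - have [XY|YX] := Ftot _ _ FX FY.
      by apply/(up Y _ FY)/(FP _ FY).1; right => //; apply: XY.
    by apply/(up X _ FX)/(FP _ FX).1; right => //; apply: YX.
have [C CE] : {C : zmodClosed A | forall x, x \in C <-> SX X x}.
  by apply: subgroup_of => //; left; apply: rpred0.
have SC : {subset S <= C} by move=> x xS; apply/CE; left.
have CD x : x \in C -> x \in D -> x \in S by move/CE => [//|/XD].
exists C; split=> //.
have [T TE] : {T : zmodClosed A | forall x, x \in T <->
    exists c d, [/\ c \in C, d \in D & x = c + d]}.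
  apply: subgroup_of; first by exists 0, 0; rewrite !rpred0 addr0.
  move=> _ _ [c [d [cC dD ->]]] [c' [d' [cC' dD' ->]]].
  by exists (c - c'), (d - d'); rewrite !rpredB // addrACA opprD.
have CT x : x \in C -> x \in T.
  by move=> xC; apply/TE; exists x, 0; rewrite rpred0 addr0.
have DT x : x \in D -> x \in T.
  by move=> xC; apply/TE; exists 0, x; rewrite rpred0 add0r.
(* By maximality, adjoining an outside element z to C produces an element of D outside S. *)
have step z : z \notin C ->
    exists c (j : int), [/\ c \in C, c + z *~ j \in D & c + z *~ j \notin S].
  move=> zC; apply: contrapT => no.
  apply: (Xmax [set x | exists c (j : int), c \in C /\ x = c + z *~ j]).
    split.
      move=> x Xx; exists x, 0; rewrite mulr0z addr0; split=> //.
      by apply/CE; right.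
    move=> /(_ z); rewrite /= => H; have : X z.
      by apply: H; exists 0, 1; rewrite rpred0 add0r.
    by move=> Xz; move: zC; rewrite (CE z).2 //; right.
  split.
    have red x : SX [set x | exists c (j : int), c \in C /\ x = c + z *~ j] x ->
        exists c (j : int), c \in C /\ x = c + z *~ j.
      by case=> // xS; exists x, 0; rewrite mulr0z addr0 SC.
    move=> x y /red[c [j [cC ->]]] /red[c' [j' [cC' ->]]].
    right; exists (c - c'), (j - j'); rewrite rpredB //.
    by rewrite mulrzBr opprD addrACA.
  move=> _ [c [j [cC ->]]] xD; apply: contrapT => xS; apply: no.
  by exists c, j; split=> //; apply/negP.
suff allT x : x \in T by move=> x; apply/TE.
apply: contrapT => /negP xT.
have [|c [j [cC cD cS]]] := step x; first by apply: contra xT => /CT.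
have ex : exists n, (0 < n)%N && (x *+ n \in T).
  exists `|j|%N; rewrite absz_gt0 -mulrz_in; apply/andP; split.
    by apply: contraNneq cS => j0; move: cD; rewrite j0 mulr0z addr0; apply: CD.
  by rewrite -(rpredDl _ (CT _ cC)) DT.
case: (ex_minnP ex) => n /andP[n0 xn] nmin.
have n1 : (1 < n)%N.
  by rewrite ltn_neqAle n0 andbT; apply: contraNneq xT => n1; rewrite -n1 in xn.
pose q := pdiv n; have q_pr : prime q by apply: pdiv_prime.
have nq : n = (n %/ q * q)%N by rewrite divnK // pdiv_dvd.
set x' := x *+ (n %/ q).
have x'q : x' *+ q \in T by rewrite -mulrnA -nq.
have x'T : x' \notin T.
  apply/negP => x'T; have := nmin (n %/ q)%N.
  rewrite x'T divn_gt0 ?prime_gt0 // dvdn_leq ?pdiv_dvd //= => /(_ isT).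
  by rewrite leqNgt ltn_Pdiv // prime_gt1.
have [c1 [d1 [c1C d1D E]]] := (TE _).1 x'q.
(* Dividing d1 by q inside D changes x' into z with q z in C and z still outside C + D. The multiple
   of z that [step] provides is then contradictory, whether or not q divides its coefficient. *)
have [d2 d2D dS] := Ddiv q d1 (prime_gt0 q_pr) d1D.
pose z := x' - d2.
have zq : z *+ q \in C.
  by rewrite mulrnBl E -addrA rpredD // SC.
have zT : z \notin T.
  by apply: contra x'T => zT; rewrite -[x'](subrK d2) rpredD // DT.
have [|c2 [j2 [c2C c2D c2S]]] := step z; first by apply: contra zT => /CT.
have zj : z *+ `|j2|%N \in T.
  by rewrite -mulrz_in -(rpredDl _ (CT _ c2C)) DT.
have [qj|qj] := boolP (q %| `|j2|)%N.
  move: c2S; rewrite CD // rpredD // mulrz_in -(divnK qj) mulnC mulrnA.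
  by rewrite rpredMn.
move: zT; rewrite (coprime_mulrn_in _ (CT _ zq) zj) //.
by rewrite prime_coprime.
Qed.

End Basics.

Definition divisible (D : zmodType) :=
  forall n (y : D), (0 < n)%N -> exists x, x *+ n = y.

(** R is the graph of a partial homomorphism, and T is its domain times D. Then T/R is a copy of D,
    hence divisible and a direct summand of (A x D)/R; the preimage of a complement is the graph of
    an extension to all of A. *)
Lemma divisible_extension (A D : zmodType) (R : zmodClosed (A * D)%type) :
    divisible D -> (forall y, (0, y) \in R -> y = 0) ->
  exists g : {additive A -> D}, forall x y, (x, y) \in R -> g x = y.
Proof.
move=> divD R0.
have [T TE] : {T : zmodClosed (A * D)%type | forall x, x \in T <->
    exists y, (x.1, y) \in R}.
  apply: subgroup_of; first by exists 0; rewrite rpred0.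
  move=> x y [u xu] [v yv]; exists (u - v).
  by rewrite (_ : (_, _) = (x.1, u) - (y.1, v)) ?rpredB.
have RT : {subset R <= T} by move=> [x y] xyR; apply/TE; exists y.
have [|C [RC CT Call]] := complement RT.
  move=> n [x y] n0 /TE[y' /= xy']; have [z zE] := divD n (y - y') n0.
  exists (0, z); first by apply/TE; exists 0; rewrite rpred0.
  rewrite (_ : _ - _ = (x, y')) //.
  have -> : (0, z) *+ n = (0, y - y') :> A * D.
    rewrite -zE; elim: (n) => [//|m IH]; rewrite !mulrS IH.
    by congr pair; rewrite /= addr0.
  by apply/eqP; rewrite xpair_eqE /= subr0 opprB addrC subrK !eqxx.
have Cex x : exists y, (x, y) \in C.
  have [c [[x1 y1] [cC /TE[y' /RC x1y'] E]]] := Call (x, 0).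
  exists (c.2 + y'); rewrite (_ : (x, _) = c + (x1, y')) ?rpredD //.
  by rewrite -[x]/((x, 0 : D).1) E.
have [f fC] := choice Cex.
have fU x y : (x, y) \in C -> f x = y.
  move=> xy; apply/eqP; rewrite -subr_eq0; apply/eqP/R0/CT; last first.
    by apply/TE; exists 0; rewrite rpred0.
  by rewrite (_ : (0, _) = (x, f x) - (x, y)) ?rpredB //= -(subrr x).
have fB : {morph f : x y / x - y}.
  by move=> x y; apply: fU; rewrite (_ : (_, _) = (x, f x) - (y, f y)) ?rpredB.
have [g gE] := additive_of fB.
by exists g => x y /RC /fU <-; rewrite gE.
Qed.

Section Extension.
Variables (A D : zmodType) (divD : divisible D).
Implicit Types (S G H K : zmodClosed A) (x y : A).

Lemma extension_elt S x (c : D) :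
    (forall m, x *+ m \in S -> c *+ m = 0) ->
  exists2 g : {additive A -> D}, {in S, forall s, g s = 0} & g x = c.
Proof.
move=> h.
have [R RE] : {R : zmodClosed (A * D)%type | forall u, u \in R <->
    exists s (m : int), s \in S /\ u = (s + x *~ m, c *~ m)}.
  apply: subgroup_of; first by exists 0, 0; rewrite rpred0 !mulr0z addr0.
  move=> _ _ [s [m [sS ->]]] [s' [m' [sS' ->]]].
  exists (s - s'), (m - m'); rewrite rpredB // !mulrzBr; split=> //.
  by congr pair; rewrite /= addrACA opprD.
have [|g gE] := @divisible_extension A D R divD.
  move=> y /RE[s [m [sS [E ->]]]].
  have : x *~ m \in S by rewrite -(rpredDl _ sS) -E rpred0.
  rewrite mulrz_in => /h.
  by case: m E => // n _ /= cn; rewrite NegzE mulrNz -pmulrn cn oppr0.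
exists g.
  move=> s sS; apply: gE; apply/RE; exists s, 0; split=> //.
  by rewrite !mulr0z addr0.
by apply: gE; apply/RE; exists 0, 1; rewrite rpred0 add0r.
Qed.

Lemma extension_glue K G (f : {additive A -> D}) :
    (forall x, x \in K -> x \in G -> f x = 0) ->
  exists2 g : {additive A -> D}, {in K, forall x, g x = 0} &
    {in G, forall x, g x = f x}.
Proof.
move=> h.
have [R RE] : {R : zmodClosed (A * D)%type | forall u, u \in R <->
    exists x y, [/\ x \in K, y \in G & u = (x + y, f y)]}.
  apply: subgroup_of; first by exists 0, 0; rewrite !rpred0 addr0 raddf0.
  move=> _ _ [x [y [xK yG ->]]] [x' [y' [xK' yG' ->]]].
  exists (x - x'), (y - y'); rewrite !rpredB //; split=> //.
  by rewrite raddfB; congr pair; rewrite /= addrACA opprD.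
have [|g gE] := @divisible_extension A D R divD.
  move=> _ /RE[x [y [xK yG [E ->]]]]; apply: h => //.
  by rewrite -(rpredDl _ xK) -E rpred0.
exists g => x xK; apply: gE; apply/RE.
  by exists x, 0; rewrite rpred0 raddf0 addr0.
by exists 0, x; rewrite rpred0 add0r.
Qed.

End Extension.

(** * Chain conditions in minimax groups *)

Section Spans.
Variable A : zmodType.
Implicit Types (S G H K Z : zmodClosed A) (x y : A) (s t : seq A).

Fixpoint zspan s x : Prop :=
  if s is a :: s' then exists m : int, zspan s' (x - a *~ m) else x = 0.

Lemma zspanB s x y : zspan s x -> zspan s y -> zspan s (x - y).
Proof.
elim: s x y => [|a s IH] x y /=; first by move=> -> ->; rewrite subrr.
move=> [m xm] [n yn]; exists (m - n).
by rewrite mulrzBr opprD addrACA -opprD; apply: IH.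
Qed.

Lemma zspan0 s : zspan s 0.
Proof. by elim: s => //= a s IH; exists 0; rewrite subr0. Qed.

Lemma mem_zspan s x : x \in s -> zspan s x.
Proof.
elim: s => //= a s IH; rewrite in_cons => /orP[/eqP->|/IH xs].
  by exists 1; rewrite subrr; apply: zspan0.
by exists 0; rewrite subr0.
Qed.

Lemma zspan_min s x K : zspan s x -> {subset s <= K} -> x \in K.
Proof.
elim: s x => [|a s IH] x /=; first by move=> -> _; rewrite rpred0.
move=> [m /IH xm] sK; rewrite -[x](subrK (a *~ m)) rpredD //.
  by apply: xm => y ys; apply: sK; rewrite in_cons ys orbT.
by rewrite mulrz_in rpredMn // sK // mem_head.
Qed.

Lemma zspan_subgroup s : {K : zmodClosed A | forall x, x \in K <-> zspan s x}.
Proof. by apply: subgroup_of; [apply: zspan0|apply: zspanB]. Qed.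

Lemma finitely_generatedP Z :
  finitely_generated Z <-> exists s, forall x, x \in Z <-> zspan s x.
Proof.
split=> [[s [sZ Zmin]]|[s Zs]]; exists s.
  move=> x; split=> [xZ|/zspan_min]; last exact.
  have [K KE] := zspan_subgroup s.
  by apply/KE; apply: Zmin xZ => y /mem_zspan/KE.
split=> [x /mem_zspan/Zs //|K sK x /Zs /zspan_min]; exact.
Qed.

(** The coefficients of [a] occurring in H form an ideal of Z. If it is nonzero, its least positive
    element d is realized by some h, and H is generated by h together with the part of H in the span
    of s. *)
Lemma zspan_noetherian s H : (forall x, x \in H -> zspan s x) ->
  exists t, forall x, x \in H <-> zspan t x.
Proof.
elim: s H => [|a s IH] H Hs.
  by exists [::] => x; split=> [/Hs|->]; rewrite ?rpred0.
have [K KE] : {K : zmodClosed A | forall x, x \in K <-> x \in H /\ zspan s x}.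
  apply: subgroup_of; first by split; [apply: rpred0|apply: zspan0].
  by move=> x y [xH xs] [yH ys]; rewrite rpredB //; split=> //; apply: zspanB.
have [t tK] := IH K (fun x xK => ((KE x).1 xK).2).
have [ex|no] := pselect (exists n, (0 < n)%N && `[< exists2 h, h \in H & zspan s (h - a *+ n) >]);
    last first.
  exists t => x; rewrite -tK; split=> [xH|/KE[] //]; apply/KE; split=> //.
  have /= [m xm] := Hs x xH; have [m0|m0] := eqVneq m 0.
    by move: xm; rewrite m0 subr0.
  exfalso; apply: no; exists `|m|%N; rewrite absz_gt0 m0; apply/asboolP.
  case: m m0 xm => n _ xm; first by exists x.
  exists (- x); rewrite ?rpredN // -opprD -[X in zspan s X]sub0r.
  apply: zspanB; first exact: zspan0.
  by move: xm; rewrite NegzE mulrNz opprK.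
case: (ex_minnP ex) => d /andP[d0 /asboolP[h hH hd]] dmin.
exists (h :: t) => x; split=> /= [xH|[m /tK/KE[xH _]]]; last first.
  by rewrite -[x](subrK (h *~ m)) rpredD // mulrz_in rpredMn.
have /= [m xm] := Hs x xH.
exists (m %/ d)%Z; apply/tK/KE.
have hH' : h *~ (m %/ d)%Z \in H by rewrite mulrz_in rpredMn.
rewrite rpredB //; split=> //.
have E : zspan s (x - h *~ (m %/ d)%Z - a *~ (m %% d)%Z).
  have hs : zspan s ((h - a *+ d) *~ (m %/ d)%Z).
    have [L LE] := zspan_subgroup s.
    by apply/LE; rewrite mulrz_in rpredMn //; apply/LE.
  have := zspanB xm hs; congr (zspan s _).
  rewrite {1}(divz_eq m d) mulrzDr mulrzBl [(m %/ d)%Z * d]mulrC mulrzA.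
  by rewrite [_ *~ _ + _]addrC opprD addrA opprB addrA subrK addrAC.
have : (0 <= (m %% d)%Z) by rewrite modz_ge0 // -lt0n.
have : ((m %% d)%Z < d) by rewrite ltz_pmod.
case: (m %% d)%Z E => // r E rd _; have [r0|r0] := posnP r.
  by move: E; rewrite r0 subr0.
suff : (d <= r)%N by rewrite leqNgt (_ : (r < d)%N).
apply: dmin; rewrite r0; apply/asboolP.
by exists (x - h *~ (m %/ d)%Z) => //; rewrite rpredB.
Qed.

Lemma zspan_finite_mod S s : (forall x, x \in s -> exists2 n, (0 < n)%N & x *+ n \in S) ->
  exists F : seq A, forall x, zspan s x -> exists2 r, r \in F & x - r \in S.
Proof.
elim: s => [_|a s IH tors].
  by exists [:: 0] => x ->; exists 0; rewrite ?mem_head // subr0 rpred0.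
have [|F HF] := IH; first by move=> x xs; apply: tors; rewrite in_cons xs orbT.
have [n n0 an] := tors a (mem_head _ _).
exists [seq a *+ i + r | i <- iota 0 n, r <- F] => x /= [m /HF[r rF xr]].
have n0' : n%:Z != 0 by rewrite -lt0n.
exists (a *~ (m %% n)%Z + r).
  have : ((m %% n)%Z < n) by rewrite ltz_pmod.
  have := modz_ge0 m n0'; case: (m %% n)%Z => // i _ lin.
  by apply/allpairsP; exists (i, r); rewrite mem_iota.
have -> : x - (a *~ (m %% n)%Z + r) = x - a *~ m - r + a *~ ((m %/ n)%Z * n).
  move: (divz_eq m n); move: (m %/ n)%Z (m %% n)%Z => q k ->.
  by rewrite mulrzDr !opprD !addrA [RHS]addrAC [X in _ = X - r]addrAC subrK.
rewrite rpredD // mulrC mulrzA mulrz_in rpredMn //.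
Qed.

End Spans.

(** * The minimal condition between a subgroup and its isolator *)

Section MinimalCondition.
Variable A : zmodType.
Implicit Types (S G H K Z : zmodClosed A) (x y : A).

Lemma ideal_quotB Z x y :
  \pi_{ideal_quot Z} (x - y) = \pi_{ideal_quot Z} x - \pi_{ideal_quot Z} y.
Proof. by rewrite raddfB. Qed.

Lemma ideal_quot_eq0 Z x : \pi_{ideal_quot Z} x = 0 <-> x \in Z.
Proof.
have := Quotient.idealrBE Z x 0; rewrite subr0 raddf0 => ->.
by split=> [/eqP|/eqP].
Qed.

(** The chain of cyclic groups generated by the classes of 2^n x stabilizes, so (2^N - 2^(N+1) j) x
    lies in Z for some j, and this coefficient is nonzero. *)
Lemma artinian_torsion Z x :
  artinian {ideal_quot Z} -> exists2 n, (0 < n)%N & x *+ n \in Z.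
Proof.
move=> artZ.
have gen n : {G : zmodClosed {ideal_quot Z} |
    forall u, u \in G <-> exists j : int, u = \pi_{ideal_quot Z} (x *~ (2 ^+ n * j))}.
  apply: subgroup_of; first by exists 0; rewrite mulr0 mulr0z raddf0.
  by move=> _ _ [i ->] [j ->]; exists (i - j); rewrite mulrBr mulrzBr ideal_quotB.
have [|N HN] := artZ (fun n => sval (gen n)).
  move=> n _ /(svalP (gen _))[j ->]; apply/(svalP (gen _)).
  by exists (2 * j); rewrite exprSr mulrA.
have : \pi_{ideal_quot Z} (x *~ 2 ^+ N) \in sval (gen N).
  by apply/(svalP (gen _)); exists 1; rewrite mulr1.
rewrite -(HN N.+1) // => /(svalP (gen _))[j] /eqP.
rewrite -Quotient.idealrBE -mulrzBr mulrz_in => h.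
exists (absz (2 ^+ N - 2 ^+ N.+1 * j)%R) => //.
rewrite absz_gt0 exprSr -mulrA -{1}[2 ^+ N]mulr1 -mulrBr mulf_neq0 //.
apply/eqP; lia.
Qed.

Lemma seq_chain_stable (P : A -> nat -> Prop) (F : seq A) :
    (forall r n, P r n.+1 -> P r n) ->
  exists N, forall r n, r \in F -> (N <= n)%N -> P r N -> P r n.
Proof.
move=> Pdec.
have Pdec' r m n : (m <= n)%N -> P r n -> P r m.
  elim: n => [|n IH]; first by rewrite leqn0 => /eqP ->.
  by rewrite leq_eqVlt => /predU1P[->|/IH h /Pdec].
elim: F => [|a F [N HN]]; first by exists 0%N.
have [aN|] := pselect (forall n, P a n).
  exists N => r n; rewrite in_cons => /predU1P[->|rF] //; exact: HN.
move=> /existsNP[M PM]; exists (maxn M N) => r n.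
rewrite in_cons geq_max => /predU1P[->|rF] /andP[Mn Nn] h.
  by case: PM; apply: Pdec' h; apply: leq_maxl.
by apply: HN => //; apply: Pdec' h; apply: leq_maxr.
Qed.

(** The images of the X n in the Artinian group A/Z stabilize. Their intersections with Z lie in a
    finitely generated group that is torsion, hence finite, modulo S, so they stabilize too; the
    modular law combines the two. *)
Lemma chain_stable S (X : nat -> zmodClosed A) :
    minimax A ->
    (forall n, {subset X n.+1 <= X n}) -> (forall n, {subset S <= X n}) ->
    (forall x, x \in X 0%N -> exists2 n, (0 < n)%N & x *+ n \in S) ->
  exists N, forall n, (N <= n)%N -> {subset X N <= X n}.
Proof.
move=> [Z [/finitely_generatedP[s Zs] artZ]] Xdec SX tors.
have Xle m n : (m <= n)%N -> {subset X n <= X m}.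
  elim: n => [|n IH]; first by rewrite leqn0 => /eqP ->.
  by rewrite leq_eqVlt => /predU1P[-> //|/IH h] x /Xdec /h.
have im n : {G : zmodClosed {ideal_quot Z} |
    forall u, u \in G <-> exists2 x, x \in X n & u = \pi_{ideal_quot Z} x}.
  apply: subgroup_of; first by exists 0; rewrite ?rpred0 ?raddf0.
  move=> _ _ [x xX ->] [y yX ->]; exists (x - y); rewrite ?rpredB //.
  by rewrite ideal_quotB.
have [|N1 HN1] := artZ (fun n => sval (im n)).
  by move=> n _ /(svalP (im _))[x /Xdec xX ->]; apply/(svalP (im _)); exists x.
have [Y YE] : {Y : zmodClosed A | forall x, x \in Y <-> x \in X 0%N /\ x \in Z}.
  apply: subgroup_of; first by rewrite !rpred0.
  by move=> x y [? ?] [? ?]; rewrite !rpredB.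
have [t tY] : exists t, forall x, x \in Y <-> zspan t x.
  by apply: (@zspan_noetherian _ s) => x /YE[_ /Zs].
have [|F HF] := @zspan_finite_mod _ S t.
  by move=> x /mem_zspan/tY/YE[/tors].
have [|N2 HN2] := @seq_chain_stable (fun r n => r \in X n) F.
  by move=> r n; apply: Xdec.
exists (maxn N1 N2) => n; rewrite geq_max => /andP[N1n N2n] x xX.
have : \pi_{ideal_quot Z} x \in sval (im n).
  rewrite HN1 //; apply/(svalP (im _)); exists x => //.
  by apply: Xle xX; apply: leq_maxl.
move=> /(svalP (im _))[y yX] /eqP; rewrite -Quotient.idealrBE => xyZ.
rewrite -[x](subrK y) rpredD //.
have /tY/HF[r rF xyr] : x - y \in Y.
  apply/YE; split=> //; rewrite rpredB //; first exact: Xle xX.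
  exact: Xle yX.
rewrite -[x - y](subrK r) rpredD ?(SX _ _ xyr) //; apply: (HN2 r n rF N2n).
rewrite -(rpredDl _ (SX _ _ xyr)) subrK rpredB //.
  by apply: Xle xX; apply: leq_maxr.
exact: Xle yX.
Qed.

Lemma minimal_subgroup S (P : zmodClosed A -> Prop) (X0 : zmodClosed A) :
    minimax A -> (forall X, P X -> {subset S <= X}) ->
    (forall x, x \in X0 -> exists2 n, (0 < n)%N & x *+ n \in S) -> P X0 ->
  exists X, [/\ P X, {subset X <= X0} &
    forall Y, P Y -> {subset Y <= X} -> {subset X <= Y}].
Proof.
move=> mA PS tors PX0; apply: contrapT => no.
pose T := {X : zmodClosed A | P X /\ {subset X <= X0}}.
have step (X : T) : exists Y : T, {subset sval Y <= sval X} /\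
    ~ {subset sval X <= sval Y}.
  case: X => X [PX XX0] /=; apply: contrapT => noY; apply: no.
  exists X; split=> // Y PY YX; apply: contrapT => nXY; apply: noY.
  have YX0 : {subset Y <= X0} by move=> x /YX/XX0.
  by exists (exist _ Y (conj PY YX0)).
have [f fP] := choice step.
pose X n := sval (iter n f (exist _ X0 (conj PX0 (fun x h => h)) : T)).
have [||N HN] := chain_stable (X := X) mA _ _ tors.
- by move=> n; apply: (fP _).1.
- by move=> n; apply/PS; apply: (svalP (iter n f _)).1.
by case: (fP (iter N f (exist _ X0 (conj PX0 (fun x h => h)) : T))).2; apply: (HN N.+1).
Qed.
End MinimalCondition.

(** * Quasicyclic groups *)

Section Quasicyclic.
Variable p : nat.
Hypothesis p_pr : prime p.
Local Notation C := (quasicyclic p).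

Let p0 n : (p%:R ^+ n : rat) != 0.
Proof. by rewrite expf_neq0 // pnatr_eq0 -lt0n prime_gt0. Qed.

Fact Zinv_invX n : p%:R ^- n \in Zinv_pred p.
Proof. by apply/asboolP; exists n; rewrite mulVf. Qed.

(** The class of p^-n, a generator of the subgroup of elements killed by p^n. *)
Definition qc n : C := \pi_C (Sub (p%:R ^- n) (Zinv_invX n) : Zinv p).

Lemma qcP n (y : C) : y *+ p ^ n = 0 -> exists a : int, y = qc n *~ a.
Proof.
elim/quotW: y => x; rewrite -raddfMn => /ideal_quot_eq0.
rewrite inE raddfMn /= => /intrP[a xa]; exists a.
rewrite /qc -raddfMz; congr (\pi_C _); apply: val_inj; rewrite raddfMz /=.
by apply: (mulIf (p0 n)); rewrite -mulrzl mulfVK // -xa -natrX mulr_natr.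
Qed.

Lemma qc_torsion (y : C) : exists n, y *+ p ^ n = 0.
Proof.
elim/quotW: y => x; have /asboolP[n xn] := valP x; exists n.
rewrite -raddfMn; apply/ideal_quot_eq0; rewrite inE raddfMn /=.
by rewrite -mulr_natr natrX.
Qed.

Lemma qc_eq0 n (a : int) : (qc n *~ a == 0) = (p ^ n %| `|a|)%N.
Proof.
rewrite /qc -raddfMz; apply/eqP/idP => [/ideal_quot_eq0|].
  rewrite inE raddfMz /= -mulrzl => /intrP[b /(congr1 ( *%R^~ (p%:R ^+ n)))].
  rewrite mulfVK // => /esym; rewrite -natrX -[(p ^ n)%:R]mulrz_nat -intrM => /intr_inj.
  by move=> <-; rewrite natz abszM dvdn_mull.
case/dvdnP => k ak; apply/ideal_quot_eq0; rewrite inE raddfMz /=.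
have [e ->] : exists e : int, a = e * (p ^ n)%N.
  by exists (sgz a * k); rewrite -mulrA -PoszM -ak -intEsg.
by rewrite -mulrzl intrM -pmulrn natrX mulfK // intr_int.
Qed.

(** The element of larger order p^i has a numerator prime to p, which Bezout inverts modulo p^i; the
    other element is therefore a multiple of it. *)
Lemma qc_chain (y z : C) : (exists a : int, y = z *~ a) \/ (exists a : int, z = y *~ a).
Proof.
wlog [n [yn zn]] : y z / exists n, y *+ p ^ n = 0 /\
    (forall m, z *+ p ^ m = 0 -> (n <= m)%N).
  move=> wl; have minex (u : C) : exists n, u *+ p ^ n = 0 /\
      forall m, u *+ p ^ m = 0 -> (n <= m)%N.
    have ex : exists n, u *+ p ^ n == 0 by have [n /eqP] := qc_torsion u; exists n.
    case: (ex_minnP ex) => n /eqP un nmin; exists n; split=> // m /eqP.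
    exact: nmin.
  have [n [yn ymin]] := minex y; have [m [zm zmin]] := minex z.
  have [nm|/ltnW mn] := leqP n m.
    by apply: wl; exists n; split=> // k /zmin; apply: leq_trans.
  have [] := wl z y; last by [left|right].
    by exists m; split=> // k /ymin; apply: leq_trans.
  by right.
left; have [j zj] := qc_torsion z; have nj := zn _ zj.
have yj : y *+ p ^ j = 0 by rewrite -(subnKC nj) expnD mulrnA yn mul0rn.
have ex : exists n, z *+ p ^ n == 0 by exists j; apply/eqP.
case: (ex_minnP ex) => i /eqP zi imin.
have ni := zn _ zi.
have {yj} yi : y *+ p ^ i = 0 by rewrite -(subnKC ni) expnD mulrnA yn mul0rn.
have [a ->] := qcP yi; have [b zb] := qcP zi.
have cop : coprime `|b| (p ^ i)%N.
  case: i zi imin zb {ni yi} => [|i] zi imin zb; first by rewrite coprimen1.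
  rewrite coprime_sym coprimeXl // prime_coprime //; apply/negP => pb.
  suff /eqP/imin : z *+ p ^ i = 0 by rewrite ltnn.
  apply/eqP; rewrite zb pmulrn -mulrzA qc_eq0 abszM /= expnS dvdn_pmul2r //.
  by rewrite expn_gt0 prime_gt0.
have /eqP := cop; rewrite -/(gcdz b (p ^ i)%N).
have [u [v E]] := Bezoutz b (p ^ i)%N => g1.
exists (u * a); rewrite zb -mulrzA; apply/eqP; rewrite -subr_eq0 -mulrzBr qc_eq0.
have g1' : gcdz b (p ^ i)%N = 1 by rewrite /gcdz g1.
have uE : u * b = 1 - v * (p ^ i)%N by rewrite -[1]g1' -E addrK.
rewrite mulrA [b * u]mulrC uE mulrBl mul1r opprB addrC subrK.
by rewrite mulrAC abszM /= dvdn_mull.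
Qed.

Lemma qc_neq0 : exists2 c : C, c != 0 & c *+ p = 0.
Proof.
exists (qc 1); first by rewrite -[qc 1]mulr1z qc_eq0 expn1 gtnNdvd // prime_gt1.
by apply/eqP; rewrite pmulrn qc_eq0 expn1 dvdnn.
Qed.

Lemma qc_divisible : divisible C.
Proof.
move=> n y n0; have [m pm ->] := pfactor_coprime p_pr n0.
have [k yk] := qc_torsion y.
have m0 : (0 < m)%N by case: m pm => //; rewrite prime_coprime ?dvdn0.
have qcD j i : qc (j + i) *+ p ^ i = qc j.
  rewrite /qc -raddfMn; congr (\pi_C _); apply: val_inj; rewrite raddfMn /=.
  by rewrite exprD invfM -[LHS]mulr_natr natrX mulfVK.
have [a ->] := qcP yk.
have := egcdnP (p ^ k) m0; move: (logn p n) => l [u v E _].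
exists (qc (k + l) *~ (a * u)).
rewrite mulnC mulrnA [_ *+ p ^ l]pmulrn mulrzAC -pmulrn qcD pmulrn.
apply/eqP; rewrite -subr_eq0 -mulrzA -mulrzBr qc_eq0 -mulrA -PoszM E.
have /eqP -> : coprime m (p ^ k) by rewrite coprime_sym coprimeXl.
by rewrite PoszD mulrDr mulr1 addrK PoszM mulrA abszM dvdn_mull.
Qed.
End Quasicyclic.

Lemma rat_divisible : divisible rat.
Proof.
move=> n y n0; exists (y / n%:R).
by rewrite -[LHS]mulr_natr mulfVK // pnatr_eq0 -lt0n.
Qed.

Section QuasicyclicImage.
Variables (A : zmodType) (p : nat).
Hypothesis p_pr : prime p.
Local Notation C := (quasicyclic p).
Implicit Types (G H K : zmodClosed A) (f : {additive A -> C}).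

Lemma image_unbounded G f : (forall n, exists2 x, x \in G & f x *+ p ^ n <> 0) ->
  forall z, exists2 x, x \in G & f x = z.
Proof.
move=> unb z; have [n zn] := qc_torsion z; have [x xG fx] := unb n.
have [[a fxa]|[a za]] := qc_chain p_pr (f x) z.
  by case: fx; rewrite fxa pmulrn mulrzAC -pmulrn zn mul0rz.
by exists (x *~ a); rewrite ?raddfMz // mulrz_in rpredMn.
Qed.

Lemma image_divisible G f x : x \in G -> f x <> 0 ->
    (forall x, x \in G -> exists2 y, y \in G & f x = f y *+ p) ->
  forall z, exists2 x, x \in G & f x = z.
Proof.
move=> xG fx divG; apply: image_unbounded => n.
have [y yG ynx] : exists2 y, y \in G & f y *+ p ^ n = f x.
  elim: n => [|n [y yG yx]]; first by exists x.
  have [z zG zy] := divG y yG; exists z => //.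
  by rewrite expnS mulrnA -zy.
by exists y; rewrite ?ynx.
Qed.

(** A subgroup of C_{p^oo} with elements of unbounded order is everything, since of two elements one
    is a multiple of the other. Lengths are shown to vanish by bounding all maps. *)
Lemma image_bounded_or_onto G f :
  (exists n, forall x, x \in G -> f x *+ p ^ n = 0) \/
  (forall z, exists2 x, x \in G & f x = z).
Proof.
have [b|nb] := pselect (exists n, forall x, x \in G -> f x *+ p ^ n = 0).
  by left.
right; apply: image_unbounded => n; apply: contrapT => h; apply: nb; exists n.
by move=> x xG; apply: contrapT => fx; apply: h; exists x.
Qed.

Lemma image_bounded n G f : (forall x, x \in G -> f x *+ p ^ n = 0) ->
  ~ forall z, exists2 x, x \in G & f x = z.
Proof.
move=> b onto_f; have [c c0 _] := qc_neq0 p_pr.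
have [|d dE] := @qc_divisible p p_pr (p ^ n)%N c; first by rewrite expn_gt0 prime_gt0.
have [x xG fx] := onto_f d; move/eqP: c0; apply.
by rewrite -dE -fx b.
Qed.
End QuasicyclicImage.

(** * The length l_p of a subquotient *)

Section SubgroupOperations.
Variable A : zmodType.
Implicit Types (S G H K : zmodClosed A) (x y : A).

Fact trivial_subgroup_subproof : {G : zmodClosed A | forall x, x \in G <-> x = 0}.
Proof. by apply: subgroup_of => // x y -> ->; rewrite subrr. Qed.
Definition trivial_subgroup := sval trivial_subgroup_subproof.
Lemma trivial_subgroupP x : x \in trivial_subgroup <-> x = 0.
Proof. exact: svalP trivial_subgroup_subproof x. Qed.

Fact full_subgroup_subproof : {G : zmodClosed A | forall x, x \in G <-> True}.
Proof. by apply: subgroup_of. Qed.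
Definition full_subgroup := sval full_subgroup_subproof.
Lemma full_subgroupP x : x \in full_subgroup.
Proof. exact/(svalP full_subgroup_subproof x). Qed.

Lemma sub_trivial_subgroup G : {subset trivial_subgroup <= G}.
Proof. by move=> x /trivial_subgroupP ->; rewrite rpred0. Qed.

Lemma sub_full_subgroup G : {subset G <= full_subgroup}.
Proof. by move=> x _; apply: full_subgroupP. Qed.

Fact kernel_in_subproof (D : zmodType) G (f : {additive A -> D}) :
  {K : zmodClosed A | forall x, x \in K <-> x \in G /\ f x = 0}.
Proof.
apply: subgroup_of; first by rewrite rpred0 raddf0.
by move=> x y [xG fx] [yG fy]; rewrite rpredB // raddfB fx fy subr0.
Qed.
Definition kernel_in (D : zmodType) G (f : {additive A -> D}) := sval (@kernel_in_subproof D G f).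
Lemma kernel_inP (D : zmodType) G (f : {additive A -> D}) x :
  x \in kernel_in G f <-> x \in G /\ f x = 0.
Proof. exact: svalP (kernel_in_subproof G f) x. Qed.

End SubgroupOperations.
Arguments trivial_subgroup {A}.
Arguments full_subgroup {A}.
#[global] Hint Resolve full_subgroupP sub_trivial_subgroup sub_full_subgroup : core.

Section Onto.
Variables (A : zmodType) (p : nat).
Hypothesis p_pr : prime p.
Local Notation C := (quasicyclic p).
Implicit Types (G H K : zmodClosed A) (f : {additive A -> C}).

(* G/H maps onto C_{p^oo}^k: since C_{p^oo} is injective, the components of such
   a map may be taken to be defined on the whole of A. *)
Definition onto H G k := exists f : nat -> {additive A -> C},
  (forall i, (i < k)%N -> {in H, forall x, f i x = 0}) /\
  forall y : nat -> C, exists2 x, x \in G & forall i, (i < k)%N -> f i x = y i.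

Definition lp H G := largest [set k | onto H G k].

Lemma onto0 H G : onto H G 0.
Proof.
have z : {morph (fun _ : A => 0 : C) : x y / x - y}.
  by move=> *; rewrite subrr.
by exists (fun _ => sval (additive_of z)); split=> // y; exists 0; rewrite ?rpred0.
Qed.

Lemma onto_le H G j k : (j <= k)%N -> onto H G k -> onto H G j.
Proof.
move=> jk [f [fH fG]]; exists f; split=> [i ij|y].
  by apply: fH; apply: leq_trans jk.
have [x xG fx] := fG y; exists x => // i ij.
by apply: fx; apply: leq_trans jk.
Qed.

Lemma onto_sub H H' G G' k : {subset H' <= H} -> {subset G <= G'} ->
  onto H G k -> onto H' G' k.
Proof.
move=> HH GG [f [fH fG]]; exists f; split=> [i ik x /HH|y]; first exact: fH.
by have [x /GG xG fx] := fG y; exists x.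
Qed.

Lemma onto1P H G : onto H G 1 <-> exists2 f : {additive A -> C},
  {in H, forall x, f x = 0} & forall z, exists2 x, x \in G & f x = z.
Proof.
split=> [[f [fH fG]]|[f fH fG]].
  exists (f 0%N); first exact: fH.
  by move=> z; have [x xG fx] := fG (fun _ => z); exists x => //; apply: fx.
exists (fun _ => f); split=> [i _|y]; first exact: fH.
by have [x xG fx] := fG (y 0%N); exists x => // -[|//] _.
Qed.

Lemma onto_cat H K G a b : {subset H <= K} -> {subset K <= G} ->
  onto H K a -> onto K G b -> onto H G (a + b).
Proof.
move=> HK KG [f [fH fK]] [g [gK gG]].
exists (fun i => if (i < a)%N then f i else g (i - a)%N); split=> [i iab x xH|y].
  case: ifP => ia; first exact: fH.
  by apply: gK; [lia|apply: HK].
have [z zG gz] := gG (fun i => y (i + a)%N).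
have [x xK fx] := fK (fun i => y i - f i z).
exists (x + z); first by rewrite rpredD // KG.
move=> i iab; case: ifP => ia; rewrite raddfD; first by rewrite fx // subrK.
rewrite gK // ?add0r; last by lia.
by rewrite gz ?subnK //; lia.
Qed.

(** Induction on k through the last component. If p^n kills its values on K, then its p^n-multiple
    vanishes on K and still maps G onto C_{p^oo}, so it counts for G/K and G is replaced by a
    kernel. Otherwise it maps K onto C_{p^oo}, so it counts for K/H and both K and G are replaced by
    kernels; the maps found there are glued with 0 on K. *)
Lemma onto_split H K G k : {subset H <= K} -> {subset K <= G} -> onto H G k ->
  exists a b, [/\ (a + b)%N = k, onto H K a & onto K G b].
Proof.
elim: k H K G => [|k IH] H K G HK KG.
  by move=> _; exists 0%N, 0%N; split=> //; apply: onto0.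
move=> [f [fH fG]]; have fHk x : x \in H -> f k x = 0 by apply: fH.
have ontok (c : {additive A -> C}) : (forall x, f k x = 0 -> c x = 0) ->
    onto H (kernel_in G c) k.
  move=> fkc; exists f; split=> [i ik|y]; first exact/fH/ltnW.
  have [x xG fx] := fG (fun i => if (i < k)%N then y i else 0).
  exists x; last by move=> i ik; rewrite fx ?ik // ltnW.
  by apply/kernel_inP; split=> //; apply: fkc; rewrite fx // ltnn.
have [[n bn]|fK] := image_bounded_or_onto p_pr K (f k).
  have cB : {morph (fun x => f k x *+ p ^ n) : x y / x - y}.
    by move=> x y; rewrite raddfB mulrnBl.
  have [c cE] := additive_of cB.
  have KG' : {subset K <= kernel_in G c}.
    by move=> x xK; apply/kernel_inP; rewrite cE bn // KG.
  have /(IH _ _ _ HK KG')[a [b [abk aHK bKG]]] : onto H (kernel_in G c) k.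
    by apply: ontok => x fx; rewrite cE fx mul0rn.
  exists a, b.+1; split=> //; first by rewrite addnS abk.
  rewrite -addn1; apply: onto_cat bKG _ => //; first by move=> x /kernel_inP[].
  apply/onto1P; exists c; first by move=> x /kernel_inP[].
  have pn0 : (0 < p ^ n)%N by rewrite expn_gt0 prime_gt0.
  move=> z; have [w wz] := qc_divisible p_pr z pn0.
  have [x xG fx] := fG (fun _ => w); exists x => //.
  by rewrite cE fx.
have HK' : {subset H <= kernel_in K (f k)}.
  by move=> x xH; apply/kernel_inP; rewrite HK // fHk.
have KG' : {subset kernel_in K (f k) <= kernel_in G (f k)}.
  by move=> x /kernel_inP[/KG xG fx]; apply/kernel_inP.
have [//|a [b [abk aHK bKG]]] := IH _ _ _ HK' KG' (ontok (f k) _).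
exists a.+1, b; split=> //; first by rewrite addSn abk.
  rewrite -addn1; apply: onto_cat aHK _ => //; first by move=> x /kernel_inP[].
  by apply/onto1P; exists (f k) => // x /kernel_inP[].
have [g [gK gG]] := bKG.
have ex i : exists g' : {additive A -> C}, (i < b)%N ->
    {in K, forall x, g' x = 0} /\ {in kernel_in G (f k), forall x, g' x = g i x}.
  have [ib|ib] := ltnP i b; last by exists (g 0%N).
  have [|g' g'K g'G] := @extension_glue A C (qc_divisible p_pr) K (kernel_in G (f k)) (g i).
    by move=> x xK /kernel_inP[_ fx]; apply: gK => //; apply/kernel_inP.
  by exists g'.
have [g' g'P] := choice ex.
exists g'; split=> [i ib|y]; first exact: (g'P i ib).1.
have [x xG gx] := gG y; exists x; first by case/kernel_inP: xG.
by move=> i ib; rewrite (g'P i ib).2 // gx.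
Qed.

(** K modulo the kernel embeds in C_{p^oo}, where of two elements one is a multiple of the other.
    Elements with images (0, c) and (c, 0) would contradict this. *)
Lemma onto_kernel_le1 K f k : onto (kernel_in K f) K k -> (k <= 1)%N.
Proof.
move=> h; rewrite leqNgt; apply/negP => /onto_le /(_ h) [g [g0 gK]].
have [c c0 _] := qc_neq0 p_pr.
have [x xK gx] := gK (fun i => if i is 0%N then 0 else c).
have [y yK gy] := gK (fun i => if i is 0%N then c else 0).
have gker i (u v : A) (m : int) : (i < 2)%N -> u \in K -> v \in K ->
    f u = f v *~ m -> g i u = g i v *~ m.
  move=> i2 uK vK E; apply/eqP; rewrite -subr_eq0 -raddfMz -raddfB; apply/eqP.
  apply: g0 => //; apply/kernel_inP; rewrite raddfB raddfMz E subrr.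
  by rewrite rpredB // mulrz_in rpredMn.
have [[a /gker E]|[a /gker E]] := qc_chain p_pr (f x) (f y).
  by move/eqP: c0; apply; have := E 1%N isT xK yK; rewrite gx // gy // mul0rz.
by move/eqP: c0; apply; have := E 0%N isT yK xK; rewrite gx // gy // mul0rz.
Qed.

Lemma zspan_bounded s f : exists n, forall x, zspan s x -> f x *+ p ^ n = 0.
Proof.
elim: s => [|a s [n IH]] /=; first by exists 0%N => x ->; rewrite raddf0 mul0rn.
have [m am] := qc_torsion (f a); exists (n + m)%N => x [k /IH].
rewrite raddfB raddfMz mulrnBl => /eqP; rewrite subr_eq0 => /eqP h.
by rewrite expnD mulrnA h mulrnAC [_ *+ p ^ m]pmulrn mulrzAC -pmulrn am mul0rz mul0rn.
Qed.

End Onto.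

Section Length.
Variables (A : zmodType) (p : nat).
Hypothesis p_pr : prime p.
Hypothesis mA : minimax A.
Local Notation C := (quasicyclic p).
Implicit Types (G H K : zmodClosed A) (f : {additive A -> C}).

(** Maps on the finitely generated Z are bounded, so unbounded lengths would occur over Z. In a
    minimal X of unbounded length over Z, the kernel of a map onto C_{p^oo} loses length at most 1,
    so it is still unbounded and contradicts minimality. *)
Lemma onto_bounded : exists b, forall H G k, onto p H G k -> (k <= b)%N.
Proof.
apply: contrapT => nb.
have unb k : onto p (@trivial_subgroup A) full_subgroup k.
  apply: contrapT => nk; apply: nb; exists k => H G j hj.
  rewrite leqNgt; apply/negP => kj; apply: nk.
  by apply: (onto_le (ltnW kj)); exact: onto_sub hj.
have [Z [/finitely_generatedP[s Zs] artZ]] := mA.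
have unbZ k : onto p Z full_subgroup k.
  have [//|//|[|a] [b [<- h]]] := @onto_split _ _ p_pr _ Z _ _ _ _ (unb k).
    by rewrite add0n.
  have [f _ fZ] := (onto1P p _ _).1 (onto_le (ltn0Sn a) h).
  have [n fn] := zspan_bounded s f.
  by case: (image_bounded (n := n) p_pr (G := Z) (f := f)) => // x /Zs; apply: fn.
have [|||X [[ZX Xunb] _ Xmin]] := @minimal_subgroup A Z
  (fun X => {subset Z <= X} /\ forall k, onto p Z X k) full_subgroup mA.
- by move=> X [].
- by move=> x _; apply: artinian_torsion.
- by split.
have [f fZ fX] := (onto1P p _ _).1 (Xunb 1%N).
have ZK : {subset Z <= kernel_in X f}.
  by move=> x xZ; apply/kernel_inP; rewrite ZX // fZ.
have KX : {subset kernel_in X f <= X} by move=> x /kernel_inP[].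
have XK : {subset X <= kernel_in X f}.
  apply: Xmin => //; split=> // k.
  have [a [b [abk aZK /(onto_kernel_le1 p_pr) b1]]] := onto_split p_pr ZK KX (Xunb k.+1).
  by apply: onto_le aZK; lia.
have [c c0 _] := qc_neq0 p_pr; have [x /XK/kernel_inP[_ fx] E] := fX c.
by rewrite -E fx eqxx in c0.
Qed.

Lemma lpP H G : onto p H G (lp p H G) /\ forall k, onto p H G k -> (k <= lp p H G)%N.
Proof.
rewrite /lp /largest; case: xgetP => [k _ //|no]; exfalso.
have [b hb] := onto_bounded.
have ex : exists k, `[< onto p H G k >] by exists 0%N; apply/asboolP/onto0.
have ub k : `[< onto p H G k >] -> (k <= b)%N by move=> /asboolP/hb.
case: (ex_maxnP ex ub) => k /asboolP ok kmax; apply: (no k); split=> // j oj.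
exact/kmax/asboolP.
Qed.

Lemma lp_add H K G : {subset H <= K} -> {subset K <= G} ->
  lp p H G = (lp p H K + lp p K G)%N.
Proof.
move=> HK KG; apply/eqP; rewrite eqn_leq; apply/andP; split; last first.
  by apply: (lpP _ _).2; exact: (onto_cat p_pr HK KG (lpP _ _).1 (lpP _ _).1).
have [a [b [<- /(lpP _ _).2 ha /(lpP _ _).2 hb]]] := onto_split p_pr HK KG (lpP H G).1.
exact: leq_add.
Qed.

Lemma lp_gt0P H G : (0 < lp p H G)%N <-> exists2 f : {additive A -> C},
  {in H, forall x, f x = 0} & forall z, exists2 x, x \in G & f x = z.
Proof.
rewrite -onto1P; split=> [h|/(lpP _ _).2 //].
exact: onto_le h (lpP _ _).1.
Qed.

Lemma lp_eq0 H G : (forall f, {in H, forall x, f x = 0} ->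
  exists n, forall x, x \in G -> f x *+ p ^ n = 0) -> lp p H G = 0%N.
Proof.
move=> h; case: (posnP (lp p H G)) => // /lp_gt0P[f /h[n fn]].
by move/(image_bounded p_pr fn).
Qed.

Lemma lp_sub H H' G G' : {subset H' <= H} -> {subset G <= G'} ->
  (lp p H G <= lp p H' G')%N.
Proof.
by move=> HH GG; apply: (lpP _ _).2; apply: onto_sub HH GG (lpP _ _).1.
Qed.

Lemma eq_lp H H' G G' : H =i H' -> G =i G' -> lp p H G = lp p H' G'.
Proof.
by move=> HH GG; apply/eqP; rewrite eqn_leq !lp_sub // => x; rewrite ?HH ?GG.
Qed.

End Length.

(** * Isolators and primary parts *)

Lemma coprime_mulrn_eq0 (A : zmodType) (x : A) m n :
  coprime m n -> x *+ m = 0 -> x *+ n = 0 -> x = 0.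
Proof.
move=> cmn xm xn; apply/trivial_subgroupP.
by apply: (coprime_mulrn_in cmn); apply/trivial_subgroupP.
Qed.

Lemma qc_coprime_eq0 p (y : quasicyclic p) m :
  prime p -> coprime p m -> y *+ m = 0 -> y = 0.
Proof.
move=> p_pr pm ym; have [k yk] := qc_torsion y.
by apply: (@coprime_mulrn_eq0 _ _ (p ^ k) m) => //; rewrite coprimeXl.
Qed.

Lemma coprime_fact N p : prime p -> (N < p)%N -> coprime N`! p.
Proof.
move=> p_pr; elim: N => [|N IH] Np; first by rewrite fact0 coprime1n.
rewrite factS coprimeMl IH ?(ltnW Np) // andbT coprime_sym prime_coprime //.
by rewrite gtnNdvd.
Qed.

Section Isolator.
Variable A : zmodType.
Implicit Types (S G H K T U : zmodClosed A) (x y : A).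

Fact isolator_subproof S :
  {K : zmodClosed A | forall x, x \in K <-> exists2 n, (0 < n)%N & x *+ n \in S}.
Proof.
apply: subgroup_of; first by exists 1%N; rewrite // mul0rn rpred0.
move=> x y [m m0 xm] [n n0 yn]; exists (m * n)%N; first by rewrite muln_gt0 m0.
by rewrite mulrnBl mulrnA [(m * n)%N]mulnC mulrnA rpredB // rpredMn.
Qed.
Definition isolator S := sval (isolator_subproof S).
Lemma isolatorP S x : x \in isolator S <-> exists2 n, (0 < n)%N & x *+ n \in S.
Proof. exact: svalP (isolator_subproof S) x. Qed.

Lemma sub_isolator S : {subset S <= isolator S}.
Proof. by move=> x xS; apply/isolatorP; exists 1%N. Qed.

Lemma isolator_pure S n x : (0 < n)%N -> x *+ n \in isolator S -> x \in isolator S.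
Proof.
move=> n0 /isolatorP[m m0]; rewrite -mulrnA => h; apply/isolatorP.
by exists (n * m)%N; rewrite // muln_gt0 n0.
Qed.

Lemma isolator_mono S T : {subset S <= T} -> {subset isolator S <= isolator T}.
Proof. by move=> ST x /isolatorP[n n0 /ST h]; apply/isolatorP; exists n. Qed.

Lemma isolator_least S U : {subset S <= U} ->
  (forall n x, (0 < n)%N -> x *+ n \in U -> x \in U) -> {subset isolator S <= U}.
Proof. by move=> SU Upure x /isolatorP[n n0 /SU]; apply: Upure. Qed.

Lemma additive_rat_isolator S (f : {additive A -> rat}) :
  {in S, forall x, f x = 0} -> {in isolator S, forall x, f x = 0}.
Proof.
move=> fS x /isolatorP[n n0 /fS/eqP]; rewrite raddfMn mulrn_eq0.
by rewrite eqn0Ngt n0 => /eqP.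
Qed.

Lemma rat_separation S x : x \notin isolator S ->
  exists2 h : {additive A -> rat}, {in S, forall y, h y = 0} & h x = 1.
Proof.
move=> xS; apply: (extension_elt rat_divisible) => -[//|m] xm.
by case/negP: xS; apply/isolatorP; exists m.+1.
Qed.

Lemma qc_separation p S x : prime p -> x \notin S -> x *+ p \in S ->
  exists2 g : {additive A -> quasicyclic p}, {in S, forall y, g y = 0} & g x <> 0.
Proof.
move=> p_pr xS xp; have [c c0 cp] := qc_neq0 p_pr.
have [m xm|g gS gx] := @extension_elt A _ (qc_divisible p_pr) S x c.
  have [/dvdnP[k ->]|pm] := boolP (p %| m)%N; first by rewrite mulnC mulrnA cp mul0rn.
  by case/negP: xS; apply: coprime_mulrn_in xp xm; rewrite prime_coprime.
by exists g => //; rewrite gx; apply/eqP.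
Qed.

End Isolator.

(** * The torsion of quotients of a minimax group *)

Section MinimaxStructure.
Variable A : zmodType.
Hypothesis mA : minimax A.
Implicit Types (S G H K T U : zmodClosed A) (x y : A).

(** L is the intersection of G with the subgroup Z of the definition of minimax. Being finitely
    generated, it is contained in every subgroup close enough to G. *)
Lemma minimax_lattice G : exists s, exists L : zmodClosed A,
  [/\ forall x, x \in L <-> zspan s x, {subset L <= G} & {subset G <= isolator L}].
Proof.
have [Z [/finitely_generatedP[s Zs] artZ]] := mA.
have [Y YE] : {Y : zmodClosed A | forall x, x \in Y <-> x \in G /\ x \in Z}.
  apply: subgroup_of; first by rewrite !rpred0.
  by move=> x y [? ?] [? ?]; rewrite !rpredB.
have [t tY] : exists t, forall x, x \in Y <-> zspan t x.
  by apply: (@zspan_noetherian _ s) => x /YE[_ /Zs].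
exists t, Y; split=> // x; first by case/YE.
move=> xG; have [n n0 xn] := artinian_torsion x artZ.
by apply/isolatorP; exists n => //; apply/YE; rewrite rpredMn.
Qed.

(** The elements killed modulo S by an integer prime to n! form a decreasing chain, stationary from
    some N on. An element killed by a prime p > N lies in the N-th group, hence in the p-th, so it
    is also killed by an integer prime to p. *)
Lemma isolator_torsion_bounded S : exists N, forall p, prime p -> (N < p)%N ->
  forall x, x *+ p \in S -> x \in S.
Proof.
have X n : {K : zmodClosed A | forall x, x \in K <->
    exists m, [/\ (0 < m)%N, coprime n`! m & x *+ m \in S]}.
  apply: subgroup_of; first by exists 1%N; rewrite coprimen1 mul0rn rpred0.
  move=> x y [i [i0 ci xi]] [j [j0 cj yj]]; exists (i * j)%N.
  rewrite muln_gt0 i0 j0 coprimeMr ci cj; split=> //.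
  by rewrite mulrnBl mulrnA [(i * j)%N]mulnC mulrnA rpredB // rpredMn.
have [|||N HN] := @chain_stable A S (fun n => sval (X n)) mA.
- move=> n x /(svalP (X _))[m [m0 cm xm]]; apply/(svalP (X _)); exists m.
  by split=> //; move: cm; rewrite factS coprimeMl => /andP[].
- move=> n x xS; apply/(svalP (X _)); exists 1%N.
  by rewrite coprimen1.
- by move=> x /(svalP (X _))[m [m0 _ xm]]; exists m.
exists N => p p_pr Np x xp.
have /(HN p (ltnW Np))/(svalP (X _))[m [_ cm xm]] : x \in sval (X N).
  apply/(svalP (X _)); exists p; split=> //; first exact: prime_gt0.
  exact: coprime_fact.
apply: (coprime_mulrn_in (m := p) _ xp xm).
by apply: coprime_dvdl cm; rewrite dvdn_fact // prime_gt0 /=.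
Qed.

(** The multiples by n! of the torsion group I/S, with I the isolator, form a decreasing chain.
    Where it becomes stationary, at N0 = N!, the group D/S = N0 (I/S) is divisible. *)
Lemma torsion_divisible_part S : exists N0, exists D : zmodClosed A,
  [/\ (0 < N0)%N,
      forall x, x \in D <-> exists2 t, t \in isolator S & x - t *+ N0 \in S &
      forall n d, (0 < n)%N -> d \in D -> exists2 d', d' \in D & d - d' *+ n \in S].
Proof.
have X n : {K : zmodClosed A | forall x, x \in K <->
    exists2 t, t \in isolator S & x - t *+ n`! \in S}.
  apply: subgroup_of; first by exists 0; rewrite ?mul0rn ?subr0 rpred0.
  move=> x y [t tS xt] [u uS yu]; exists (t - u); first by rewrite rpredB.
  by rewrite mulrnBl opprD addrACA -opprD rpredB.
have [|||N HN] := @chain_stable A S (fun n => sval (X n)) mA.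
- move=> n x /(svalP (X _))[t tS xt]; apply/(svalP (X _)).
  by exists (t *+ n.+1); rewrite ?rpredMn // -mulrnA -factS.
- move=> n x xS; apply/(svalP (X _)); exists 0; first by rewrite rpred0.
  by rewrite mul0rn subr0.
- move=> x /(svalP (X _))[t /isolatorP[n n0 tn] xt]; exists n => //.
  rewrite -[x](subrK (t *+ 0`!)) mulrnDl rpredD //.
  by rewrite rpredMn.
exists N`!, (sval (X N)); split; [exact: fact_gt0|exact: svalP (X N)|].
move=> n d n0 dX.
have /(svalP (X _))[t tS dt] := HN (N + n)%N (leq_addr _ _) _ dX.
have [k kE] : exists k, (N + n)`! = (k * N`! * n)%N.
  exists ('C(N + n, N) * n.-1`!)%N; case: n n0 {dt} => // n _.
  rewrite -(bin_fact (leq_addr n.+1 N)) addKn factS -!mulnA succnK.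
  by rewrite [(N`! * (_ * _))%N]mulnA [(N`! * _ * _)%N]mulnC.
exists (t *+ (k * N`!)); last by rewrite -mulrnA -kE.
apply/(svalP (X _)); exists (t *+ k); first by rewrite rpredMn.
by rewrite -mulrnA subrr rpred0.
Qed.

Definition finite_mod K S := exists F : seq A,
  forall x, x \in K -> exists2 r, r \in F & x - r \in S.

Lemma finite_mod_fibers (T : eqType) (P : A -> T -> Prop) (L : seq T) K K' S :
    (forall x, x \in K -> exists2 l, l \in L & P x l) ->
    (forall x y l, x \in K -> y \in K -> P x l -> P y l -> x - y \in K') ->
  finite_mod K' S -> finite_mod K S.
Proof.
move=> KL Pfib [F HF].
have ex l : exists z, (exists2 x, x \in K & P x l) -> z \in K /\ P z l.
  have [[x xK xl]|no] := pselect (exists2 x, x \in K & P x l); first by exists x.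
  by exists 0 => /no.
have [z zP] := choice ex.
exists [seq z l + r | l <- L, r <- F] => x xK.
have [l lL xl] := KL x xK.
have [|zK zl] := zP l; first by exists x.
have [r rF xr] := HF _ (Pfib x _ l xK zK xl zl).
exists (z l + r); first by apply/allpairsP; exists (l, r).
by rewrite opprD addrA.
Qed.

Lemma infinite_primary_onto p S K : prime p -> {subset S <= K} ->
    (forall x, x \in K -> exists n, x *+ p ^ n \in S) ->
    ~ finite_mod K S ->
  exists2 g : {additive A -> quasicyclic p}, {in S, forall x, g x = 0} &
    forall z, exists2 x, x \in K & g x = z.
Proof.
move=> p_pr SK prim inf.
(* A minimal infinite X/S is p-divisible: otherwise it is elementary abelian,
   and then the kernel of a nonzero homomorphism to C_{p^oo} is smaller. *)
have [|||X [[SX Xinf] XK Xmin]] := @minimal_subgroup A S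
  (fun X => {subset S <= X} /\ ~ finite_mod X S) K mA.
- by move=> X [].
- by move=> x /prim[n xn]; exists (p ^ n)%N; rewrite ?expn_gt0 ?prime_gt0.
- by split.
have [x0 x0X x0S] : exists2 x0, x0 \in X & x0 \notin S.
  apply: contrapT => no; apply: Xinf; exists [:: 0] => x xX; exists 0 => //.
    by rewrite mem_head.
  by rewrite subr0; apply: contrapT => /negP xS; apply: no; exists x.
have [x1 [x1X x1S x1p]] : exists x1, [/\ x1 \in X, x1 \notin S & x1 *+ p \in S].
  have ex : exists n, x0 *+ p ^ n \in S by apply/prim/XK.
  case: (ex_minnP ex) => [[|n]] x0n nmin.
    by rewrite x0n in x0S.
  exists (x0 *+ p ^ n); split; first by rewrite rpredMn.
    by apply/negP => /nmin; rewrite ltnn.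
  by rewrite -mulrnA -expnSr.
have [g gS gx1] := qc_separation p_pr x1S x1p.
have [Y YE] : {Y : zmodClosed A | forall x, x \in Y <->
    exists2 y, y \in X & x - y *+ p \in S}.
  apply: subgroup_of; first by exists 0; rewrite ?mul0rn ?subr0 rpred0.
  move=> x y [t tS xt] [u uS yu]; exists (t - u); first by rewrite rpredB.
  by rewrite mulrnBl opprD addrACA -opprD rpredB.
have YX : {subset Y <= X}.
  by move=> x /YE[y yX xy]; rewrite -[x](subrK (y *+ p)) rpredD ?(SX _ xy) // rpredMn.
have SY : {subset S <= Y}.
  by move=> x xS; apply/YE; exists 0; rewrite ?mul0rn ?subr0 // rpred0.
have [[F HF]|Yinf] := pselect (finite_mod Y S); last first.
  exists g => // z.
  have [|y yX <-] := @image_divisible A p p_pr X g x1 x1X gx1 _ z.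
    move=> x /(Xmin Y (conj SY Yinf) YX)/YE[y yX xy]; exists y => //.
    by apply/eqP; rewrite -subr_eq0 -raddfMn -raddfB gS.
  by exists y => //; apply: XK.
exfalso.
have [T TE] : {T : zmodClosed A | forall x, x \in T <-> x \in X /\ x *+ p \in S}.
  apply: subgroup_of; first by rewrite mul0rn !rpred0.
  by move=> x y [xX xp] [yX yp]; rewrite mulrnBl !rpredB.
(* If Y/S is finite, multiplication by p has finite image on X/S, so its kernel T/S is infinite and
   T is X by minimality. Then g takes at most p values on X, so its kernel on X is infinite as
   well. *)
have XT : {subset X <= T}.
  apply: Xmin; last by move=> x /TE[].
  split; first by move=> x xS; apply/TE; rewrite SX // rpredMn.
  move=> Tfin; apply: Xinf.
  apply: (@finite_mod_fibers A (fun x r => x *+ p - r \in S) F _ T) => //.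
    move=> x xX; apply: HF; apply/YE; exists x => //.
    by rewrite subrr rpred0.
  move=> x y r xX yX xr yr; apply/TE; rewrite rpredB //; split=> //.
  by rewrite mulrnBl -(rpredDr _ yr) addrA subrK.
have XK' : {subset X <= kernel_in X g}.
  apply: Xmin; last by move=> x /kernel_inP[].
  split; first by move=> x xS; apply/kernel_inP; rewrite SX // gS.
  move=> Kfin; apply: Xinf.
  apply: (@finite_mod_fibers _ (fun x i => g x = qc p_pr 1 *+ i) (iota 0 p) _
    (kernel_in X g)) => //.
    move=> x /XT/TE[xX xp].
    have [|a gx] := @qcP p p_pr 1 (g x); first by rewrite -raddfMn gS.
    have p0 : p%:Z != 0 by rewrite -lt0n prime_gt0.
    have aE : (absz (a %% p)%Z : int) = (a %% p)%Z by rewrite gez0_abs ?modz_ge0.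
    exists (absz (a %% p)%Z).
      by rewrite mem_iota /= add0n -ltz_nat aE ltz_pmod // ltz_nat prime_gt0.
    rewrite gx; apply/eqP; rewrite -subr_eq0 pmulrn aE -mulrzBr qc_eq0 expn1.
    by rewrite {1}(divz_eq a p) addrK abszM dvdn_mull.
  move=> x y i xX yX gx gy; apply/kernel_inP; rewrite rpredB //.
  by rewrite raddfB gx gy subrr.
by have /XK'/kernel_inP[_] := x1X.
Qed.

End MinimaxStructure.

(** * Torsion-free corank *)

(** Any n+1 vectors of Q^n are linearly dependent. Clearing denominators gives integer coefficients,
    so that the relation can be transported to an abelian group. *)
Lemma rat_relation n (M : nat -> nat -> rat) : exists c : nat -> int,
  (exists2 i, (i <= n)%N & c i != 0) /\
  forall j, (j < n)%N -> \sum_(i < n.+1) M i j * (c i)%:~R = 0.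
Proof.
pose B := \matrix_(i < n.+1, j < n) M i j.
have /rowV0Pn[v /sub_kermxP vB v0] : kermx B != 0.
  rewrite kermx_eq0 /row_free neq_ltn (leq_ltn_trans (rank_leq_col B)) //.
have [i0 vi0] : exists i, v 0 i != 0 by apply/rV0Pn.
pose D : int := \prod_i denq (v 0 i).
have D0 : D != 0 by apply/prodf_neq0 => i _; apply: denq_neq0.
have [c cE] : {c : 'I_n.+1 -> int & forall i, (c i)%:~R = D%:~R * v 0 i}.
  have ex i : exists c : int, c%:~R = D%:~R * v 0 i.
    exists ((\prod_(k | k != i) denq (v 0 k)) * numq (v 0 i)).
    rewrite [in RHS]/D [in RHS](bigD1 i) //= !intrM numqE.
    by rewrite mulrA [LHS]mulrC mulrA.
  exact: choice ex.
exists (fun i => c (inord i)); split.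
  exists i0; first by rewrite -ltnS.
  by rewrite inord_val -(intr_eq0 rat) cE mulf_neq0 // intr_eq0.
move=> j jn; have /rowP/(_ (Ordinal jn)) := vB; rewrite !mxE => E.
rewrite -[RHS](mulr0 D%:~R) -[X in _ = _ * X]E mulr_sumr; apply: eq_bigr => i _ /=.
by rewrite inord_val cE mxE mulrC mulrA.
Qed.

Lemma zspan_sum (A : zmodType) (s : seq A) x : zspan s x ->
  exists c : nat -> int, x = \sum_(k < size s) s`_k *~ c k.
Proof.
elim: s x => [|a s IH] x /=; first by move=> ->; exists (fun _ => 0); rewrite big_ord0.
move=> [m /IH[c E]]; exists (fun k => if k is k'.+1 then c k' else m).
by rewrite big_ord_recl /= -E addrC subrK.
Qed.

Section DualSystems.
Variable A : zmodType.
Hypothesis mA : minimax A.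
Implicit Types (S G H K T U : zmodClosed A) (y : A).
Implicit Types (f : nat -> {additive A -> rat}) (x : nat -> A).

(** A certificate that A/K has rank at least n. In [corank] the functionals moreover cut out K, so
    that A/K is torsion-free of rank exactly n; tensor products are thereby postponed to the
    comparison with [rank]. *)
Definition dual K n f x :=
  (forall i, (i < n)%N -> {in K, forall y, f i y = 0}) /\
  forall i j, (i < n)%N -> (j < n)%N -> f i (x j) = (i == j)%:R.

Definition corank K n := exists f x, dual K n f x /\
  forall y, (forall i, (i < n)%N -> f i y = 0) -> y \in K.

Lemma dual_sum K n f x (c : nat -> int) i m : dual K n f x -> (m <= n)%N ->
  (i < m)%N -> f i (\sum_(j < m) x j *~ c j) = (c i)%:~R.
Proof.
move=> [_ fx] mn im; rewrite raddf_sum (bigD1 (Ordinal im)) //= raddfMz.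
have lt k : (k < m)%N -> (k < n)%N by move=> /leq_trans; apply.
rewrite fx ?lt // eqxx big1 ?addr0 // => j /eqP ji.
rewrite raddfMz fx ?lt // (_ : (i == j) = false) ?mul0rz //.
by apply/eqP => ij; apply: ji; apply: val_inj.
Qed.

(** Positive multiples of the x j lie in a lattice spanned by s. More than [size s] of them would be
    linearly dependent, which the functionals of a dual system forbid. *)
Lemma dual_bounded : exists m, forall K n f x, dual K n f x -> (n <= m)%N.
Proof.
have [s [L [Ls _ LA]]] := minimax_lattice mA full_subgroup.
exists (size s) => K n f x fx; rewrite leqNgt; apply/negP => sn.
have ex j : exists Nc : nat * (nat -> int), (0 < Nc.1)%N /\
    x j *+ Nc.1 = \sum_(k < size s) s`_k *~ Nc.2 k.
  have /LA/isolatorP[N N0 /Ls/zspan_sum[c E]] := full_subgroupP (x j).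
  by exists (N, c).
have [Nc NcE] := choice ex.
have [d [[i im di] dE]] := rat_relation (size s) (fun j k => ((Nc j).2 k)%:~R).
have rel0 : \sum_(j < (size s).+1) x j *~ ((Nc j).1%:Z * d j) = 0.
  have E j : x j *~ ((Nc j).1%:Z * d j) = \sum_(k < size s) s`_k *~ ((Nc j).2 k * d j).
    rewrite mulrzA -pmulrn (NcE j).2 mulrz_suml; apply: eq_bigr => k _.
    by rewrite mulrzA.
  under eq_bigr do rewrite E.
  rewrite exchange_big big1 // => k _ /=; rewrite -mulrz_sumr.
  rewrite (_ : \sum_(j < _) _ = 0) ?mulr0z //; apply: (@intr_inj rat).
  rewrite rmorph_sum /= -[RHS](dE k) //; apply: eq_bigr => j _.
  by rewrite rmorphM.
have := dual_sum (fun j => (Nc j).1%:Z * d j) fx sn (im : (i < (size s).+1)%N).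
rewrite rel0 raddf0 => /esym/eqP; rewrite intr_eq0 mulf_eq0 (negPf di) orbF.
by rewrite eqz_nat eqn0Ngt (NcE i).1.
Qed.

Lemma corank_pure K n y m : corank K n -> (m != 0) -> y *~ m \in K -> y \in K.
Proof.
move=> [f [x [[fK _] kerf]]] m0 yK; apply: kerf => i /fK/(_ _ yK)/eqP.
by rewrite raddfMz mulrz_eq0 (negPf m0) => /eqP.
Qed.

(** With n' > n, some nontrivial integer combination of the x j is killed by the n functionals that
    cut out K; it lies in K, hence in K', against duality. *)
Lemma dual_le_corank K K' n n' f x : corank K n -> {subset K <= K'} ->
  dual K' n' f x -> (n' <= n)%N.
Proof.
move=> [g [z [[gK _] kerg]]] KK fx; rewrite leqNgt; apply/negP => nn'.
have [c [[i im ci] cE]] := rat_relation n (fun j i => g i (x j)).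
have /KK sK : \sum_(j < n.+1) x j *~ c j \in K.
  apply: kerg => k /cE; rewrite raddf_sum => E; rewrite -[RHS]E.
  by apply: eq_bigr => j _; rewrite raddfMz mulrzr.
have := dual_sum c fx nn' (im : (i < n.+1)%N); rewrite fx.1 //.
  by move/esym/eqP; rewrite intr_eq0 (negPf ci).
exact: leq_ltn_trans nn'.
Qed.

Lemma corank_le K K' n n' : corank K n -> corank K' n' -> {subset K <= K'} ->
  (n' <= n)%N.
Proof. by move=> Kn [f [x [fx _]]] KK; apply: dual_le_corank Kn KK fx. Qed.

Lemma eq_corank K K' n n' : K =i K' -> corank K n -> corank K' n' -> n = n'.
Proof.
move=> KK Kn Kn'; apply/eqP; rewrite eqn_leq.
by rewrite (corank_le Kn' Kn) ?(corank_le Kn Kn') // => y; rewrite KK.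
Qed.

(** For u in K', the n dual vectors of K' and u satisfy an integer relation modulo K. Testing it
    with the functionals of K' leaves a nonzero multiple of u in K, and K is pure. *)
Lemma corank_eq_sub K K' n : corank K n -> corank K' n -> {subset K <= K'} ->
  {subset K' <= K}.
Proof.
move=> Kn [f [x [fx _]]] KK u uK'; have [g [z [[gK _] kerg]]] := Kn.
pose y j := if (j < n)%N then x j else u.
have [c [[i im ci] cE]] := rat_relation n (fun j i => g i (y j)).
have sK : \sum_(j < n.+1) y j *~ c j \in K.
  apply: kerg => k /cE; rewrite raddf_sum => E; rewrite -[RHS]E.
  by apply: eq_bigr => j _; rewrite raddfMz mulrzr.
have c0 j : (j < n)%N -> c j = 0.
  move=> jn; have := KK _ sK => /(fx.1 j jn).
  rewrite big_ord_recr /= raddfD raddfMz /y ltnn (fx.1 j jn u uK') mul0rz addr0.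
  under eq_bigr do rewrite ltn_ord.
  by rewrite (dual_sum c fx (leqnn n) jn) => /eqP; rewrite intr_eq0 => /eqP.
have cn : c n != 0.
  by move: im; rewrite leq_eqVlt => /predU1P[<- //|/c0 E]; rewrite E eqxx in ci.
apply: (corank_pure Kn cn); move: sK; rewrite big_ord_recr /= /y ltnn.
by rewrite big1 ?add0r // => j _; rewrite c0 // mulr0z.
Qed.

(** One Gram-Schmidt step: h separates u from K, and subtracting its components along the f j makes
    it vanish on the x j without changing its value at u. *)
Lemma dual_extend K n f x u : {subset isolator K <= K} ->
    dual K n f x -> (forall i, (i < n)%N -> f i u = 0) -> u \notin K ->
  exists f' x', dual K n.+1 f' x'.
Proof.
move=> Kpure [fK fx] fu uK.
have [|h hK hu] := @rat_separation _ K u; first by apply: contra uK => /Kpure.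
have hB : {morph (fun y => h y - \sum_(j < n) h (x j) * f j y) : y z / y - z}.
  move=> y z; rewrite raddfB; have -> : \sum_(j < n) h (x j) * f j (y - z) =
      \sum_(j < n) h (x j) * f j y - \sum_(j < n) h (x j) * f j z.
    by rewrite -sumrB; apply: eq_bigr => j _; rewrite raddfB mulrBr.
  by rewrite opprD addrACA -opprD.
have [h' h'E] := additive_of hB.
exists (fun i => if (i < n)%N then f i else h'), (fun i => if (i < n)%N then x i else u).
split=> [i _ y yK|i j].
  case: ifP => [/fK|_]; first exact.
  rewrite h'E hK // big1 ?subr0 // => j _.
  by rewrite (fK j (ltn_ord j) y yK) mulr0.
rewrite !ltnS => i_le j_le.
case: (ltnP i n) => [iltn|ni]; case: (ltnP j n) => [jltn|nj].
- exact: fx.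
- by rewrite fu // ltn_eqF // (leq_trans iltn).
- have -> : i = n by apply/eqP; rewrite eqn_leq i_le.
  rewrite gtn_eqF // h'E (bigD1 (Ordinal jltn)) //= fx // eqxx mulr1.
  rewrite big1 ?addr0 ?subrr // => k /eqP kj.
  rewrite fx // (_ : (nat_of_ord k == j) = false) ?mulr0 //.
  by apply/eqP => E; apply: kj; apply: val_inj.
- have -> : i = n by apply/eqP; rewrite eqn_leq i_le.
  have -> : j = n by apply/eqP; rewrite eqn_leq j_le.
  rewrite eqxx h'E hu big1 ?subr0 // => k _.
  by rewrite fu // mulr0.
Qed.

Lemma corank_exists K : {subset isolator K <= K} -> exists n, corank K n.
Proof.
move=> Kpure; have [m mb] := dual_bounded.
have ex : exists n, `[< exists f x, dual K n f x >].
  have z : {morph (fun _ : A => 0 : rat) : x y / x - y}.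
    by move=> *; rewrite subrr.
  by exists 0%N; apply/asboolP; exists (fun _ => sval (additive_of z)), (fun _ => 0).
have ub n : `[< exists f x, dual K n f x >] -> (n <= m)%N.
  by move=> /asboolP[f [x /mb]].
case: (ex_maxnP ex ub) => n /asboolP[f [x fx]] nmax.
exists n, f, x; split=> // u fu; apply: contrapT => /negP uK.
have /asboolP/nmax := dual_extend Kpure fx fu uK.
by rewrite ltnn.
Qed.

Lemma corankS K n : corank K n.+1 ->
  exists K', [/\ {subset K <= K'}, corank K' n & ~ {subset K' <= K}].
Proof.
move=> Kn; have [f [x [[fK fx] kerf]]] := Kn.
have [K' K'E] : {K' : zmodClosed A | forall y, y \in K' <->
    forall i, (i < n)%N -> f i y = 0}.
  apply: subgroup_of => [i _|y z fy fz i ii]; first by rewrite raddf0.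
  by rewrite raddfB fy // fz // subr0.
have KK : {subset K <= K'}.
  by move=> y yK; apply/K'E => i ii; apply: fK => //; apply: ltnW.
have K'n : corank K' n.
  exists f, x; split; last by move=> y /K'E.
  split; first by move=> i ii y /K'E; apply.
  by move=> i j ii jj; rewrite fx // ltnW.
exists K'; split=> // K'K.
by have := corank_le K'n Kn K'K; rewrite ltnn.
Qed.

End DualSystems.

(** * Homomorphisms to Q and to R_V *)

Lemma dvdz_denq (x : rat) (m : int) : x * m%:~R \is a Num.int -> (denq x %| m)%Z.
Proof.
move=> /intrP[k xm]; have : numq x * m = k * denq x.
  apply: (@intr_inj rat); rewrite !intrM -xm numqE.
  by rewrite -!mulrA [_%:~R * m%:~R]mulrC.
move=> E; have : (denq x %| numq x * m)%Z by rewrite E dvdz_mull.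
by rewrite Gauss_dvdzr // coprimezE coprime_sym coprime_num_den.
Qed.

(* phi is the projection of Q onto C_{p^oo}, whose kernel is Z localized at p. *)
Lemma rat_onto_qc p : prime p -> exists phi : {additive rat -> quasicyclic p},
  forall q n, phi q *+ p ^ n = 0 ->
    exists m, [/\ (0 < m)%N, coprime p m & q * (p ^ n * m)%:R \is a Num.int].
Proof.
move=> p_pr.
have [R RE] : {R : zmodClosed (rat * quasicyclic p)%type | forall u, u \in R <->
    exists x : Zinv p, u = (val x, \pi_(quasicyclic p) x)}.
  apply: subgroup_of; first by exists 0; rewrite !raddf0.
  by move=> _ _ [x ->] [y ->]; exists (x - y); rewrite !raddfB.
have [|phi phiE] := @divisible_extension _ _ R (qc_divisible p_pr).
  by move=> y /RE[x [x0 ->]]; rewrite (_ : x = 0) ?raddf0 //; apply: val_inj; rewrite /= -x0.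
exists phi => q n qn.
have d0 : (0 < `|denq q|)%N by rewrite absz_gt0 denq_neq0.
have [m pm mE] := pfactor_coprime p_pr d0; exists m.
have m0 : (0 < m)%N by move: d0; rewrite mE; case: (m).
have qm : q * m%:R \in Zinv_pred p.
  apply/asboolP; exists (logn p `|denq q|); rewrite -natrX -mulrA -natrM -mE.
  have -> : `|denq q|%N%:R = (denq q)%:~R :> rat by rewrite pmulrn gez0_abs.
  by rewrite -numqE intr_int.
pose x : Zinv p := Sub (q * m%:R) qm.
have phx : phi (q * m%:R) = \pi_(quasicyclic p) x by apply: phiE; apply/RE; exists x.
split=> //; have : \pi_(quasicyclic p) (x *+ p ^ n) = 0.
  by rewrite raddfMn /= -phx mulr_natr raddfMn mulrnAC qn mul0rn.
move=> /ideal_quot_eq0; rewrite inE raddfMn /=.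
by rewrite -[_ *+ p ^ n]mulr_natr -mulrA -natrM mulnC.
Qed.

Lemma mulrz_abs_eq0 (A : zmodType) (x : A) (j : int) :
  x *~ j = 0 <-> x *+ `|j|%N = 0.
Proof. by rewrite -!trivial_subgroupP mulrz_in. Qed.

Section RatImages.
Variable A : zmodType.
Hypothesis mA : minimax A.
Implicit Types (S G H K T U : zmodClosed A) (x y : A).

(** For large p the quotient by a full lattice has no p-torsion, so each x has a multiple prime to p
    in the lattice. A map to C_{p^oo} is bounded on the lattice, hence on A. *)
Lemma lp_large_prime : exists N, forall p, prime p -> (N < p)%N ->
  lp p (@trivial_subgroup A) full_subgroup = 0%N.
Proof.
have [s [L [Ls _ LA]]] := minimax_lattice mA full_subgroup.
have [N HN] := isolator_torsion_bounded mA L.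
exists N => p p_pr Np; apply: lp_eq0 => // f _.
have [n fn] := zspan_bounded s f; exists n => x _.
have /LA/isolatorP[k k0 xk] := full_subgroupP x.
have [m pm kE] := pfactor_coprime p_pr k0.
have xm : x *+ m \in L.
  move: xk; rewrite {}kE; elim: (logn p k) => [|i IH]; first by rewrite muln1.
  by rewrite expnSr mulnA mulrnA => /(HN p p_pr Np).
apply: (qc_coprime_eq0 p_pr pm).
by rewrite -mulrnA mulnC mulrnA -[f x *+ m]raddfMn fn //; apply/Ls.
Qed.

(** Composing h with the projection of Q onto C_{p^oo} gives a map that is not onto, hence bounded;
    this bounds the p-part of the denominators of h on G. *)
Lemma rat_image_bounded p H G (h : {additive A -> rat}) : prime p ->
    {in H, forall x, h x = 0} -> lp p H G = 0%N ->
  exists n, forall x, x \in G ->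
    exists m, [/\ (0 < m)%N, coprime p m & h x * (p ^ n * m)%:R \is a Num.int].
Proof.
move=> p_pr hH lp0; have [phi phiP] := rat_onto_qc p_pr.
have cB : {morph (fun x => phi (h x)) : x y / x - y}.
  by move=> x y; rewrite !raddfB.
have [c cE] := additive_of cB.
have [[n bn]|onto_c] := image_bounded_or_onto p_pr G c.
  by exists n => x /bn; rewrite cE => /phiP.
suff : (0 < lp p H G)%N by rewrite lp0.
apply/(lp_gt0P p_pr mA); exists c => // x xH.
by rewrite cE hH // raddf0.
Qed.

(** The p-part of the denominators of h is at most p^n on G, so q = p^k h(y) forces p^k to divide
    the numerator of q times p^n. *)
Lemma rat_image_not_divisible p G (h : {additive A -> rat}) q : prime p ->
    lp p trivial_subgroup G = 0%N -> q != 0 ->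
  exists k0, forall k y, (k0 <= k)%N -> y \in G -> q != h y *+ p ^ k.
Proof.
move=> p_pr lp0 q0.
have [|n nP] := @rat_image_bounded p trivial_subgroup G h p_pr _ lp0.
  by move=> x /trivial_subgroupP ->; rewrite raddf0.
(* Since k < p^k, no positive number below or equal to k is divisible by p^k. *)
exists (absz (numq q) * p ^ n)%N => k y kk yG; apply/eqP => E.
have [m [m0 pm /intrP[b hb]]] := nP y yG.
have E2 : (p ^ k %| absz (numq q) * p ^ n * m)%N.
  have : numq q * (p ^ n * m)%N = b * (p ^ k)%N * denq q.
    apply: (@intr_inj rat); rewrite !intrM numqE -hb.
    rewrite {1}E -!pmulrn -[_ *+ p ^ k]mulr_natr.
    by rewrite -!mulrA; congr (_ * _); rewrite mulrA mulrC.
  move=> /(congr1 absz); rewrite !abszM /= mulnA => ->.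
  by rewrite -mulnA dvdn_mull // dvdn_mulr.
move: E2; rewrite Gauss_dvdl ?coprimeXl // => /dvdn_leq.
rewrite muln_gt0 absz_gt0 numq_eq0 q0 expn_gt0 prime_gt0 // => /(_ isT).
apply/negP; rewrite -ltnNge; apply: leq_ltn_trans kk _.
by rewrite ltn_expl // prime_gt1.
Qed.

(** A rational functional separating x from S has denominators with bounded p-part for each p in V.
    As V is finite, one integer N clears these parts for all p in V at once, and N h takes values in
    R_V. *)
Lemma Rloc_separation (V : set nat) (L : seq nat) S x :
    (forall p, prime p -> V p -> p \in L) ->
    (forall p, prime p -> V p -> lp p (isolator S) full_subgroup = 0%N) ->
    x \notin isolator S ->
  exists2 g : {additive A -> Rloc V}, {in S, forall y, g y = 0} & g x <> 0.
Proof.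
move=> VL lp0 xS; have [h hS hx] := rat_separation xS.
have ex p : exists n, prime p -> V p -> forall y : A,
    exists m, [/\ (0 < m)%N, coprime p m & h y * (p ^ n * m)%:R \is a Num.int].
  have [[p_pr Vp]|no] := pselect (prime p /\ V p); last by exists 0%N => ? ?; case: no.
  have [n nP] := rat_image_bounded p_pr (additive_rat_isolator hS) (lp0 p p_pr Vp).
  by exists n => _ _ y; apply: nP.
have [n nP] := choice ex.
pose N := (\prod_(p <- L | prime p) p ^ n p)%N.
have NV y : h y * N%:R \in Rloc_pred V.
  apply/asboolP => p p_pr Vp; have [m [m0 pm hm]] := nP p p_pr Vp y.
  have : (denq (h y * N%:R)%R %| Posz m)%Z.
    apply: dvdz_denq; have /dvdnP[k ->] : (p ^ n p %| N)%N.
      by rewrite /N (big_rem p) ?VL //= p_pr dvdn_mulr.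
    rewrite -pmulrn -mulrA -natrM -mulnA mulnC natrM mulrA.
    by rewrite rpredM // natr_int.
  rewrite dvdzE /= => dm; apply/negP => /dvdn_trans /(_ dm).
  by apply/negP; rewrite -prime_coprime.
have gB : {morph (fun y => Sub (h y * N%:R) (NV y) : Rloc V) : y z / y - z}.
  by move=> y z; apply: val_inj; rewrite [RHS]raddfB /= raddfB mulrBl.
have [g gE] := additive_of gB.
exists g => [y yS|]; first by apply: val_inj; rewrite gE /= hS // mul0r.
rewrite gE => /(congr1 val); rewrite /= hx mul1r => /eqP.
rewrite pnatr_eq0 -leqn0 leqNgt => /negP; apply; rewrite /N.
elim/big_ind: _ => // [a b a0 b0|p p_pr]; first by rewrite muln_gt0 a0.
by rewrite expn_gt0 prime_gt0.
Qed.

(** K/H embeds in R_V. A fixed x1 outside H bounds the order of every f(x): modulo H, a multiple of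
    x is a multiple of x1, and the p-part of its coefficient comes from the numerator of g(x1)
    alone, denominators in R_V being prime to p. *)
Lemma lp_Rloc_kernel (V : set nat) K H p (g : {additive A -> Rloc V}) :
    prime p -> V p -> (forall x, x \in H <-> x \in K /\ g x = 0) ->
  lp p H K = 0%N.
Proof.
move=> p_pr Vp HE; apply: lp_eq0 => // f fH.
have [[x1 x1K x1g]|no] := pselect (exists2 x, x \in K & g x <> 0); last first.
  exists 0%N => x xK; rewrite fH ?mul0rn //; apply/HE; split=> //.
  by apply: contrapT => gx; apply: no; exists x.
have GB : {morph (fun x => val (g x)) : x y / x - y} by move=> x y; rewrite !raddfB.
have [G GE] := additive_of GB.
have G0 x : G x = 0 -> g x = 0 by rewrite GE => gx; apply: val_inj; rewrite raddf0.
pose a := G x1; have a0 : a != 0 by apply/eqP => /G0.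
have na0 : (0 < `|numq a|)%N by rewrite absz_gt0 numq_eq0.
have [m pm] := pfactor_coprime p_pr na0; move: (logn p _) => l mE.
have [n fx1] := qc_torsion (f x1); exists (l + n)%N => x xK.
pose b := G x.
have pd : coprime p `|denq b|.
  by rewrite /b GE prime_coprime //; have /asboolP := valP (g x); apply.
have xH : x *~ (numq a * denq b) - x1 *~ (numq b * denq a) \in H.
  apply/HE; split; first by rewrite rpredB // rpredMz.
  apply: G0; rewrite raddfB [G (x *~ _)]raddfMz [G (x1 *~ _)]raddfMz -/a -/b.
  rewrite -[b *~ _]mulrzr -[a *~ _]mulrzr !intrM !numqE; apply/eqP; rewrite subr_eq0; apply/eqP.
  by rewrite mulrCA -!mulrA; congr (_ * _); rewrite mulrC -mulrA.
have := fH _ xH; rewrite raddfB [f (x *~ _)]raddfMz [f (x1 *~ _)]raddfMz.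
move=> /eqP; rewrite subr_eq0 => /eqP E.
have pmd : coprime p (m * `|denq b|) by rewrite coprimeMr pm.
apply: (qc_coprime_eq0 p_pr pmd).
have : f x *~ (numq a * denq b * (p ^ n)%N) = 0.
  by rewrite mulrzA E mulrzAC -pmulrn fx1 mul0rz.
move/mulrz_abs_eq0; rewrite !abszM mE /= -mulrnA => <-; congr (_ *+ _).
by rewrite expnD; lia.
Qed.

(** This subgroup is the preimage in A of U_V(A/S). *)
Fact Rloc_kernel_subproof (V : set nat) S : {K : zmodClosed A | forall x, x \in K <->
  forall g : {additive A -> Rloc V}, {in S, forall y, g y = 0} -> g x = 0}.
Proof.
apply: subgroup_of => [g _|x y gx gy g gS]; first by rewrite raddf0.
by rewrite raddfB gx // gy // subr0.
Qed.
Definition Rloc_kernel V S := sval (Rloc_kernel_subproof V S).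
Lemma Rloc_kernelP V S x : x \in Rloc_kernel V S <->
  forall g : {additive A -> Rloc V}, {in S, forall y, g y = 0} -> g x = 0.
Proof. exact: svalP (Rloc_kernel_subproof V S) x. Qed.

Lemma Rloc_mulrn_eq0 (V : set nat) (u : Rloc V) n : (0 < n)%N -> u *+ n = 0 -> u = 0.
Proof.
move=> n0 /(congr1 val); rewrite raddfMn raddf0 /= => /eqP.
rewrite mulrn_eq0 eqn0Ngt n0 => /eqP u0.
by apply: val_inj; rewrite raddf0.
Qed.

Lemma sub_Rloc_kernel V S : {subset S <= Rloc_kernel V S}.
Proof. by move=> x xS; apply/Rloc_kernelP => g; apply. Qed.

Lemma Rloc_kernel_pure V S n x : (0 < n)%N -> x *+ n \in Rloc_kernel V S ->
  x \in Rloc_kernel V S.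
Proof.
move=> n0 /Rloc_kernelP xn; apply/Rloc_kernelP => g gS.
by apply: (Rloc_mulrn_eq0 n0); rewrite -raddfMn xn.
Qed.

Lemma isolator_Rloc_kernel V S : {subset isolator S <= Rloc_kernel V S}.
Proof. by apply: isolator_least (@sub_Rloc_kernel V S) (@Rloc_kernel_pure V S). Qed.

Lemma Rloc_kernel_isolated V S :
  {subset isolator (Rloc_kernel V S) <= Rloc_kernel V S}.
Proof. by apply: isolator_least => // n x; apply: Rloc_kernel_pure. Qed.

(* The quotient by the kernel embeds in a finite power of R_V. *)
Lemma lp_Rloc_kernel_full V S p : prime p -> V p ->
  lp p (Rloc_kernel V S) full_subgroup = 0%N.
Proof.
move=> p_pr Vp; have [m mb] := dual_bounded mA.
set U := Rloc_kernel V S.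
(* Cutting K by one more homomorphism to R_V preserves the length over U and strictly raises the
   corank. The latter is bounded by m, so the descent from A must stop at U. *)
have step (K : zmodClosed A) n : {subset U <= K} -> corank K n ->
    lp p U K = 0%N \/ exists K' n', [/\ {subset U <= K'}, corank K' n', (n < n' <= m)%N &
      lp p U K = lp p U K'].
  move=> UK Kn; have [KU|/existsNP[x /not_implyP[xK /negP xU]]] :=
      pselect (forall x, x \in K -> x \in U).
    by left; apply: lp_eq0 => // f fU; exists 0%N => x /KU/fU ->; rewrite mul0rn.
  right; have [g gS gx] : exists2 g : {additive A -> Rloc V},
      {in S, forall y, g y = 0} & g x <> 0.
    apply: contrapT => no; case/negP: xU; apply/Rloc_kernelP => g gS.
    by apply: contrapT => gx; apply: no; exists g.
  have UK' : {subset U <= kernel_in K g}.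
    by move=> y yU; apply/kernel_inP; rewrite UK //; split=> //; move/Rloc_kernelP: yU; apply.
  have K'K : {subset kernel_in K g <= K} by move=> y /kernel_inP[].
  have [|n' K'n'] := @corank_exists A mA (kernel_in K g).
    apply: isolator_least => // i y i0 /kernel_inP[yK gy]; apply/kernel_inP; split.
      by apply: (corank_pure Kn (m := i%:Z)); rewrite // -lt0n.
    by apply: (Rloc_mulrn_eq0 i0); rewrite -raddfMn.
  exists (kernel_in K g), n'; split=> //; last first.
    have E : lp p (kernel_in K g) K = 0%N.
      exact: (lp_Rloc_kernel p_pr Vp (kernel_inP K g)).
    by rewrite (lp_add p_pr mA UK' K'K) E addn0.
  have -> : (n' <= m)%N by have [f [z [/mb]]] := K'n'.
  rewrite andbT ltn_neqAle (corank_le K'n' Kn K'K) andbT; apply/eqP => E.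
  rewrite -E in K'n'; have /(_ x xK)/kernel_inP[_] := corank_eq_sub K'n' Kn K'K.
  exact: gx.
suff main k (K : zmodClosed A) n : {subset U <= K} -> corank K n ->
    (m <= n + k)%N -> lp p U K = 0%N.
  have [|n fulln] := @corank_exists A mA full_subgroup; first by [].
  exact: (main m _ n _ fulln (leq_addl _ _)).
elim: k K n => [|k IH] K n UK Kn mnk.
  by have [//|[K' [n' [_ _ /andP[]]]]] := step K n UK Kn; lia.
have [//|[K' [n' [UK' K'n' /andP[nn' _] ->]]]] := step K n UK Kn.
by apply: IH UK' K'n' _; lia.
Qed.








End RatImages.

(** * Approximating a subgroup *)

Section Constructions.
Variable A : zmodType.
Hypothesis mA : minimax A.
Implicit Types (S G H K T U : zmodClosed A) (x y : A) (F : seq A).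

(* For fixed S, the sets of T with agree F S T are the basic neighbourhoods. *)
Definition agree F S T := forall x, x \in F -> (x \in T) = (x \in S).

Lemma finite_p_bounded p F (f : {additive A -> quasicyclic p}) :
  exists n, forall m x, (n <= m)%N -> x \in F -> f x *+ p ^ m = 0.
Proof.
have [n fn] := zspan_bounded F f; exists n => m x nm /mem_zspan/fn fx.
by rewrite -(subnKC nm) expnD mulrnA fx mul0rn.
Qed.

Lemma additive_mulrn (D : zmodType) (f : {additive A -> D}) n :
  {g : {additive A -> D} | forall x, g x = f x *+ n}.
Proof.
have gB : {morph (fun x => f x *+ n) : x y / x - y}.
  by move=> x y; rewrite raddfB mulrnBl.
by have [g gE] := additive_of gB; exists g.
Qed.

Lemma shrink_subgroup p S F : prime p -> (0 < lp p trivial_subgroup S)%N ->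
  exists T, [/\ agree F S T, {subset T <= S}, {subset S <= isolator T},
    lp p trivial_subgroup S = (lp p trivial_subgroup T).+1 &
    forall q, prime q -> q <> p ->
      lp q trivial_subgroup T = lp q trivial_subgroup S].
Proof.
move=> p_pr /(lp_gt0P p_pr mA)[f _ fS].
have [n fn] := finite_p_bounded F f.
have [g gE] := additive_mulrn f (p ^ n).
have TS : {subset kernel_in S g <= S} by move=> x /kernel_inP[].
have Stors x : x \in S -> exists m, x *+ p ^ m \in kernel_in S g.
  move=> xS; have [m gm] := qc_torsion (g x); exists m.
  by apply/kernel_inP; rewrite rpredMn // raddfMn.
exists (kernel_in S g); split=> //.
- move=> x xF; apply/idP/idP => [/TS //|xS]; apply/kernel_inP; split=> //.
  by rewrite gE fn.
- move=> x /Stors[m xm]; apply/isolatorP; exists (p ^ m)%N => //.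
  by rewrite expn_gt0 prime_gt0.
- rewrite (lp_add p_pr mA (@sub_trivial_subgroup _ _) TS) -addn1; congr (_ + _)%N.
  apply/eqP; rewrite eqn_leq (onto_kernel_le1 p_pr (lpP p_pr mA _ _).1) /=.
  apply/(lp_gt0P p_pr mA); exists g; first by move=> x /kernel_inP[].
  move=> z; have pn0 : (0 < p ^ n)%N by rewrite expn_gt0 prime_gt0.
  have [w <-] := qc_divisible p_pr z pn0; have [x xS <-] := fS w.
  by exists x.
- move=> q q_pr qp; rewrite [RHS](lp_add q_pr mA (@sub_trivial_subgroup _ _) TS).
  rewrite [X in (_ + X)%N]lp_eq0 ?addn0 // => h hT; exists 0%N => x /Stors[m xm].
  rewrite (@qc_coprime_eq0 q (h x) (p ^ m)) ?mul0rn //; last by rewrite -raddfMn hT.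
  by rewrite prime_coprime // Euclid_dvdX // dvdn_prime2 //; apply/negP => /andP[/eqP].
Qed.

(* Up to a finite group, the torsion of A/S is divisible and so splits off. *)
Lemma isolator_complement S : exists N0, exists C : zmodClosed A,
  [/\ (0 < N0)%N, {subset S <= C},
    forall x, x \in C -> x \in isolator S -> x *+ N0 \in S &
    forall x, exists c t, [/\ c \in C, t \in isolator S & x = c + t]].
Proof.
have [N0 [D [N00 DE Ddiv]]] := torsion_divisible_part mA S.
have SD : {subset S <= D}.
  by move=> x xS; apply/DE; exists 0; rewrite ?rpred0 // mul0rn subr0.
have DI : {subset D <= isolator S}.
  move=> x /DE[t tS xt]; rewrite -[x](subrK (t *+ N0)) rpredD ?rpredMn //.
  exact: sub_isolator.
have [C [SC CD Call]] := complement SD Ddiv.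
exists N0, C; split=> //.
  move=> x xC xS; apply: CD; first by rewrite rpredMn.
  by apply/DE; exists x; rewrite // subrr rpred0.
by move=> x; have [c [d [cC /DI dS ->]]] := Call x; exists c, d.
Qed.

(** For x outside the isolator some rational functional h kills S with h(x) = 1, while h(y) p^k = 1
    is impossible for large k because l_p(A) = 0 bounds the p-part of the denominators of h. *)
Lemma finite_far F S p : lp p (@trivial_subgroup A) full_subgroup = 0%N -> prime p ->
  (* The stronger claim, for all exponents j >= k, lets the bounds for the elements of F be combined
     by a maximum. *)
  exists k, forall x y, x \in F -> x \notin isolator S -> x - y *+ p ^ k \notin S.
Proof.
move=> lp0 p_pr; suff [k kP] : exists k, forall j x y, (k <= j)%N -> x \in F ->
    x \notin isolator S -> x - y *+ p ^ j \notin S.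
  by exists k => x y; apply: kP.
elim: F => [|z F [k kP]]; first by exists 0%N.
have [zS|zS] := boolP (z \in isolator S).
  exists k => j x y kj; rewrite in_cons => /predU1P[->|]; first by rewrite zS.
  exact: kP.
have [h hS hz] := rat_separation zS.
have [k1 k1P] := rat_image_not_divisible mA h p_pr lp0 (oner_neq0 _).
exists (maxn k k1) => j x y; rewrite geq_max => /andP[kj k1j].
rewrite in_cons => /predU1P[->|]; last exact: kP.
move=> _; apply: contra (k1P j y k1j (full_subgroupP y)) => /hS/eqP.
by rewrite raddfB raddfMn hz subr_eq0.
Qed.

(** K is T + H, so this is the second isomorphism theorem for lengths; maps given on T and vanishing
    on S are glued with 0 on H. *)
Lemma lp_meet p S H T K : prime p -> {subset S <= H} ->
    (forall x, x \in T -> x \in H -> x \in S) ->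
    (forall x, x \in K <-> exists2 t, t \in T & x - t \in H) ->
  lp p H K = lp p S T.
Proof.
move=> p_pr SH THS KE; apply/eqP; rewrite eqn_leq; apply/andP; split.
  apply: (lpP p_pr mA _ _).2; have [f [fH fK]] := (lpP p_pr mA H K).1.
  exists f; split=> [i ik x /SH|y]; first exact: fH.
  have [x /KE[t tT xt] fx] := fK y; exists t => // i ik.
  by apply/eqP; rewrite -fx // eq_sym -subr_eq0 -raddfB fH.
apply: (lpP p_pr mA _ _).2; have [f [fS fT]] := (lpP p_pr mA S T).1.
have ex i : exists g : {additive A -> quasicyclic p}, (i < lp p S T)%N ->
    {in H, forall x, g x = 0} /\ {in T, forall x, g x = f i x}.
  have [ik|_] := ltnP i (lp p S T); last by exists (f 0%N).
  have [|g gH gT] := @extension_glue A _ (qc_divisible p_pr) H T (f i).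
    by move=> x xH xT; apply: fS => //; apply: THS.
  by exists g.
have [g gP] := choice ex; exists g; split=> [i ik|y]; first exact: (gP i ik).1.
have [x xT fx] := fT y; exists x; last by move=> i ik; rewrite (gP i ik).2 // fx.
by apply/KE; exists x; rewrite // subrr rpred0.
Qed.

(** The new elements of T are multiples of elements of a complement C of the torsion of A/S up to a
    finite group, chosen inside U. The set W of primes selects where T must gain no length; at the
    others T absorbs the full length of U over the isolator of S. *)
Lemma enlarge_subgroup S U (W : set nat) F :
    {subset isolator S <= U} -> {subset isolator U <= U} ->
  exists T, [/\ agree F S T, {subset S <= T}, isolator T =i U,
    forall p, prime p -> W p -> lp p trivial_subgroup T = lp p trivial_subgroup S &
    forall p, prime p -> ~ W p -> lp p trivial_subgroup T =
      (lp p trivial_subgroup S + lp p (isolator S) U)%N].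
Proof.
move=> SU Upure.
have SU' : {subset S <= U} by move=> x /sub_isolator/SU.
have [N0 [C [N00 SC Ctors Call]]] := isolator_complement S.
have [CU CUE] : {K : zmodClosed A | forall x, x \in K <-> x \in C /\ x \in U}.
  apply: subgroup_of; first by rewrite !rpred0.
  by move=> x y [? ?] [? ?]; rewrite !rpredB.
have [s [L [Ls LCU CUL]]] := minimax_lattice mA CU.
pose Wfree m := forall p, prime p -> W p -> coprime p m.
have WfreeM i j : Wfree i -> Wfree j -> Wfree (i * j)%N.
  by move=> fi fj p p_pr Wp; rewrite coprimeMr fi // fj.
(* T1 consists of the elements of CU that an integer prime to all of W brings into L + S. Over W it
   adds no length beyond the lattice L, and for p outside W it contains the p-primary part of CU
   modulo L. *)
have [T1 T1E] : {K : zmodClosed A | forall x, x \in K <-> x \in CU /\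
    exists m l, [/\ (0 < m)%N, Wfree m, l \in L & x *+ m - l \in S]}.
  apply: subgroup_of.
    split; first by rewrite rpred0.
    exists 1%N, 0; rewrite mul0rn subr0 !rpred0; split=> //.
    by move=> p _ _; rewrite coprimen1.
  move=> x y [xC [i [l [i0 fi lL xl]]]] [yC [j [k [j0 fj kL yk]]]].
  split; first by rewrite rpredB.
  exists (i * j)%N, (l *+ j - k *+ i); split.
  - by rewrite muln_gt0 i0.
  - exact: WfreeM.
  - by rewrite rpredB ?rpredMn.
  have -> : (x - y) *+ (i * j) - (l *+ j - k *+ i) = (x *+ i - l) *+ j - (y *+ j - k) *+ i.
    by rewrite !mulrnBl -!mulrnA [(j * i)%N]mulnC opprD addrACA -opprD.
  by rewrite rpredB ?rpredMn.
have T1C x : x \in T1 -> x \in C by move=> /T1E[/CUE[]].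
have T1U x : x \in T1 -> x \in U by move=> /T1E[/CUE[]].
have LT1 p n x : prime p -> ~ W p -> x \in CU -> x *+ p ^ n \in L -> x \in T1.
  move=> p_pr nW xC xL; apply/T1E; split=> //; exists (p ^ n)%N, (x *+ p ^ n).
  rewrite subrr rpred0 expn_gt0 prime_gt0 //; split=> // q q_pr Wq.
  rewrite coprimeXr // prime_coprime // dvdn_prime2 //; apply/eqP => E.
  by apply: nW; rewrite -E.
have LT1' x : x \in L -> x \in T1.
  move=> xL; apply/T1E; split; first exact: LCU.
  exists 1%N, x; rewrite mulr1n subrr rpred0; split=> // p _ _.
  by rewrite coprimen1.
have [N HN] := lp_large_prime mA; have [l Nl l_pr] := prime_above N.
have [k far] := finite_far F S (HN l l_pr Nl) l_pr.
(* The factor N0 kills the torsion of C modulo S, which makes T meet the isolator of S in S; the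
   factor l^k keeps T away from the elements of F outside the isolator. *)
have [N1 N1def] : exists N1, N1 = (N0 * l ^ k)%N by exists (N0 * l ^ k)%N.
have N10 : (0 < N1)%N by rewrite N1def muln_gt0 N00 expn_gt0 prime_gt0.
have [T TE] : {K : zmodClosed A | forall x, x \in K <->
    exists2 t, t \in T1 & x - t *+ N1 \in S}.
  apply: subgroup_of; first by exists 0; rewrite ?mul0rn ?subr0 rpred0.
  move=> x y [t tT xt] [u uT yu]; exists (t - u); first by rewrite rpredB.
  by rewrite mulrnBl opprD addrACA -opprD rpredB.
have ST : {subset S <= T}.
  by move=> x xS; apply/TE; exists 0; rewrite ?rpred0 // mul0rn subr0.
have T1T x : x \in T1 -> x *+ N1 \in T.
  by move=> xT; apply/TE; exists x; rewrite // subrr rpred0.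
have TU : {subset T <= U}.
  move=> x /TE[t /T1U tU xt]; rewrite -[x](subrK (t *+ N1)) rpredD ?rpredMn //.
  exact: SU'.
have TI x : x \in T -> x \in isolator S -> x \in S.
  move=> /TE[t tT xt] xI; rewrite -[x](subrK (t *+ N1)) rpredD //.
  rewrite N1def mulrnA rpredMn // Ctors ?T1C //; apply: (isolator_pure N10).
  rewrite -(rpredDl _ (sub_isolator xt)) subrK //.
have SIT := isolator_mono ST.
have UIT : {subset U <= isolator T}.
  move=> x xU; have [c [d [cC dI xE]]] := Call x.
  rewrite xE rpredD ?(SIT d) //.
  have /CUL/isolatorP[n n0 nc] : c \in CU.
    by apply/CUE; split=> //; rewrite -(rpredDr _ (SU _ dI)) -xE.
  apply/isolatorP; exists (n * N1)%N; first by rewrite muln_gt0 n0.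
  by rewrite mulrnA T1T // LT1'.
exists T; split=> //.
- move=> x xF; apply/idP/idP => [xT|/ST //]; apply: contrapT => /negP xS.
  have xI : x \notin isolator S by apply: contra xS; apply: TI.
  have /TE[t _ xt] := xT.
  have := far x (t *+ N0) xF xI; rewrite -mulrnA -N1def.
  by rewrite xt.
- move=> x; apply/idP/idP; last exact: UIT.
  by move=> xT; apply: Upure; apply: isolator_mono xT.
- move=> p p_pr Wp.
  rewrite (lp_add p_pr mA (@sub_trivial_subgroup _ S) ST) [X in (_ + X)%N]lp_eq0 ?addn0 //.
  move=> f fS; have [j fj] := zspan_bounded s f; exists j => x /TE[t tT xt].
  have -> : f x = f t *+ N1 by apply/eqP; rewrite -subr_eq0 -raddfMn -raddfB fS.
  have /T1E[_ [m [y [m0 /(_ p p_pr Wp) pm yL ty]]]] := tT.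
  rewrite mulrnAC (@qc_coprime_eq0 p (f t *+ p ^ j) m) ?mul0rn //.
  rewrite mulrnAC (_ : f t *+ m = f y) ?fj //; first exact/Ls.
  by apply/eqP; rewrite -subr_eq0 -raddfMn -raddfB fS.
- move=> p p_pr nWp.
  rewrite (lp_add p_pr mA (@sub_trivial_subgroup _ S) ST); congr (_ + _)%N.
  have [TS TSE] : {K : zmodClosed A | forall x, x \in K <->
      exists2 t, t \in T & x - t \in isolator S}.
    apply: subgroup_of; first by exists 0; rewrite ?subr0 rpred0.
    move=> x y [t tT xt] [u uT yu]; exists (t - u); first by rewrite rpredB.
    by rewrite opprD addrACA -opprD rpredB.
  have ITS : {subset isolator S <= TS}.
    by move=> x xI; apply/TSE; exists 0; rewrite ?subr0 ?rpred0.
  have TTS x : x \in T -> x \in TS.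
    by move=> xT; apply/TSE; exists x; rewrite // subrr rpred0.
  have TSU : {subset TS <= U}.
    by move=> x /TSE[t tT xt]; rewrite -[x](subrK t) rpredD ?(TU t) // SU.
  rewrite (lp_add p_pr mA ITS TSU) (lp_meet p_pr (@sub_isolator _ S) TI TSE).
  rewrite [X in (_ + X)%N]lp_eq0 ?addn0 // => f fTS.
  (* A multiple of c prime to p lies in T1, and f vanishes on N1 T1, which is contained in T; only
     the p-part of N1 remains as a bound. *)
  exists (logn p N1) => x xU; have [c [d [cC dI xE]]] := Call x.
  rewrite xE raddfD (fTS d) ?ITS // addr0.
  have cCU : c \in CU.
    by apply/CUE; split=> //; rewrite -(rpredDr _ (SU _ dI)) -xE.
  have /CUL/isolatorP[n n0 nc] := cCU.
  have [m pm nE] := pfactor_coprime p_pr n0.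
  have [m1 pm1 N1E] := pfactor_coprime p_pr N10.
  apply: (@qc_coprime_eq0 p _ (m * m1)) => //; first by rewrite coprimeMr pm.
  rewrite -mulrnA (_ : (_ * _)%N = (m * N1)%N); last by rewrite {2}N1E; lia.
  rewrite mulrnA -[f c *+ m]raddfMn -[RHS](fTS (c *+ m *+ N1)) ?raddfMn //.
  apply/TTS/T1T/(LT1 p (logn p n)) => //; first by rewrite rpredMn.
  by rewrite -mulrnA -nE.
Qed.



(** A quotient C_{p^oo} of I/S, with I the isolator, yields a subgroup C_{p^oo} as well: the
    divisible part D/S then has an element of order p, and repeated p-th roots of it in D generate P
    modulo S. *)
Lemma quasicyclic_extension p S : prime p -> (0 < lp p S (isolator S))%N ->
  exists P : zmodClosed A, exists g : {additive A -> quasicyclic p},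
  [/\ {subset S <= P}, {in S, forall x, g x = 0},
    forall x, x \in P -> g x = 0 -> x \in S &
    forall z, exists2 x, x \in P & g x = z].
Proof.
move=> p_pr /(lp_gt0P p_pr mA)[g0 g0S g0I].
have [N0 [D [N00 DE Ddiv]]] := torsion_divisible_part mA S.
have [w w0 _] := qc_neq0 p_pr.
have [d [dD gd0 [n n0 dn]]] : exists d, [/\ d \in D, g0 d <> 0 &
    exists2 n, (0 < n)%N & d *+ n \in S].
  have [w' w'E] := qc_divisible p_pr w N00; have [x xI gx] := g0I w'.
  exists (x *+ N0); split; first by apply/DE; exists x; rewrite // subrr rpred0.
    by rewrite raddfMn gx w'E; apply/eqP.
  have /isolatorP[n n0 xn] := xI; exists n => //.
  by rewrite mulrnAC rpredMn.
have [m pm nE] := pfactor_coprime p_pr n0.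
have [x0 [x0D x0S x0p]] : exists x0, [/\ x0 \in D, x0 \notin S & x0 *+ p \in S].
  have ex : exists a, d *+ m *+ p ^ a \in S by exists (logn p n); rewrite -mulrnA -nE.
  case: (ex_minnP ex) => [[|a]] xa amin.
    by case: gd0; apply: (qc_coprime_eq0 p_pr pm); rewrite -raddfMn g0S.
  exists (d *+ m *+ p ^ a); split; first by rewrite !rpredMn.
    by apply/negP => /amin; rewrite ltnn.
  by rewrite -mulrnA -expnSr.
have ex (x : A) : exists y, x \in D -> y \in D /\ x - y *+ p \in S.
  have [xD|] := boolP (x \in D); last by exists 0.
  by have [y yD xy] := Ddiv p x (prime_gt0 p_pr) xD; exists y.
have [phi phiP] := choice ex.
(* P is generated by S and the chain u, which is p-divisible modulo S. *)
pose u j := iter j phi x0.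
have uD j : u j \in D by elim: j => [|j IH] //=; apply: (phiP _ IH).1.
have uS j : u j - u j.+1 *+ p \in S := (phiP _ (uD j)).2.
have uSi i j : u j - u (j + i)%N *+ p ^ i \in S.
  elim: i => [|i IH]; first by rewrite addn0 mulr1n subrr rpred0.
  have := rpredD IH (rpredMn (p ^ i) (uS (j + i)%N)).
  by rewrite mulrnBl -mulrnA -expnS addrA subrK addnS.
have [P PE] : {K : zmodClosed A | forall x, x \in K <->
    exists j (k : int), x - u j *~ k \in S}.
  apply: subgroup_of; first by exists 0%N, 0; rewrite mulr0z subr0 rpred0.
  have lift x j i (k : int) : x - u j *~ k \in S ->
      x - u (j + i)%N *~ (Posz (p ^ i) * k) \in S.
    move=> xk; rewrite -[x](subrK (u j *~ k)) -addrA rpredD //.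
    by rewrite mulrzA -pmulrn -mulrzBl rpredMz.
  move=> x y [j [k /(lift x j)xk]] [j' [k' /(lift y j')yk]].
  have := yk j; rewrite addnC => {}yk.
  exists (j + j')%N, (Posz (p ^ j') * k - Posz (p ^ j) * k').
  by rewrite mulrzBr opprD addrACA -opprD rpredB.
have [g gS gx0] := qc_separation p_pr x0S x0p.
have gcong x y : x - y \in S -> g x = g y.
  by move=> /gS/eqP; rewrite raddfB subr_eq0 => /eqP.
exists P, g; split=> //.
- by move=> x xS; apply/PE; exists 0%N, 0; rewrite mulr0z subr0.
- move=> x /PE[j [k xk]] gx.
  have guj : g (u j) *+ p ^ j <> 0.
    by rewrite -raddfMn -(gcong x0) //; apply: (uSi j 0%N).
  rewrite -[x](subrK (u j *~ k)) rpredD // mulrz_in.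
  have {gx} : g (u j) *+ `|k|%N = 0.
    by apply/mulrz_abs_eq0; rewrite -raddfMz -(gcong x).
  have [->|k0] := posnP `|k|%N; first by rewrite mulr0n rpred0.
  have [m' pm' ->] := pfactor_coprime p_pr k0; move: (logn p _) => i.
  rewrite mulnC mulrnA => /(qc_coprime_eq0 p_pr pm') gi.
  have ij : (j < i)%N.
    rewrite ltnNge; apply/negP => /subnKC E; apply: guj.
    by rewrite -[X in (p ^ X)%N]E expnD mulrnA gi mul0rn.
  rewrite mulrnA rpredMn // -(subnKC ij) expnD expnSr !mulrnA rpredMn //.
  have := uSi j 0%N; rewrite add0n => h.
  by rewrite -(rpredDl _ (rpredMn p h)) mulrnBl subrK.
- apply: (image_divisible p_pr (x := x0)) => //.
    by apply/PE; exists 0%N, 1; rewrite mulr1z subrr rpred0.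
  move=> x /PE[j [k xk]]; exists (u j.+1 *~ k).
    by apply/PE; exists j.+1, k; rewrite subrr rpred0.
  rewrite (gcong _ _ xk) [LHS]raddfMz (gcong _ _ (uS j)) [g (_ *+ p)]raddfMn.
  by rewrite [g (_ *~ k)]raddfMz !pmulrn mulrzAC.
Qed.

Lemma twist_subgroup p S F : prime p -> (0 < lp p trivial_subgroup S)%N ->
    (0 < lp p S (isolator S))%N ->
  exists T, [/\ agree F S T, exists2 x, x \in S & x \notin T &
    (0 < lp p trivial_subgroup T)%N].
Proof.
move=> p_pr /(lp_gt0P p_pr mA)[f _ fS] /(quasicyclic_extension p_pr)[P [g [SP gS Pker gP]]].
have [n fn] := finite_p_bounded F f.
have pn0 : (0 < p ^ n)%N by rewrite expn_gt0 prime_gt0.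
(* (f, g) maps P onto C_{p^oo}^2, S is the preimage of the first axis, and T is
   the preimage of the graph of multiplication by p^n. *)
have [T TE] : {K : zmodClosed A | forall x, x \in K <-> x \in P /\ g x = f x *+ p ^ n}.
  apply: subgroup_of; first by rewrite !raddf0 mul0rn rpred0.
  by move=> x y [xP gx] [yP gy]; rewrite rpredB // !raddfB mulrnBl gx gy.
exists T; split.
- move=> x xF; apply/idP/idP => [/TE[xP]|xS].
    by rewrite fn //; apply: Pker.
  by apply/TE; rewrite SP // gS // fn.
- have [c c0 _] := qc_neq0 p_pr; have [w wc] := qc_divisible p_pr c pn0.
  have [s sS fs] := fS w; exists s => //; apply/negP => /TE[_].
  by rewrite gS // fs wc => /esym/eqP; rewrite (negPf c0).
- apply/(lp_gt0P p_pr mA); exists f; first by move=> x /trivial_subgroupP ->; rewrite raddf0.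
  move=> z; have [x xP gx] := gP (z *+ p ^ n).
  have [s sS fs] := fS (z - f x); have fxs : f (x + s) = z.
    by rewrite raddfD fs addrC subrK.
  exists (x + s) => //; apply/TE; rewrite fxs rpredD ?(SP s) //; split=> //.
  by rewrite raddfD (gS s) // addr0.
Qed.

End Constructions.

(** * Neighbourhoods of a subgroup *)

Section LocalStructure.
Variable A : zmodType.
Hypothesis mA : minimax A.
Implicit Types (S G H K T U L : zmodClosed A) (x y : A) (F : seq A).

(* kappa_p(A/S) + l_p(S) *)
Definition weight p S :=
  (lp p trivial_subgroup S + lp p (isolator S) full_subgroup)%N.

Lemma weight_total p S : prime p ->
  lp p (@trivial_subgroup A) full_subgroup = (weight p S + lp p S (isolator S))%N.
Proof.
move=> p_pr; rewrite (lp_add p_pr mA (@sub_trivial_subgroup _ S) (@sub_full_subgroup _ S)).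
rewrite (lp_add p_pr mA (@sub_isolator _ S) (@sub_full_subgroup _ _)).
by rewrite /weight addnAC addnA.
Qed.

Lemma agree_catl F1 F2 S T : agree (F1 ++ F2) S T -> agree F1 S T.
Proof. by move=> ST x xF; apply: ST; rewrite mem_cat xF. Qed.

Lemma agree_catr F1 F2 S T : agree (F1 ++ F2) S T -> agree F2 S T.
Proof. by move=> ST x xF; apply: ST; rewrite mem_cat xF orbT. Qed.

Lemma agree_trans F S T U : agree F S T -> agree F T U -> agree F S U.
Proof. by move=> ST TU x xF; rewrite TU // ST. Qed.

Lemma agree_all (I : eqType) (r : seq I) S (Q : I -> zmodClosed A -> Prop) :
    (forall i, i \in r -> exists F, forall T, agree F S T -> Q i T) ->
  exists F, forall T, agree F S T -> forall i, i \in r -> Q i T.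
Proof.
elim: r => [|i r IH] h; first by exists [::].
have [|F1 FP1] := IH; first by move=> j jr; apply: h; rewrite in_cons jr orbT.
have [F2 FP2] := h i (mem_head _ _).
exists (F1 ++ F2) => T ST j; rewrite in_cons => /predU1P[->|jr].
  by apply: FP2; apply: agree_catr ST.
by apply: FP1 jr; apply: agree_catl ST.
Qed.

Definition is_lattice S (s : seq A) L :=
  [/\ forall x, x \in L <-> zspan s x, {subset L <= S} & {subset S <= isolator L}].

Lemma agree_lattice S s L T : is_lattice S s L -> agree s S T -> {subset L <= T}.
Proof.
move=> [Ls LS _] ST x /Ls/zspan_min; apply=> y ys.
by rewrite ST // LS //; apply/Ls/mem_zspan.
Qed.

Fact primary_subproof p L : {P : zmodClosed A | forall x, x \in P <-> exists n, x *+ p ^ n \in L}.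
Proof.
apply: subgroup_of; first by exists 0%N; rewrite mul0rn rpred0.
move=> x y [m xm] [n yn]; exists (m + n)%N.
by rewrite expnD mulrnBl {1}mulrnA mulnC mulrnA rpredB // rpredMn.
Qed.
Definition primary p L := sval (primary_subproof p L).
Lemma primaryP p L x : x \in primary p L <-> exists n, x *+ p ^ n \in L.
Proof. exact: svalP (primary_subproof p L) x. Qed.

Lemma sub_primary p L : {subset L <= primary p L}.
Proof. by move=> x xL; apply/primaryP; exists 0%N. Qed.

Lemma primary_isolator p L : prime p -> {subset primary p L <= isolator L}.
Proof.
move=> p_pr x /primaryP[n xn]; apply/isolatorP; exists (p ^ n)%N => //.
by rewrite expn_gt0 prime_gt0.
Qed.

Lemma first_multiple p (L K : zmodClosed A) x : {subset L <= K} -> x \in primary p L ->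
  x \notin K -> exists n, x *+ p ^ n \notin K /\ x *+ p ^ n *+ p \in K.
Proof.
move=> LK /primaryP[n0 /LK xn0] xK.
have ex : exists n, x *+ p ^ n \in K by exists n0.
case: (ex_minnP ex) => [[|n]] xn nmin; first by rewrite xn in xK.
exists n; split; last by rewrite -mulrnA -expnSr.
by apply/negP => /nmin; rewrite ltnn.
Qed.

Lemma qc_common_bound p k (y : nat -> quasicyclic p) :
  exists e, forall i, (i < k)%N -> y i *+ p ^ e = 0.
Proof.
elim: k => [|k [e IH]]; first by exists 0%N.
have [m ym] := qc_torsion (y k); exists (e + m)%N => i.
rewrite ltnS leq_eqVlt => /predU1P[->|/IH yi].
  by rewrite addnC expnD mulrnA ym mul0rn.
by rewrite expnD mulrnA yi mul0rn.
Qed.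

(** At weight 0 all k = l_p(A) maps onto C_{p^oo} can be taken to vanish on S. Their common kernel K
    in P is finite modulo L, since otherwise l_p(A) > k. If T met P outside K, it would contain an
    element of K2 outside K; representatives of K2 modulo L exclude this. Hence the k maps,
    restricted to P, extend to maps vanishing on T. *)
Lemma nbhd_weight0 p S s L : prime p -> is_lattice S s L -> weight p S = 0%N ->
  exists F, forall T, agree F S T -> weight p T = 0%N /\
    forall x, x \in primary p L -> (x \in T) = (x \in S).
Proof.
move=> p_pr lat w0; have [Ls LS SL] := lat.
set k := lp p (@trivial_subgroup A) full_subgroup.
have kE : k = lp p S (isolator S) by rewrite /k (weight_total S) // w0.
have := (lpP p_pr mA S (isolator S)).1; rewrite -kE => -[f [fS fI]].
set P := primary p L.
have [K KE] : {K : zmodClosed A | forall x, x \in K <->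
    x \in P /\ forall i, (i < k)%N -> f i x = 0}.
  apply: subgroup_of; first by rewrite rpred0; split=> // i _; rewrite raddf0.
  move=> x y [xP fx] [yP fy]; rewrite rpredB //; split=> // i ik.
  by rewrite raddfB fx // fy // subr0.
have LK : {subset L <= K}.
  by move=> x xL; apply/KE; rewrite sub_primary //; split=> // i ik; apply: fS ik _ (LS _ xL).
have SPK x : x \in S -> x \in P -> x \in K.
  by move=> xS xP; apply/KE; split=> // i ik; apply: fS.
have [FK FKP] : finite_mod K L.
  apply: contrapT => inf.
  have [|g gL gK] := infinite_primary_onto mA p_pr LK _ inf.
    by move=> x /KE[/primaryP].
  suff : onto p (@trivial_subgroup A) full_subgroup (1 + k).
    by move/(lpP p_pr mA _ _).2; rewrite -/k ltnn.
  apply: (@onto_cat _ _ p_pr _ K) => //.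
    by apply/onto1P; exists g => // x /trivial_subgroupP ->; rewrite raddf0.
  exists f; split=> [i ik x /KE[_]|y]; first exact.
  by have [x _ fx] := fI y; exists x.
have [Ptors PtorsE] : {K : zmodClosed A | forall x, x \in K <-> x *+ p \in L}.
  apply: subgroup_of; first by rewrite mul0rn rpred0.
  by move=> x y xp yp; rewrite mulrnBl rpredB.
have Ptors_fin : finite_mod Ptors L.
  apply: contrapT => inf.
  have [||g gL gK] := infinite_primary_onto mA p_pr _ _ inf.
  - by move=> x xL; apply/PtorsE; rewrite rpredMn.
  - by move=> x /PtorsE xp; exists 1%N.
  apply: (image_bounded (n := 1) p_pr _ gK) => x /PtorsE/gL.
  by rewrite raddfMn.
have [K2 K2E] : {K2 : zmodClosed A | forall x, x \in K2 <-> x *+ p \in K}.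
  apply: subgroup_of; first by rewrite mul0rn rpred0.
  by move=> x y xp yp; rewrite mulrnBl rpredB.
have [R RP] : finite_mod K2 L.
  apply: (@finite_mod_fibers A _ (fun x r => x *+ p - r \in L) FK _ Ptors) => //.
    by move=> x /K2E/FKP.
  move=> x y r _ _ xr yr; apply/PtorsE.
  by rewrite mulrnBl -(rpredDr _ yr) addrA subrK.
exists (s ++ R) => T ST; have LT := agree_lattice lat (agree_catl ST).
have RST r : r \in R -> (r \in T) = (r \in S) by apply: (agree_catr ST).
have TPK x : x \in T -> x \in P -> x \in K.
  move=> xT xP; apply: contrapT => /negP xK.
  have [n [xn xnp]] := first_multiple LK xP xK.
  have [|r rR xr] := RP (x *+ p ^ n); first exact/K2E.
  case/negP: xn; apply: SPK; last by rewrite rpredMn.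
  rewrite -[_ *+ _](subrK r) rpredD ?(LS _ xr) // -RST //.
  by rewrite -(rpredBl _ (rpredMn (p ^ n) xT)) LT.
have PI : {subset P <= isolator T}.
  by move=> x /(primary_isolator p_pr); apply: isolator_mono.
split.
  suff h : onto p T (isolator T) k.
    have := (lpP p_pr mA _ _).2 _ h; rewrite /k (weight_total T) //; lia.
  have ex i : exists g : {additive A -> quasicyclic p}, (i < k)%N ->
      {in T, forall x, g x = 0} /\ {in P, forall x, g x = f i x}.
    have [ik|_] := ltnP i k; last by exists (f 0%N).
    have [|g gT gP] := @extension_glue A _ (qc_divisible p_pr) T P (f i).
      by move=> x xT xP; have /KE[_] := TPK x xT xP; apply.
    by exists g.
  have [g gP] := choice ex; exists g; split=> [i ik|y]; first exact: (gP i ik).1.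
  have [e ye] := qc_common_bound k y.
  have SIL := isolator_least SL (fun n x n0 => @isolator_pure A L n x n0).
  have [x /SIL/isolatorP[n n0 xn] fx] := fI y.
  have [m pm nE] := pfactor_coprime p_pr n0.
  have m0 : (0 < m)%N by move: n0; rewrite nE muln_gt0 => /andP[].
  (* u inverts m modulo p^e, which kills all the y i; so u m x lies in P and has the same images as
     x. *)
  have [u v E _] := egcdnP (p ^ e) m0.
  have xmP : x *+ m *+ u \in P.
    by rewrite rpredMn //; apply/primaryP; exists (logn p n); rewrite -mulrnA -nE.
  exists (x *+ m *+ u); first exact: PI.
  move=> i ik; rewrite (gP i ik).2 // !raddfMn fx // -mulrnA mulnC E.
  have /eqP -> : coprime m (p ^ e) by rewrite coprime_sym coprimeXl.
  by rewrite mulrnDr mulnC mulrnA ye // mul0rn add0r.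
move=> x xP; have xRP y : y \in K -> (y \in T) = (y \in S).
  move=> yK; have [|r rR yr] := RP y; first by apply/K2E; rewrite rpredMn.
  rewrite -[y](subrK r) (rpredDl _ (LS _ yr)) -RST //.
  by rewrite (rpredDl _ (LT _ yr)).
apply/idP/idP => [xT|xS]; first by rewrite -xRP //; apply: TPK.
by rewrite xRP //; apply: SPK.
Qed.

(** DP is the divisible p-part modulo L. Any T containing L whose torsion quotient has no C_{p^oo}
    must contain DP, and P/DP is finite, so finitely many representatives decide the membership of
    all of P. *)
Lemma nbhd_reduced p S s L : prime p -> is_lattice S s L -> lp p S (isolator S) = 0%N ->
  exists F, forall T, agree F S T -> lp p T (isolator T) = 0%N ->
    forall x, x \in primary p L -> (x \in T) = (x \in S).
Proof.
move=> p_pr lat t0; have [Ls LS SL] := lat.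
have [N0 [D [N00 DE Ddiv]]] := torsion_divisible_part mA L.
set P := primary p L.
have [DP DPE] : {K : zmodClosed A | forall x, x \in K <-> x \in D /\ x \in P}.
  apply: subgroup_of; first by rewrite !rpred0.
  by move=> x y [? ?] [? ?]; rewrite !rpredB.
have DPdiv x : x \in DP -> exists2 y, y \in DP & x - y *+ p \in L.
  move=> /DPE[xD /primaryP[n xn]]; have [y yD xy] := Ddiv p x (prime_gt0 p_pr) xD.
  exists y => //; apply/DPE; split=> //; apply/primaryP; exists n.+1.
  rewrite expnS mulrnA -(rpredDl _ (rpredMn (p ^ n) xy)) mulrnBl subrK //.
have DPT T : {subset L <= T} -> lp p T (isolator T) = 0%N -> {subset DP <= T}.
  move=> LT tT x xDP; apply: contrapT => /negP xT.
  have xP : x \in P by case/DPE: xDP.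
  have [n [xn xnp]] := first_multiple LT xP xT.
  have [g gT gx] := qc_separation p_pr xn xnp.
  suff : (0 < lp p T (isolator T))%N by rewrite tT.
  apply/(lp_gt0P p_pr mA); exists g => // z.
  have [|y /DPE[_ yP] <-] := @image_divisible A p p_pr DP g _ (rpredMn (p ^ n) xDP) gx _ z.
    move=> y /DPdiv[y' y'D yy]; exists y' => //.
    by apply/eqP; rewrite -subr_eq0 -raddfMn -raddfB gT ?LT.
  by exists y => //; apply: (isolator_mono LT); apply: primary_isolator yP.
have [R RP] : finite_mod P DP.
  apply: contrapT => inf.
  have LDP : {subset DP <= P} by move=> x /DPE[].
  have [|g gDP gP] := infinite_primary_onto mA p_pr LDP _ inf.
    move=> x /primaryP[n xn]; exists n; apply/DPE; split; last exact: sub_primary.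
    by apply/DE; exists 0; rewrite ?rpred0 // mul0rn subr0.
  apply: (image_bounded (n := logn p N0) p_pr _ gP) => x xP.
  have [m pm N0E] := pfactor_coprime p_pr N00.
  apply: (qc_coprime_eq0 p_pr pm); rewrite -mulrnA mulnC -N0E -raddfMn gDP //.
  apply/DPE; split; last by rewrite rpredMn.
  apply/DE; exists x; first exact: (primary_isolator p_pr).
  by rewrite subrr rpred0.
exists (s ++ R) => T ST tT x xP; have LT := agree_lattice lat (agree_catl ST).
have [r rR xr] := RP x xP.
rewrite -[x](subrK r) (rpredDl _ (DPT S LS t0 _ xr)) (rpredDl _ (DPT T LT tT _ xr)).
exact: (agree_catr ST).
Qed.

(** Induction on the order n of x modulo L: x is a combination of its multiple by the prime-to-p
    part of n, which is p-primary, and its multiple by the p-part, which has smaller order. *)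
Lemma primary_local L S T :
    (forall p x, prime p -> x \in primary p L -> x \in T -> x \in S) ->
    {subset L <= S} ->
  forall x, x \in isolator L -> x \in T -> x \in S.
Proof.
move=> loc LS x /isolatorP[n]; elim/ltn_ind: n x => n IH x n0 xn xT.
have [n1|n1] := leqP n 1.
  by apply: LS; rewrite -[x]mulr1n; have <- : n = 1%N by lia.
have p_pr : prime (pdiv n) by apply: pdiv_prime.
set p := pdiv n in p_pr *; have [m pm nE] := pfactor_coprime p_pr n0.
have ln0 : (0 < logn p n)%N by rewrite logn_gt0 mem_primes p_pr n0 pdiv_dvd.
have m0 : (0 < m)%N by move: n0; rewrite {1}nE muln_gt0 => /andP[].
apply: (@coprime_mulrn_in _ S m (p ^ logn p n)).
- by rewrite coprime_sym coprimeXl.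
- apply: (loc p) => //; last by rewrite rpredMn.
  by apply/primaryP; exists (logn p n); rewrite -mulrnA -nE.
- apply: (IH m) => //; last by rewrite rpredMn.
    by rewrite [X in (_ < X)%N]nE ltn_Pmulr // -{1}(expn0 p) ltn_exp2l // prime_gt1.
  by rewrite -mulrnA mulnC -nE.
Qed.

End LocalStructure.

(** * The function d_A *)

Section Dimension.
Variable A : zmodType.
Hypothesis mA : minimax A.
Implicit Types (S G H K T U L : zmodClosed A) (x y : A) (F : seq A).
Variables (V : set nat) (Lcr Lncr : seq nat).
Hypothesis Vprime : forall p, V p -> prime p.
Hypothesis VP : forall p, prime p ->
  V p <-> (2 <= lp p (@trivial_subgroup A) full_subgroup)%N.
Hypothesis LcrP : forall p, p \in Lcr <-> V p.
Hypothesis Lncr_prime : forall p, p \in Lncr -> prime p /\ ~ V p.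
Hypothesis LncrP : forall p, prime p -> ~ V p ->
  (0 < lp p (@trivial_subgroup A) full_subgroup)%N -> p \in Lncr.
Hypothesis Lncr_uniq : uniq Lncr.

Local Notation W := (Rloc_kernel V).

(* gamma(A/S), where V is the set of critical primes *)
Definition gam S := xget 0%N [set n | corank (W S) n].

Lemma gamP S : corank (W S) (gam S).
Proof.
rewrite /gam; case: xgetP => [n _ //|no].
have [n nP] := corank_exists mA (@Rloc_kernel_isolated A V S).
by case: (no n).
Qed.

(** This is d_A(S): kappa and ell are merged into the weight, and the sum runs over a finite list
    containing every noncritical prime of positive length in A. *)
Definition rankd S := (gam S + \sum_(p <- Lncr) weight p S)%N.
(* The condition in (i). *)
Definition scat S := forall p, V p -> weight p S = 0%N.

Lemma weight_le_total p S : prime p ->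
  (weight p S <= lp p (@trivial_subgroup A) full_subgroup)%N.
Proof. by move=> p_pr; rewrite (weight_total mA S p_pr) leq_addr. Qed.

Lemma weight_ncr_le1 p S : prime p -> ~ V p -> (weight p S <= 1)%N.
Proof.
move=> p_pr nV; apply: leq_trans (weight_le_total S p_pr) _.
by rewrite leqNgt; apply/negP => /(VP p_pr).
Qed.

Lemma Rloc_kernel_mono S T L : {subset S <= isolator L} -> {subset L <= T} ->
  {subset W S <= W T}.
Proof.
move=> SL LT x /Rloc_kernelP xS; apply/Rloc_kernelP => g gT; apply: xS => y.
by move=> /SL/isolatorP[n n0 /LT/gT]; rewrite raddfMn; apply: Rloc_mulrn_eq0.
Qed.

Lemma Rloc_kernel_id S : W (W S) =i W S.
Proof.
move=> x; apply/idP/idP; last exact: sub_Rloc_kernel.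
move=> /Rloc_kernelP xW; apply/Rloc_kernelP => g gS; apply: xW => y.
by move/Rloc_kernelP; apply.
Qed.

Lemma eq_isolator_Rloc S T : isolator S =i isolator T -> W S =i W T.
Proof.
move=> E x; apply/idP/idP.
  apply: (@Rloc_kernel_mono S T T) => // y yS.
  by rewrite -E; apply: sub_isolator.
apply: (@Rloc_kernel_mono T S S) => // y yS.
by rewrite E; apply: sub_isolator.
Qed.

Lemma eq_gam S T : W S =i W T -> gam S = gam T.
Proof. by move=> E; apply: eq_corank E (gamP S) (gamP T). Qed.

Lemma Rloc_kernel_scat S : scat S -> W S =i isolator S.
Proof.
move=> scS x; apply/idP/idP; last exact: isolator_Rloc_kernel.
move=> /Rloc_kernelP xW; apply: contrapT => /negP xS.
have [||g gS gx] := @Rloc_separation A mA V Lcr S x _ _ xS.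
- by move=> p _ /LcrP.
- by move=> p _ /scS /eqP; rewrite addn_eq0 => /andP[_ /eqP].
by apply: gx; apply: xW.
Qed.

(** Noncritical weights are at most 1, so only the vanishing of a weight has to persist nearby;
    gamma cannot increase because T contains a full lattice of S. *)
Lemma rankd_upper S : exists F, forall T, agree F S T ->
  (gam T <= gam S)%N /\ forall p, p \in Lncr -> (weight p T <= weight p S)%N.
Proof.
have [s [L lat]] := minimax_lattice mA S.
have [|F FP] := @agree_all A nat Lncr S (fun p T => (weight p T <= weight p S)%N).
  move=> p /Lncr_prime[p_pr nV]; have [w0|w1] := posnP (weight p S).
    have [F FP] := nbhd_weight0 mA p_pr lat w0.
    by exists F => T /FP[-> _].
  by exists [::] => T _; apply: leq_trans (weight_ncr_le1 T p_pr nV) w1.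
exists (s ++ F) => T ST; split; last exact: FP _ (agree_catr ST).
have LT := agree_lattice lat (agree_catl ST).
apply: corank_le (gamP S) (gamP T) _.
by case: lat => _ _ SL; apply: Rloc_kernel_mono SL LT.
Qed.

Lemma rankd_usc S : exists F, forall T, agree F S T -> (rankd T <= rankd S)%N.
Proof.
have [F FP] := rankd_upper S; exists F => T /FP[gT wT].
rewrite leq_add // big_seq [X in (_ <= X)%N]big_seq.
by apply: leq_sum => p /wT.
Qed.

Lemma rankd_strict S : scat S -> exists F, forall T, agree F S T ->
  scat T /\ (T =i S \/ (rankd T < rankd S)%N).
Proof.
clear Lncr_uniq.
move=> scS; have [s [L lat]] := minimax_lattice mA S; have [Ls LS SL] := lat.
have [N NP] := isolator_torsion_bounded mA L.
have [F0 F0P] := rankd_upper S.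
(* Above N the p-primary part modulo L is L itself, so only finitely many primes need control. The
   critical ones are added so that their weights remain 0. *)
pose ps := [seq p <- iota 0 N.+1 ++ Lcr | prime p].
have [|F FP] := @agree_all A nat ps S (fun p T =>
    (weight p S = 0%N -> weight p T = 0%N) /\
    (weight p T = weight p S -> forall x, x \in primary p L -> (x \in T) = (x \in S))).
  move=> p; rewrite mem_filter => /andP[p_pr _].
  have [w0|w1] := posnP (weight p S).
    by have [F FP] := nbhd_weight0 mA p_pr lat w0; exists F => T /FP[].
  have nV : ~ V p by move=> /scS w0; rewrite w0 in w1.
  have tot1 : lp p (@trivial_subgroup A) full_subgroup = 1%N.
    apply/eqP; rewrite eqn_leq (leq_trans w1 (weight_le_total S p_pr)) andbT.
    by rewrite leqNgt; apply/negP => /(VP p_pr).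
  (* The weight already uses up the total length 1, so nothing is left for the torsion of A/T. *)
  have red T : weight p T = weight p S -> lp p T (isolator T) = 0%N.
    by have := weight_total mA T p_pr; lia.
  have [F FP] := nbhd_reduced mA p_pr lat (red S erefl).
  exists F => T /FP ST; split; first by move=> w0; rewrite w0 in w1.
  by move=> /red/ST.
exists (F0 ++ (s ++ F)) => T ST.
have [gT wT] := F0P T (agree_catl ST).
have sT := agree_catl (agree_catr ST); have {}FP := FP T (agree_catr (agree_catr ST)).
have LT := agree_lattice lat sT.
have scT : scat T.
  move=> p Vp; have pps : p \in ps.
    by rewrite mem_filter Vprime // mem_cat (LcrP p).2 ?orbT.
  by apply: (FP p pps).1; apply: scS.
split=> //; have [lt|ge] := ltnP (rankd T) (rankd S); [by right|left].
have wsum : (\sum_(p <- Lncr) weight p T <= \sum_(p <- Lncr) weight p S)%N.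
  by rewrite big_seq [X in (_ <= X)%N]big_seq; apply: leq_sum => p /wT.
have gE : gam T = gam S by move: ge gT wsum; rewrite /rankd; lia.
have sumE : (\sum_(p <- Lncr) weight p T = \sum_(p <- Lncr) weight p S)%N.
  by move: ge gT wsum; rewrite /rankd; lia.
have wE p : p \in Lncr -> weight p T = weight p S.
  move=> pL; apply/eqP; rewrite eqn_leq wT //= leqNgt; apply/negP => lt.
  suff : (\sum_(q <- Lncr) weight q T < \sum_(q <- Lncr) weight q S)%N.
    by rewrite sumE ltnn.
  rewrite (big_rem p pL) [X in (_ < X)%N](big_rem p pL) /=.
  rewrite -addSn leq_add // big_seq [X in (_ <= X)%N]big_seq.
  by apply: leq_sum => q /mem_rem/wT.
(* Together with the equality of coranks, this inclusion forces the two kernels, hence the two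
   isolators, to coincide. *)
have WST : {subset W S <= W T} by apply: Rloc_kernel_mono SL LT.
have TS : {subset isolator T <= isolator S}.
  move=> x; rewrite -!Rloc_kernel_scat //.
  by have := gamP T; rewrite gE => h; apply: corank_eq_sub (gamP S) h WST x.
have SIL := isolator_least SL (fun n x n0 => @isolator_pure A L n x n0).
have prim p x : prime p -> x \in primary p L -> (x \in T) = (x \in S).
  move=> p_pr xP; have [pN|Np] := leqP p N.
    have pps : p \in ps by rewrite mem_filter p_pr mem_cat mem_iota /= add0n ltnS pN.
    have [wS wP] := FP p pps; apply: wP => //.
    have [w0|w1] := posnP (weight p S); first by rewrite wS.
    apply: wE; apply: LncrP => //; first by move=> /scS w0; rewrite w0 in w1.
    exact: leq_trans w1 (weight_le_total S p_pr).
  have xL : x \in L.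
    move: xP => /primaryP[n]; elim: n => [|n IH]; first by rewrite mulr1n.
    by rewrite expnSr mulrnA => /(NP p p_pr Np).
  by rewrite LT // LS.
move=> x; apply/idP/idP => [xT|xS].
  apply: (@primary_local A L S T) => //.
    by move=> p y p_pr yP; rewrite (prim p).
  exact/SIL/TS/sub_isolator.
apply: (@primary_local A L T S) => //; last exact: SL.
by move=> p y p_pr yP; rewrite (prim p).
Qed.

Lemma shrink p S F : prime p -> (0 < lp p trivial_subgroup S)%N ->
  exists T, [/\ agree F S T, isolator T =i isolator S,
    lp p trivial_subgroup S = (lp p trivial_subgroup T).+1,
    weight p S = (weight p T).+1 &
    forall q, prime q -> q <> p ->
      lp q trivial_subgroup T = lp q trivial_subgroup S /\ weight q T = weight q S].
Proof.
move=> p_pr /(shrink_subgroup mA F p_pr)[T [ST TS SIT lpS lpT]].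
have E : isolator T =i isolator S.
  move=> x; apply/idP/idP; first exact: isolator_mono.
  by apply: isolator_least SIT _ x => n x n0; apply: isolator_pure.
have lpE q : prime q -> lp q (isolator T) full_subgroup = lp q (isolator S) full_subgroup.
  by move=> q_pr; apply: eq_lp.
exists T; split=> //; first by rewrite /weight lpS lpE // addSn.
by move=> q q_pr qp; rewrite /weight lpE // lpT.
Qed.

Lemma enlarge S U (Q : set nat) F :
    {subset isolator S <= U} -> {subset isolator U <= U} ->
  exists T, [/\ agree F S T, isolator T =i U,
    forall p, prime p -> Q p -> weight p T =
      (lp p trivial_subgroup S + lp p U full_subgroup)%N &
    forall p, prime p -> ~ Q p -> weight p T = weight p S].
Proof.
move=> SU Upure; have [T [ST TS TU lpQ lpnQ]] := enlarge_subgroup mA Q F SU Upure.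
have lpE q : prime q -> lp q (isolator T) full_subgroup = lp q U full_subgroup.
  by move=> q_pr; apply: eq_lp.
exists T; split=> // p p_pr Qp; first by rewrite /weight lpE // lpQ.
by rewrite /weight lpE // lpnQ // -addnA -(lp_add p_pr mA SU (@sub_full_subgroup _ U)).
Qed.

(** If a listed l_p(S) is positive, shrinking S lowers that weight by one. Otherwise gamma is
    positive, since gamma = 0 would make A/S torsion and all listed weights zero; the isolator is
    then enlarged so that its corank drops by one. *)
Lemma scat_predecessor S n F : scat S -> rankd S = n.+1 ->
  exists T, [/\ agree F S T, scat T & rankd T = n].
Proof.
move=> scS dS.
have [[p pL lp1]|no] := pselect (exists2 p, p \in Lncr & (0 < lp p trivial_subgroup S)%N).
  have [p_pr nVp] := Lncr_prime pL.
  have [T [ST E lpS wS wT]] := shrink F p_pr lp1; exists T; split=> //.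
    move=> q Vq; rewrite (wT q _ _).2 ?scS //; first exact: Vprime.
    by move=> qp; apply: nVp; rewrite -qp.
  move: dS; rewrite /rankd (eq_gam (eq_isolator_Rloc E)) !(big_rem p pL) /= wS.
  suff -> : (\sum_(q <- rem p Lncr) weight q T = \sum_(q <- rem p Lncr) weight q S)%N.
    by rewrite addSn addnS => -[].
  apply: eq_big_seq => q; rewrite mem_rem_uniq // inE => /andP[/eqP qp qL].
  by rewrite (wT q _ _).2 //; apply: (Lncr_prime qL).1.
have lp0 p : p \in Lncr -> lp p trivial_subgroup S = 0%N.
  by move=> pL; case: (posnP (lp p trivial_subgroup S)) => // h; case: no; exists p.
have WS := Rloc_kernel_scat scS.
have := gamP S; case gE : (gam S) => [|g] cS.
  exfalso; have fullS x : x \in isolator S.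
    by rewrite -WS; have [f [z [_ ker]]] := cS; apply: ker.
  move: dS; rewrite /rankd gE add0n big_seq big1 // => p pL.
  rewrite /weight lp0 // add0n; apply: lp_eq0 => [|//|f fS].
  - by have [] := Lncr_prime pL.
  - by exists 0%N => x _; rewrite fS ?mul0rn.
have [K [WK cK nKW]] := corankS cS.
have SK : {subset isolator S <= K} by move=> x; rewrite -WS => /WK.
have Kpure : {subset isolator K <= K}.
  apply: isolator_least => // m x m0 xm.
  by apply: (corank_pure cK (m := m%:Z)); rewrite // -lt0n.
(* With no prime restricted, T gains exactly the length that the quotient by the isolator loses, so
   every weight is kept. *)
have [T [ST TK _ wT]] := enlarge set0 F SK Kpure.
have {}wT p : prime p -> weight p T = weight p S by move=> p_pr; apply: wT.
have scT : scat T by move=> p Vp; rewrite wT ?scS //; apply: Vprime.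
exists T; split=> //; move: dS; rewrite /rankd gE.
have -> : gam T = g.
  apply: eq_corank (gamP T) cK => x; rewrite Rloc_kernel_scat // TK //.
rewrite addSn => -[<-]; congr (_ + _)%N; apply: eq_big_seq => p pL.
by rewrite wT //; apply: (Lncr_prime pL).1.
Qed.

(** A positive critical weight must survive the change of S. If l_p(S) = 0, the isolator is enlarged
    to A at constant weight. If l_p(S) > 0 and the torsion of A/S has no quotient C_{p^oo}, the
    weight is the total, at least 2, and S may be shrunk. In the remaining case shrinking could end
    at weight 0; the graph of [twist_subgroup] keeps a positive length instead. *)
Lemma nonscat_perfect S F : ~ scat S ->
  exists T, [/\ agree F S T, ~ scat T & ~ (T =i S)].
Proof.
clear Lncr_uniq.
move=> /existsNP[p /not_implyP[Vp /eqP wp]]; have p_pr := Vprime Vp.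
have nsc T : (0 < weight p T)%N -> ~ scat T by move=> w1 /(_ p Vp) w0; rewrite w0 in w1.
have tot := weight_total mA S p_pr; have := (VP p_pr).1 Vp; rewrite tot => ge2.
have [lp0|lp1] := posnP (lp p trivial_subgroup S).
  have [||T [ST TU _ wT]] := @enlarge S full_subgroup set0 F; [by []|by []|].
  exists T; split=> //; first by apply: nsc; rewrite wT // lt0n.
  move=> E; case/eqP: wp; rewrite /weight lp0 add0n.
  apply: lp_eq0 => // f fS; exists 0%N => x _.
  rewrite fS ?mul0rn // (_ : x \in isolator S) //.
  have : x \in isolator T by rewrite TU.
  by apply: isolator_mono => y; rewrite E.
have [t0|t1] := posnP (lp p S (isolator S)).
  have [T [ST E lpS wS _]] := shrink F p_pr lp1; exists T; split=> //.
    by apply: nsc; lia.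
  move=> TS; have := @eq_lp A p p_pr mA trivial_subgroup trivial_subgroup T S (fun=> erefl) TS.
  by lia.
have [T [ST [x xS xT] lpT]] := twist_subgroup mA F p_pr lp1 t1.
exists T; split=> //; first by apply: nsc; rewrite /weight addn_gt0 lpT.
by move=> E; rewrite E xS in xT.
Qed.

(** Shrinking removes the critical lengths of S by induction on their sum. What remains of the
    critical weights comes from A modulo the isolator, and enlarging the isolator to W(S) kills
    it. *)
Lemma scat_dense S F : exists T, [/\ agree F S T, scat T & rankd T = rankd S].
Proof.
have [m] := ubnP (\sum_(p <- Lcr) lp p trivial_subgroup S)%N.
elim: m S => // m IH S; rewrite ltnS => mS.
have [[p Vp lp1]|no] := pselect (exists2 p, V p & (0 < lp p trivial_subgroup S)%N).
  have p_pr := Vprime Vp; have pL := (LcrP p).2 Vp.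
  have [T [ST E lpS wS wT]] := shrink F p_pr lp1.
  have [|T' [TT' scT' dT']] := IH T.
    apply: leq_trans mS; rewrite (big_rem p pL) [X in (_ < X)%N](big_rem p pL) /=.
    rewrite -addSn leq_add ?lpS // big_seq [X in (_ <= X)%N]big_seq.
    apply: leq_sum => q /mem_rem/LcrP/Vprime q_pr.
    by have [->|/eqP qp] := eqVneq q p; [rewrite lpS|rewrite (wT q q_pr qp).1].
  exists T'; split=> //; first exact: agree_trans ST TT'.
  rewrite dT' /rankd (eq_gam (eq_isolator_Rloc E)); congr (_ + _)%N.
  apply: eq_big_seq => q /Lncr_prime[q_pr nVq].
  by rewrite (wT q q_pr _).2 // => qp; apply: nVq; rewrite qp.
have lp0 p : V p -> lp p trivial_subgroup S = 0%N.
  by move=> Vp; case: (posnP (lp p trivial_subgroup S)) => // h; case: no; exists p.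
(* The primes of V are restricted so that T gains no critical length; the noncritical weights are
   kept. *)
have [T [ST TW wV wnV]] := enlarge V F (@isolator_Rloc_kernel A V S) (@Rloc_kernel_isolated A V S).
exists T; split=> //.
  move=> p Vp; have p_pr := Vprime Vp.
  by rewrite wV // lp0 // (lp_Rloc_kernel_full mA).
rewrite /rankd; congr (_ + _)%N; last first.
  by apply: eq_big_seq => p /Lncr_prime[p_pr nVp]; apply: wnV.
apply: eq_gam => x; rewrite -[RHS]Rloc_kernel_id; apply: eq_isolator_Rloc => {}x.
rewrite TW; apply/idP/idP; first exact: sub_isolator.
exact: Rloc_kernel_isolated.
Qed.

End Dimension.

(** * The invariants of the statement *)

Lemma quot_map (A : zmodType) (S : zmodClosed A) :
  exists psi : {additive A -> {ideal_quot S}},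
    (forall u, exists x, psi x = u) /\ forall x, psi x = 0 <-> x \in S.
Proof.
have piB : {morph (fun x => \pi_{ideal_quot S} x) : x y / x - y}.
  exact: ideal_quotB.
have [psi psiE] := additive_of piB; exists psi; split=> [u|x].
  by exists (repr u); rewrite psiE reprK.
by rewrite psiE; apply: ideal_quot_eq0.
Qed.

Lemma ell_quotient (A B : zmodType) (H : zmodClosed A) (psi : {additive A -> B}) p :
    (forall u, exists x, psi x = u) -> (forall x, psi x = 0 <-> x \in H) ->
  ell p B = lp p H full_subgroup.
Proof.
move=> psi_onto psi0; rewrite /ell /lp; congr largest; apply/seteqP; split=> k /=.
  move=> [f f_onto].
  have fB i : {morph (fun x => if insub i is Some j then f (psi x) (j : 'I_k) else 0) :
      x y / x - y}.
    by move=> x y; case: insub => [j|]; rewrite ?subr0 // !raddfB !ffunE.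
  exists (fun i => sval (additive_of (fB i))); split=> [i ik x xH|y].
    rewrite (svalP (additive_of (fB i))) /= insubT.
    by have /psi0 -> := xH; rewrite raddf0 ffunE.
  have [u fu] := f_onto [ffun j : 'I_k => y j]; have [x xu] := psi_onto u.
  exists x => // i ik; rewrite (svalP (additive_of (fB i))) /= insubT xu fu ffunE.
  by [].
move=> [f [fH f_onto]]; have [s sK] := choice psi_onto.
have gB : {morph (fun u => [ffun j : 'I_k => f j (s u)]) : u v / u - v}.
  move=> u v; apply/ffunP => j; rewrite !ffunE; apply/eqP.
  rewrite -raddfB -subr_eq0 -raddfB; apply/eqP/fH => //; apply/psi0.
  by rewrite raddfB [psi (s u - s v)]raddfB !sK subrr.
have [g gE] := additive_of gB; exists g => y.
have [x _ fx] := f_onto (fun i => if insub i is Some j then y j else 0).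
exists (psi x); rewrite gE; apply/ffunP => j; rewrite ffunE.
have -> : f j (s (psi x)) = f j x.
  apply/eqP; rewrite -subr_eq0 -raddfB; apply/eqP/fH => //; apply/psi0.
  by rewrite raddfB sK subrr.
by rewrite fx // valK.
Qed.

(** The components of a map defined on S alone extend to A because C_{p^oo} is injective; indices
    outside 'I_k get the zero map. *)
Lemma ell_subgroup (A : zmodType) (S : zmodClosed A) p : prime p ->
  ell p (subgroup_type S) = lp p trivial_subgroup S.
Proof.
move=> p_pr; rewrite /ell /lp; congr largest; apply/seteqP; split=> k /=.
  move=> [f f_onto].
  have ex i : exists g : {additive A -> quasicyclic p}, forall u : subgroup_type S,
      g (val u) = if insub i is Some j then f u (j : 'I_k) else 0.
    have [R RE] : {R : zmodClosed (A * quasicyclic p)%type | forall v, v \in R <->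
        exists u : subgroup_type S,
          v = (val u, if insub i is Some j then f u (j : 'I_k) else 0)}.
      apply: subgroup_of.
        by exists 0; rewrite !raddf0; case: insub => // j; rewrite ffunE.
      move=> _ _ [u ->] [v ->]; exists (u - v); congr pair => /=.
      by case: insub => [j|]; rewrite ?subr0 // raddfB !ffunE.
    have [|g gE] := @divisible_extension _ _ R (qc_divisible p_pr).
      move=> y /RE[u [u0 ->]]; have -> : u = 0 by apply: val_inj; rewrite /= -u0.
      by rewrite raddf0; case: insub => // j; rewrite ffunE.
    by exists g => u; apply: gE; apply/RE; exists u.
  have [g gE] := choice ex; exists g; split=> [i ik x /trivial_subgroupP ->|y].
    by rewrite raddf0.
  have [u fu] := f_onto [ffun j : 'I_k => y j].
  by exists (val u); [exact: valP|move=> i ik; rewrite gE insubT fu ffunE].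
move=> [f [_ f_onto]].
have gB : {morph (fun u : subgroup_type S => [ffun j : 'I_k => f j (val u)]) : u v / u - v}.
  by move=> u v; apply/ffunP => j; rewrite !ffunE !raddfB.
have [g gE] := additive_of gB; exists g => y.
have [x xS fx] := f_onto (fun i => if insub i is Some j then y j else 0).
by exists (Sub x xS); rewrite gE; apply/ffunP => j; rewrite ffunE /= fx // valK.
Qed.

Section Translation.
Variable A : zmodType.
Implicit Types S : zmodClosed A.

Lemma ell_full p : ell p A = lp p (@trivial_subgroup A) full_subgroup.
Proof.
have [f fE] := @additive_of A A id (fun x y => erefl).
apply: (ell_quotient _ (psi := f)) => [u|x]; first by exists u; rewrite fE.
by rewrite fE trivial_subgroupP.
Qed.

Lemma quot2_map S (U : zmodClosed {ideal_quot S}) (K : zmodClosed A) :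
    (forall x, \pi_{ideal_quot S} x \in U <-> x \in K) ->
  exists psi : {additive A -> {ideal_quot U}},
    (forall u, exists x, psi x = u) /\ forall x, psi x = 0 <-> x \in K.
Proof.
move=> UK.
have piB : {morph (fun x => \pi_{ideal_quot U} (\pi_{ideal_quot S} x)) : x y / x - y}.
  by move=> x y; rewrite !ideal_quotB.
have [psi psiE] := additive_of piB; exists psi; split=> [u|x].
  by exists (repr (repr u)); rewrite psiE !reprK.
by rewrite psiE; split=> [/ideal_quot_eq0/UK//|/UK xK]; apply/ideal_quot_eq0.
Qed.

Lemma kappa_ideal_quot S p : kappa p {ideal_quot S} = lp p (isolator S) full_subgroup.
Proof.
have [|psi [psi_onto psi0]] := @quot2_map S (@torsion {ideal_quot S}) (isolator S).
  move=> x; split=> [/asboolP[n [n0]]|/isolatorP[n n0 xn]].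
    by rewrite -raddfMn => /ideal_quot_eq0 xn; apply/isolatorP; exists n.
  apply/asboolP; exists n; split=> //.
  by rewrite -raddfMn; apply/ideal_quot_eq0.
exact: ell_quotient psi_onto psi0.
Qed.

Lemma Uker_map S V : exists psi : {additive A -> {ideal_quot (@Uker V {ideal_quot S})}},
    (forall u, exists x, psi x = u) /\ forall x, psi x = 0 <-> x \in Rloc_kernel V S.
Proof.
apply: quot2_map => x; split=> [/asboolP xU|/Rloc_kernelP xW].
  apply/Rloc_kernelP => g gS.
  have hB : {morph (fun u : {ideal_quot S} => g (repr u)) : u v / u - v}.
    move=> u v; rewrite -raddfB; apply/eqP; rewrite -subr_eq0 -raddfB; apply/eqP/gS.
    by apply/ideal_quot_eq0; rewrite !ideal_quotB !reprK subrr.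
  have [h hE] := additive_of hB; have := xU h; rewrite hE => <-.
  apply/eqP; rewrite -subr_eq0 -raddfB; apply/eqP/gS.
  by apply/ideal_quot_eq0; rewrite !ideal_quotB !reprK subrr.
apply/asboolP => f.
have gB : {morph (fun x => f (\pi_{ideal_quot S} x)) : x y / x - y}.
  by move=> a b; rewrite !raddfB.
have [g gE] := additive_of gB; rewrite -gE; apply: xW => y /ideal_quot_eq0 yS.
by rewrite gE yS raddf0.
Qed.

End Translation.

(** * The corank as the dimension of a tensor product *)

Section TensorRank.
Variable B : zmodType.
Local Notation T := (tensorQ B).

Definition pure (b : B) (q : rat) : T := \pi_T [:: (b, q)].

Lemma tensor_pi_add s t : \pi_T (s ++ t) = \pi_T s + \pi_T t :> T.
Proof. by rewrite -tensor_add_pi. Qed.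

Lemma pureDl b b' q : pure (b + b') q = pure b q + pure b' q.
Proof. by rewrite -tensor_pi_add; apply/tensorQP/tensor_Dl. Qed.

Lemma pureDr b q q' : pure b (q + q') = pure b q + pure b q'.
Proof. by rewrite -tensor_pi_add; apply/tensorQP/tensor_Dr. Qed.

Lemma pureMz b (m : int) q : pure (b *~ m) q = pure b (q *~ m).
Proof.
have Bl : {morph pure^~ q : b b' / b - b'}.
  by move=> b1 b2; apply/eqP; rewrite eq_sym subr_eq -pureDl subrK.
have Br : {morph pure b : q q' / q - q'}.
  by move=> q1 q2; apply/eqP; rewrite eq_sym subr_eq -pureDr subrK.
have [f fE] := additive_of Bl; have [g gE] := additive_of Br.
by rewrite -fE -gE !raddfMz fE gE.
Qed.

(** A common denominator merges a sum of pure tensors into one, so the kernel of a linear map on the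
    tensor product can be tested on pure tensors. *)
Lemma tensor_pure (u : T) : exists b N, (0 < N)%N /\ u = pure b (N%:R^-1).
Proof.
elim/quotW: u => s; elim: s => [|[c q] s [b [N [N0 E]]]].
  by exists 0, 1%N; split=> //; apply/esym/tensorQP/tensor_0l.
rewrite -cat1s tensor_pi_add E -/(pure c q).
pose d := `|denq q|%N.
have d0 : (0 < d)%N by rewrite absz_gt0 denq_neq0.
have nz k : (0 < k)%N -> k%:R != 0 :> rat by rewrite pnatr_eq0 -lt0n.
exists (c *~ (numq q * N) + b *~ d), (N * d)%N; rewrite muln_gt0 N0; split=> //.
rewrite pureDl !pureMz; congr (pure _ _ + pure _ _).
  rewrite -[_ *~ (_ * _)]mulrzr intrM natrM invfM [(numq q)%:~R * _]mulrC mulrACA.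
  rewrite -pmulrn mulVf ?nz // mul1r mulrC -{1}[q]divq_num_den.
  by rewrite [d%:R]pmulrn gez0_abs.
by rewrite natrM invfM -[_ *~ d%:Z]mulrzr -pmulrn mulfVK ?nz.
Qed.

End TensorRank.

Lemma linear_bijection_dim n m (phi : 'rV[rat]_n -> 'rV[rat]_m) :
  linear phi -> bijective phi -> (m <= n)%N.
Proof.
move=> phiL [psi phiK psiK].
pose M := \matrix_(i < n) phi (delta_mx 0 i).
have phiM r : phi r = r *m M.
  have phi0 : phi 0 = 0 by have := phiL (-1) 0 0; rewrite scaler0 addr0 scaleN1r addNr.
  rewrite mulmx_sum_row [in LHS](row_sum_delta r).
  elim/big_ind2: _ => // [x1 x2 y1 y2 E1 E2|i _].
    by have := phiL 1 x2 y2; rewrite !scale1r E1 E2.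
  by have := phiL (r 0 i) (delta_mx 0 i) 0; rewrite phi0 !addr0 rowK.
have : row_full M.
  apply/row_fullP; exists (\matrix_(i < m) psi (delta_mx 0 i)).
  apply/row_matrixP => i; rewrite row_mul rowK -phiM psiK.
  by rewrite rowE mulmx1.
by rewrite -col_leq_rank => /leq_trans; apply; apply: rank_leq_row.
Qed.

Lemma rank_unique (B : zmodType) n :
  inhabited (Vector.axiom n (tensorQ B)) -> rank B = n.
Proof.
move=> [[f fL fB]]; rewrite /rank; case: xgetP => [m _ [[g gL gB]]|/(_ n)]; last first.
  by case; split; exists f.
have inv_linear (V W : lmodType rat) (h k : _ -> _) (hL : linear (h : V -> W)) :
    cancel h k -> cancel k h -> linear (k : W -> V).
  by move=> hK kK a u v; apply: (can_inj hK); rewrite hL !kK.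
have [f' fK f'K] := fB; have [g' gK g'K] := gB.
apply/eqP; rewrite eqn_leq; apply/andP; split.
  apply: (@linear_bijection_dim _ _ (g \o f')).
    by move=> a u v /=; rewrite (inv_linear _ _ f f' fL fK f'K) gL.
  by exists (f \o g') => x /=; rewrite ?gK ?fK ?f'K ?g'K.
apply: (@linear_bijection_dim _ _ (f \o g')).
  by move=> a u v /=; rewrite (inv_linear _ _ g g' gL gK g'K) fL.
by exists (g \o f') => x /=; rewrite ?fK ?gK ?f'K ?g'K.
Qed.

Section CorankRank.
Variables (A B : zmodType) (K : zmodClosed A) (psi : {additive A -> B}).
Hypothesis psi_onto : forall u, exists x, psi x = u.
Hypothesis psi0 : forall x, psi x = 0 <-> x \in K.

(** The functionals f induce a linear map F from the tensor product to Q^n. It is injective because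
    they cut out K, and the dual vectors x give its inverse G. *)
Lemma corank_rank n : corank K n -> rank B = n.
Proof.
move=> [f [x [[fK fx] ker]]]; apply: rank_unique.
have [s sK] := choice psi_onto.
have fs i y : (i < n)%N -> f i (s (psi y)) = f i y.
  move=> ii; apply/eqP; rewrite -subr_eq0 -raddfB; apply/eqP/fK => //.
  by apply/psi0; rewrite raddfB sK subrr.
pose h (b : B) : 'rV[rat]_n := \row_i f i (s b).
have hpsi y i : h (psi y) 0 i = f i y by rewrite mxE fs.
have hD b b' : h (b + b') = h b + h b'.
  by apply/rowP => i; rewrite -(sK b) -(sK b') -raddfD !mxE !fs // raddfD.
have h0 : h 0 = 0 by apply: (addrI (h 0)); rewrite -hD !addr0.
pose Fl (l : seq (B * rat)) : 'rV[rat]_n := \sum_(bq <- l) bq.2 *: h bq.1.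
have Flt l l' : tensor_eq l l' -> Fl l = Fl l'.
  rewrite /Fl; elim=> {l l'}.
  - by [].
  - by move=> l l' _ ->.
  - by move=> l l' l2 _ -> _ ->.
  - by move=> l1 l1' l2 l2' _ E1 _ E2; rewrite !big_cat E1 E2.
  - by move=> l l'; rewrite !big_cat /= addrC.
  - by move=> q; rewrite big_seq1 big_nil h0 scaler0.
  - by move=> b; rewrite big_seq1 big_nil scale0r.
  - by move=> b b' q; rewrite !big_cons !big_nil /= !addr0 hD scalerDr.
  - by move=> b q q'; rewrite !big_cons !big_nil /= !addr0 scalerDl.
pose F (u : tensorQ B) := Fl (repr u).
have Fpi l : F (\pi_(tensorQ B) l) = Fl l by apply: Flt; apply: tensor_repr.
have FL : linear F.
  move=> a; elim/quotW=> l; elim/quotW=> l'.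
  have -> : a *: \pi_(tensorQ B) l + \pi_(tensorQ B) l' =
      \pi_(tensorQ B) (map (fun bq => (bq.1, a * bq.2)) l ++ l').
    by rewrite tensor_pi_add; congr (_ + _); exact: (tensor_scaling_pi a l).
  rewrite !Fpi /Fl big_cat big_map scaler_sumr; congr (_ + _).
  by apply: eq_bigr => bq _; rewrite scalerA.
have Fpure b q : F (pure b q) = q *: h b by rewrite Fpi /Fl big_seq1.
have F0 u : F u = 0 -> u = 0.
  have [b [N [N0 ->]]] := tensor_pure u; rewrite Fpure => /eqP.
  rewrite scaler_eq0 invr_eq0 pnatr_eq0 eqn0Ngt N0 => /eqP hb.
  have b0 : b = 0.
    rewrite -(sK b); apply/psi0/ker => i ii.
    by have /rowP/(_ (Ordinal ii)) := hb; rewrite !mxE.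
  by rewrite b0; apply/tensorQP/tensor_0l.
have FD u v : F (u + v) = F u + F v by have := FL 1 u v; rewrite !scale1r.
have Finj : injective F.
  move=> u v E; apply/eqP; rewrite -subr_eq0; apply/eqP/F0.
  by rewrite addrC; have := FL (-1) v u; rewrite !scaleN1r => ->; rewrite E addNr.
pose G (r : 'rV[rat]_n) : tensorQ B := \sum_(i < n) pure (psi (x i)) (r 0 i).
have GK r : F (G r) = r.
  have -> : F (G r) = \sum_(i < n) F (pure (psi (x i)) (r 0 i)).
    rewrite /G; elim/big_ind2: _ => //; last by move=> u1 u2 v1 v2 <- <-.
    by rewrite -[0]/(\pi_(tensorQ B) [::]) Fpi /Fl big_nil.
  apply/rowP => j; rewrite summxE (bigD1 j) //= big1 ?addr0.
    by rewrite Fpure !mxE fs // fx // eqxx mulr1.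
  move=> i ij; rewrite Fpure !mxE fs // fx // (_ : (_ == _) = false) ?mulr0 //.
  by apply: contraNF ij => /eqP E; apply/eqP/val_inj.
split; exists F => //; exists G => // u; apply: Finj; exact: GK.
Qed.

End CorankRank.

(** * Cantor-Bendixson ranks *)

Section SubgroupTopology.
Variable A : zmodType.
Implicit Types (S T : subgroups A) (G : zmodClosed A).

Lemma subgroups_of G : exists T : subgroups A, mem_subgroup T =i G.
Proof.
have h : @is_subgroup A (fun x => x \in G).
  by split=> [|x y]; [exact: rpred0|exact: rpredB].
by exists (exist _ (fun x => x \in G) (mem_set h)).
Qed.

Lemma subgroups_inj S T : mem_subgroup S =i mem_subgroup T -> S = T.
Proof. by move=> ST; apply: val_inj; apply/funext => x; apply: ST. Qed.

(** Evaluations are continuous with discrete values, so cylinders are neighbourhoods. Conversely,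
    the filter generated by the cylinders around S converges at every coordinate, hence in the
    product topology. *)
Lemma nbhs_subgroupsP S (N : set (subgroups A)) : nbhs S N <->
  exists F : seq A, forall T, agree F (mem_subgroup S) (mem_subgroup T) -> N T.
Proof.
split; last first.
  move=> [F FN]; have : nbhs S [set T | agree F (mem_subgroup S) (mem_subgroup T)].
    elim: F {FN} => [|x F IH]; first by apply: filterS filterT => T _ x.
    have evx : nbhs S [set T | (x \in mem_subgroup T) = (x \in mem_subgroup S)].
      have c : {for S, continuous ((fun f : {ptws A -> bool} => f x) \o
          (val : subgroups A -> {ptws A -> bool}))}.
        apply: continuous_comp; first exact: initial_continuous.
        exact: (@proj_continuous A (fun=> bool) x).
      by apply: (c [set b | b = (x \in mem_subgroup S)]); exact: discrete_set1.
    apply: filterS2 evx IH => T Tx TF y; rewrite in_cons => /predU1P[->|] //.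
    exact: TF.
  by apply: filterS.
move=> [_ [[B Bop <-] BS] BN].
pose Psi : set_system {ptws A -> bool} := [set M | exists F : seq A,
  forall f : {ptws A -> bool}, (forall x, x \in F -> f x = val S x) -> M f].
have PsiF : Filter Psi.
  split; first by exists [::].
    move=> M1 M2 [F1 FM1] [F2 FM2]; exists (F1 ++ F2) => f fF; split.
      by apply: FM1 => x xF; apply: fF; rewrite mem_cat xF.
    by apply: FM2 => x xF; apply: fF; rewrite mem_cat xF orbT.
  by move=> M1 M2 M12 [F FM]; exists F => f /FM/M12.
have cPsi : {ptws, Psi --> (val S : A -> bool)}.
  apply/cvg_sup => x M [_ [[Q Qop <-] QS] QM]; exists [:: x] => f fx.
  by apply: QM; rewrite /preimage /= fx ?mem_head.
have [F FB] : Psi B by apply: cPsi; apply: open_nbhs_nbhs.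
by exists F => T ST; apply: BN; apply: FB => x /ST.
Qed.

End SubgroupTopology.

Section CantorBendixsonRanks.
Variable A : zmodType.
Hypothesis mA : minimax A.
Implicit Types (S T : subgroups A) (G : zmodClosed A).
Variables (V : set nat) (Lcr Lncr : seq nat).
Hypothesis Vprime : forall p, V p -> prime p.
Hypothesis VP : forall p, prime p ->
  V p <-> (2 <= lp p (@trivial_subgroup A) full_subgroup)%N.
Hypothesis LcrP : forall p, p \in Lcr <-> V p.
Hypothesis Lncr_prime : forall p, p \in Lncr -> prime p /\ ~ V p.
Hypothesis LncrP : forall p, prime p -> ~ V p ->
  (0 < lp p (@trivial_subgroup A) full_subgroup)%N -> p \in Lncr.
Hypothesis Lncr_uniq : uniq Lncr.

Local Notation rk S := (rankd V Lncr (mem_subgroup S)).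
Local Notation sc S := (scat V (mem_subgroup S)).

Lemma eq_isolator (G H : zmodClosed A) : G =i H -> isolator G =i isolator H.
Proof. by move=> E x; apply/idP/idP; apply: isolator_mono => y; rewrite E. Qed.

Lemma eq_weight (G H : zmodClosed A) p : prime p -> G =i H -> weight p G = weight p H.
Proof.
move=> p_pr E; rewrite /weight; congr (_ + _)%N; first exact: eq_lp.
by apply: eq_lp => //; apply: eq_isolator.
Qed.

Lemma eq_scat (G H : zmodClosed A) : G =i H -> scat V G -> scat V H.
Proof. by move=> E scG p Vp; rewrite -(eq_weight (Vprime Vp) E) scG. Qed.

Lemma eq_rankd (G H : zmodClosed A) : G =i H -> rankd V Lncr G = rankd V Lncr H.
Proof.
move=> E; congr (_ + _)%N; first exact/(eq_gam mA)/eq_isolator_Rloc/eq_isolator.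
by apply: eq_big_seq => p /Lncr_prime[p_pr _]; apply: eq_weight.
Qed.

Lemma subgroups_ex (G : zmodClosed A) S F : agree F (mem_subgroup S) G ->
  exists2 T, mem_subgroup T =i G & agree F (mem_subgroup S) (mem_subgroup T).
Proof.
move=> SG; have [T TG] := subgroups_of G; exists T => // x xF.
by rewrite TG SG.
Qed.

(** A point of the scattered class with rank exactly n is isolated at stage n by [rankd_strict]. One
    of larger rank is a limit of points of rank one less, and a point outside the class is a limit
    of other such points, so both survive. *)
Lemma derivedP n S : derived n S <-> ~ sc S \/ (n <= rk S)%N.
Proof.
elim: n S => [|n IH] S; first by split=> // _; right.
split=> /=.
  move=> [dS niso]; have [scS|] := pselect (sc S); [right|by left].
  have : (n <= rk S)%N by have /IH[] := dS.
  rewrite leq_eqVlt => /predU1P[nE|//]; exfalso; apply: niso.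
  have [F FP] := rankd_strict mA Vprime VP LcrP Lncr_prime LncrP scS.
  split; first exact/mem_set.
  exists [set T | agree F (mem_subgroup S) (mem_subgroup T)].
    by apply/nbhs_subgroupsP; exists F.
  apply/seteqP; split=> [T [/FP[scT lt] /IH[//|nT]]|_ -> //].
  by case: lt => [/subgroups_inj //|]; rewrite -nE ltnNge nT.
move=> h; split.
  by apply/IH; case: h => [|/ltnW]; [left|right].
move=> [_ [N /nbhs_subgroupsP[F FN] /seteqP[NS _]]].
suff [T [ST dT nTS]] : exists T,
    [/\ agree F (mem_subgroup S) (mem_subgroup T), derived n T & T <> S].
  by apply: nTS; apply: NS; split=> //; apply: FN.
have [scS|nscS] := pselect (sc S).
  have [//|nS] := h; case rE : (rk S) nS => [//|m] mS.
  have [G [SG scG rG]] := scat_predecessor mA Vprime LcrP Lncr_prime Lncr_uniq F scS rE.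
  have [T TG ST] := subgroups_ex SG; have rT : rk T = m by rewrite (eq_rankd TG).
  exists T; split=> //; first by apply/IH; right; rewrite rT.
  by move=> TS; move: rT; rewrite TS rE; lia.
have [G [SG nscG nGS]] := nonscat_perfect mA Vprime VP F nscS.
have [T TG ST] := subgroups_ex SG; exists T; split=> //.
  by apply/IH; left => /(eq_scat TG).
by move=> TS; apply: nGS => x; rewrite -TG TS.
Qed.

Lemma has_CB_rankP S n : has_CB_rank S n <-> sc S /\ rk S = n.
Proof.
rewrite /has_CB_rank; split=> [[/derivedP d1 d2]|[scS <-]].
  have [scS|nsc] := pselect (sc S); last by case: d2; apply/derivedP; left.
  split=> //; case: d1 => // nS; apply/eqP; rewrite eqn_leq nS andbT leqNgt.
  by apply/negP => lt; apply: d2; apply/derivedP; right.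
split; first by apply/derivedP; right.
by move=> /derivedP[//|]; rewrite ltnn.
Qed.

(** The complement of the class is perfect. Conversely, induction on the rank excludes each point of
    the class from every perfect P: nearby points of P other than S would have smaller rank, so S
    would be isolated in P. *)
Lemma scatteredP S : scattered S <-> sc S.
Proof.
split=> [sS|scS].
  apply: contrapT => nsc; apply: sS; exists [set T | ~ sc T] => //.
  apply/seteqP; split=> // T [/set_mem nscT [N /nbhs_subgroupsP[F FN] /seteqP[NT _]]].
  have [G [TG nscG nGT]] := nonscat_perfect mA Vprime VP F nscT.
  have [T' T'G TT'] := subgroups_ex TG; apply: nGT => x; rewrite -T'G.
  have -> // : T' = T; apply: NT; split; first exact: FN.
  by move=> /(eq_scat T'G).
move=> [P perfP PS]; have [n] := ubnP (rk S); elim: n S PS scS => // n IH S PS scS.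
rewrite ltnS => rS.
have [F FP] := rankd_strict mA Vprime VP LcrP Lncr_prime LncrP scS.
have : isolated P S.
  split; first exact/mem_set.
  exists [set T | agree F (mem_subgroup S) (mem_subgroup T)].
    by apply/nbhs_subgroupsP; exists F.
  apply/seteqP; split=> [T [/FP[scT lt] PT]|_ -> //].
  case: lt => [/subgroups_inj //|lt]; exfalso.
  by apply: (IH T) => //; apply: leq_trans lt rS.
by rewrite perfP.
Qed.

(** Upper semicontinuity gives one neighbourhood on which all ranks are at most that of S; density
    of scattered points of the same rank shows that every neighbourhood attains it. *)
Lemma extended_CB_rankP (R : realType) S : extended_CB_rank R S = (rk S)%:R%:E.
Proof.
apply/eqP; rewrite eq_le; apply/andP; split.
  have [F FP] := rankd_usc mA VP Lncr_prime (mem_subgroup S).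
  pose N := [set T | agree F (mem_subgroup S) (mem_subgroup T)].
  apply: (@le_trans _ _ (ereal_sup [set n%:R%:E | n in
      [set n | exists2 y, N y & has_CB_rank y n]])).
    by apply: ereal_inf_lbound; exists N => //; apply/nbhs_subgroupsP; exists F.
  apply: ge_ereal_sup => _ [n [T /FP rT /has_CB_rankP[_ <-]] <-].
  by rewrite lee_fin ler_nat.
apply: le_ereal_inf_tmp => _ [N /nbhs_subgroupsP[F FN] <-].
have [G [SG scG rG]] := scat_dense mA Vprime LcrP Lncr_prime (mem_subgroup S) F.
have [T TG ST] := subgroups_ex SG.
apply: ereal_sup_ubound; exists (rk T); last by rewrite (eq_rankd TG) rG.
exists T; first exact: FN.
apply/has_CB_rankP; split=> //; apply: eq_scat scG => x; by rewrite TG.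
Qed.

End CantorBendixsonRanks.

Lemma sum_over_set (V : set nat) (r : seq nat) (f : nat -> nat) :
    uniq r -> (forall p, p \in r -> V p) -> (forall p, V p -> p \notin r -> f p = 0%N) ->
  (\sum_(p \in V) f p)%N = (\sum_(p <- r) f p)%N.
Proof.
move=> ur rV f0; rewrite (fsbigE r _ ur) // big_mkcond /= big_seq [RHS]big_seq.
by apply: eq_bigr => p /rV pV; rewrite (mem_set pV).
Qed.

(** * Reduction of the sums over all primes to finite lists *)

Section PrimeLists.
Variables (A : zmodType) (S : zmodClosed A) (V : set nat) (r : seq nat) (N : nat).
Hypothesis mA : minimax A.
Hypothesis NP : forall p, prime p -> (N < p)%N ->
  lp p (@trivial_subgroup A) full_subgroup = 0%N.
Hypothesis ur : uniq r.
Hypothesis rP : forall p, p \in r <-> V p /\ (p <= N)%N.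
Hypothesis Vprime : forall p, V p -> prime p.

Lemma kappa_sumE :
  kappa_sum V {ideal_quot S} = (\sum_(p <- r) lp p (isolator S) full_subgroup)%N.
Proof.
rewrite /kappa_sum (sum_over_set ur) => [|p /rP[]//|p Vp pr].
  by apply: eq_bigr => p _; apply: kappa_ideal_quot.
rewrite kappa_ideal_quot; apply/eqP; rewrite -leqn0 -(NP (Vprime Vp)).
  by apply: lp_sub => //; apply: Vprime.
by rewrite ltnNge; apply: contra pr => pN; apply/rP.
Qed.

Lemma ell_sumE :
  ell_sum V (subgroup_type S) = (\sum_(p <- r) lp p trivial_subgroup S)%N.
Proof.
rewrite /ell_sum (sum_over_set ur) => [|p /rP[]//|p Vp pr].
  by apply: eq_big_seq => p /rP[/Vprime p_pr _]; apply: ell_subgroup.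
rewrite ell_subgroup ?Vprime //; apply/eqP; rewrite -leqn0 -(NP (Vprime Vp)).
  by apply: lp_sub => //; apply: Vprime.
by rewrite ltnNge; apply: contra pr => pN; apply/rP.
Qed.

End PrimeLists.

Theorem theoremG (R : realType) (A : zmodType) (S : subgroups A)
    (minimaxA : minimax A) :
  (scattered S <->
     kappa_sum (cr A) {ideal_quot (mem_subgroup S)} = 0%N /\
     ell_sum (cr A) (subgroup_type (mem_subgroup S)) = 0%N) /\
  extended_CB_rank R S = (dA S)%:R%:E.
Proof.
have [N NP] := lp_large_prime minimaxA.
(* This set is [cr A] again, written in the form in which [gamma (ncr A)] refers to it. *)
pose V := primes_set `\` ncr A.
have VE p : V p <-> cr A p.
  split=> [[p_pr /not_andP[//|/contrapT //]]|crp]; split; first by case: crp.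
  by case.
have Vprime p : V p -> prime p by case.
have VP p : prime p -> V p <-> (2 <= lp p (@trivial_subgroup A) full_subgroup)%N.
  by move=> p_pr; rewrite VE /cr /= ell_full; split=> [[]|].
(* All lengths vanish for primes above N, so the lists may be cut off there. *)
pose Lcr := [seq p <- iota 0 N.+1 | `[< V p >]].
pose Lncr := [seq p <- iota 0 N.+1 | `[< ncr A p >]].
have Lin (W : set nat) p :
    p \in [seq p <- iota 0 N.+1 | `[< W p >]] <-> W p /\ (p <= N)%N.
  rewrite mem_filter mem_iota /= add0n ltnS.
  by split=> [/andP[/asboolP]|[/asboolP -> ->]].
have leN p : prime p -> (0 < lp p (@trivial_subgroup A) full_subgroup)%N -> (p <= N)%N.
  by move=> p_pr h; rewrite leqNgt; apply/negP => /(NP p p_pr) E; rewrite E in h.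
have LcrP p : p \in Lcr <-> V p.
  rewrite Lin; split=> [[]//|Vp]; split=> //; have p_pr := Vprime p Vp.
  by apply: leN => //; apply: leq_trans ((VP p p_pr).1 Vp).
have Lncr_prime p : p \in Lncr -> prime p /\ ~ V p.
  by move=> /Lin[[p_pr nc] _]; split=> // /VE.
have LncrP p : prime p -> ~ V p ->
    (0 < lp p (@trivial_subgroup A) full_subgroup)%N -> p \in Lncr.
  move=> p_pr nV h; apply/Lin; split; last exact: leN.
  by split=> // /VE.
have Lncr_uniq : uniq Lncr by rewrite filter_uniq // iota_uniq.
have Lcr_uniq : uniq Lcr by rewrite filter_uniq // iota_uniq.
have Lcr' p : p \in Lcr <-> cr A p /\ (p <= N)%N by rewrite Lin VE.
split.
  rewrite (scatteredP minimaxA Vprime VP LcrP Lncr_prime LncrP).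
  have crprime p : cr A p -> prime p by case.
  rewrite (kappa_sumE _ minimaxA NP Lcr_uniq Lcr' crprime).
  rewrite (ell_sumE _ minimaxA NP Lcr_uniq Lcr' crprime).
  split=> [scS|[/eqP k0 /eqP l0] p Vp].
    split; rewrite big_seq big1 // => p /LcrP/scS/eqP; rewrite addn_eq0;
      by case/andP => /eqP ? /eqP.
  have pL := (LcrP p).2 Vp.
  move: k0 l0; rewrite !(big_rem p pL) /= !addn_eq0 => /andP[/eqP k0 _] /andP[/eqP l0 _].
  by rewrite /weight k0 l0.
rewrite (extended_CB_rankP minimaxA Vprime VP LcrP Lncr_prime LncrP Lncr_uniq).
congr ((_)%:R%:E); rewrite /dA /rankd -addnA; congr (_ + _)%N.
  have [psi [psi_onto psi0]] := Uker_map (mem_subgroup S) V.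
  by rewrite /gamma (corank_rank psi_onto psi0 (gamP minimaxA V (mem_subgroup S))).
have ncrprime p : ncr A p -> prime p by case.
rewrite (kappa_sumE _ minimaxA NP Lncr_uniq (Lin _) ncrprime).
rewrite (ell_sumE _ minimaxA NP Lncr_uniq (Lin _) ncrprime).
by rewrite -big_split; apply: eq_bigr => p _; rewrite /weight addnC.
Qed.
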